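(* Let $T$ be a map defined on the Dirichlet space $\mathcal{D}$ with values in $\mathrm{Hol}(\mathbb{D})$. The following are equivalent: (i) $T$ maps $\mathcal{D}$ into $\mathcal{D}$, and $T:\mathcal{D}\to\mathcal{D}$ is a continuous linear map sending finite Blaschke products to finite Blaschke products. (ii) There are finite Blaschke products $\phi,\psi$, with $\phi$ non-constant, such that $$Tf=\psi\cdot(f\circ\phi)\quad\text{for all } f\in\mathcal{D}.$$ If, further, $T(\mathcal{D})=\mathcal{D}$, then (in (ii)) $\psi$ is a unimodular constant and $\phi$ is an automorphism of $\mathbb{D}$, and consequently $T$ is invertible.
   Context: $\mathbb{D}$ is the open unit disk in $\mathbb{C}$ and $\mathrm{Hol}(\mathbb{D})$ is the space of holomorphic functions on $\mathbb{D}$. The Dirichlet space $\mathcal{D}$ consists of those $f\in\mathrm{Hol}(\mathbb{D})$ such that $\mathcal{D}(f):=\frac{1}{\pi}\int_{\mathbb{D}}|f'(z)|^2\,dA(z)<\infty$, where $dA$ is area (Lebesgue) measure. It is a subspace of the Hardy space $H^2$ and is a Hilbert space with the norm given by $\|f\|_{\mathcal{D}}^2:=\|f\|_{H^2}^2+\mathcal{D}(f)$, where $\|f\|_{H^2}^2=\sup_{r<1}\frac{1}{2\pi}\int_0^{2\pi}|f(re^{it})|^2\,dt$. A finite Blaschke product is a function of the form $B(z)=c\prod_{n=1}^{N}\frac{a_n-z}{1-\overline{a_n}z}$ with $N\ge 0$, $a_1,\dots,a_N\in\mathbb{D}$ and $c$ a unimodular constant (so unimodular constants, $N=0$, are included).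 An automorphism of $\mathbb{D}$ is a biholomorphic map of $\mathbb{D}$ onto itself. *)

(* Defs.v *)
From HB Require Import structures.
From mathcomp Require Import all_boot all_order all_algebra.
From mathcomp Require Import all_classical all_reals all_analysis.
From mathcomp Require Import measurable_realfun complex.
From mathcomp Require Import lra.

Set Implicit Arguments.
Unset Strict Implicit.
Unset Printing Implicit Defensive.

Import Order.TTheory GRing.Theory Num.Theory.
Import numFieldNormedType.Exports.
Import Normc.

Local Open Scope classical_set_scope.
Local Open Scope ring_scope.
Local Open Scope complex_scope.

Section derive_scaleD.
Context {K : numFieldType} (a : K) (f g : K^o -> K^o) (z : K).
Hypotheses (df : derivable f z 1) (dg : derivable g z 1).

Lemma derivable_scaleD : derivable ((fun w => a * f w + g w) : K^o -> K^o) z 1.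
Proof. by apply: (@derivableD K K^o K^o (a *: f) g) => //; exact: derivableZ. Qed.

Lemma derive_scaleD :
  derive1 ((fun w => a * f w + g w) : K^o -> K^o) z = a * derive1 f z + derive1 g z.
Proof.
rewrite !derive1E.
rewrite [LHS](@deriveD K K^o K^o (a *: f) g)//; last exact: derivableZ.
by rewrite deriveZ.
Qed.

End derive_scaleD.

Section holomorphic_functions.
Context {R : realType}.
Local Notation C := R[i].

Definition unit_disc : set C := [set z | `|z| < 1].

(* [C^o] carries the normed module structure of [C] over itself, so these are
   complex differentiability and the complex derivative. *)
Definition complex_derivable (f : C -> C) (z : C) : Prop :=
  derivable (f : C^o -> C^o) z 1.

Definition complex_derive (f : C -> C) (z : C) : C :=
  derive1 (f : C^o -> C^o) z.

(* A holomorphic function on the disc is represented by its extension by 0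
   to [C], so that equality in [hol] is equality of functions on the disc. *)
Definition hol_pred : {pred C -> C} := mem [set f : C -> C |
  (forall z, unit_disc z -> complex_derivable f z) /\
  (forall z, ~ unit_disc z -> f z = 0)].

Lemma complex_derivableMD (a : C) (f g : C -> C) z :
  complex_derivable f z -> complex_derivable g z ->
  complex_derivable (fun w => a * f w + g w) z.
Proof. exact: (@derivable_scaleD C a f g z). Qed.

Lemma complex_deriveMD (a : C) (f g : C -> C) z :
  complex_derivable f z -> complex_derivable g z ->
  complex_derive (fun w => a * f w + g w) z =
  a * complex_derive f z + complex_derive g z.
Proof. exact: (@derive_scaleD C a f g z). Qed.

Lemma hol_submod_closed : submod_closed hol_pred.
Proof.
split.
  by rewrite inE; split => // z _; exact: derivable_cst.
move=> a f g; rewrite !inE => -[df f0] [dg g0]; split=> z Dz.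
  by apply: complex_derivableMD; [exact: df | exact: dg].
have -> : (a *: f + g) z = a * f z + g z by [].
by rewrite f0// g0// mulr0 addr0.
Qed.

HB.instance Definition _ := GRing.isSubmodClosed.Build C (C -> C) hol_pred
  hol_submod_closed.

Record hol := Hol { hol_fun :> C -> C; hol_funP : hol_fun \in hol_pred }.

HB.instance Definition _ := [isSub for hol_fun].
HB.instance Definition _ := [Choice of hol by <:].
HB.instance Definition _ := [SubChoice_isSubLmodule of hol by <:].

End holomorphic_functions.
Arguments hol R : clear implicits.

Section measurability.
Context {R : realType}.
Local Notation C := R[i].
Local Notation Re := (@complex.Re R).
Local Notation Im := (@complex.Im R).
Local Notation D := [set p : R * R | unit_disc (p.1 +i* p.2)].

Let normcE (z : C) : normc z ^+ 2 = Re z ^+ 2 + Im z ^+ 2.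
Proof. by case: z => a b /=; rewrite sqr_sqrtr// addr_ge0 ?sqr_ge0. Qed.

Let normc_ge0 (z : C) : 0 <= normc z.
Proof. by case: z => a b /=; exact: sqrtr_ge0. Qed.

Let Re_le_normc (z : C) : `|Re z| <= normc z.
Proof.
rewrite -(@ler_pXn2r _ 2)// ?nnegrE// normcE real_normK ?num_real//.
by rewrite lerDl sqr_ge0.
Qed.

Let Im_le_normc (z : C) : `|Im z| <= normc z.
Proof.
rewrite -(@ler_pXn2r _ 2)// ?nnegrE// normcE real_normK ?num_real//.
by rewrite lerDr sqr_ge0.
Qed.

Let normc_le (z : C) : normc z <= `|Re z| + `|Im z|.
Proof.
rewrite -(@ler_pXn2r _ 2)// ?nnegrE ?addr_ge0// normcE sqrrD !real_normK ?num_real//.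
by rewrite lerD2r lerDl mulrn_wge0// mulr_ge0.
Qed.

Let open_measurable_box (P : set C) :
  (forall z, P z -> exists2 e : R, 0 < e & forall w, normc (w - z) < e -> P w) ->
  measurable [set p : R * R | P (p.1 +i* p.2)].
Proof.
move=> Pop.
pose I := (rat * rat * nat)%type.
pose B (q : I) : set (R * R) :=
  (`](ratr q.1.1 - q.2.+1%:R^-1), (ratr q.1.1 + q.2.+1%:R^-1)[ `*`
   `](ratr q.1.2 - q.2.+1%:R^-1), (ratr q.1.2 + q.2.+1%:R^-1)[)%classic.
pose F (q : I) := [set p | B q p /\ B q `<=` [set p : R * R | P (p.1 +i* p.2)]].
have -> : [set p : R * R | P (p.1 +i* p.2)] = \bigcup_q F q.
  apply/seteqP; split => [[x y] /= /Pop[e e0 Pe]|p [q _ [Bp]]]; last exact.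
  have e40 : 0 < e / 4 by rewrite divr_gt0.
  have [n _ /(_ n (leqnn n))] := near_infty_natSinv_lt (PosNum e40).
  rewrite /= => ne.
  have n0 : (0 : R) < n.+1%:R^-1 by rewrite invr_gt0.
  set t : R := n.+1%:R^-1 in ne n0.
  have [q1 /itvP q1P] := @rat_in_itvoo R (x - t) (x + t) ltac:(lra).
  have [q2 /itvP q2P] := @rat_in_itvoo R (y - t) (y + t) ltac:(lra).
  have q1a : x - t < ratr q1 by rewrite q1P.
  have q1b : ratr q1 < x + t by rewrite q1P.
  have q2a : y - t < ratr q2 by rewrite q2P.
  have q2b : ratr q2 < y + t by rewrite q2P.
  exists ((q1, q2), n) => //; split.
    by split; rewrite /= in_itv/= -/t; apply/andP; split; lra.
  move=> [u v] [] /=; rewrite !in_itv/= -/t => /andP[u1 u2] /andP[v1 v2].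
  apply: Pe; apply: (le_lt_trans (normc_le _)) => /=.
  have : `|u - x| < t + t by rewrite ltr_norml; apply/andP; split; lra.
  have : `|v - y| < t + t by rewrite ltr_norml; apply/andP; split; lra.
  lra.
apply: countable_bigcupT_measurable => [|q]; first exact: countableP.
have [h|h] := pselect (B q `<=` [set p : R * R | P (p.1 +i* p.2)]).
  have -> : F q = B q by apply/seteqP; split => p // [].
  by apply: measurableX; exact: measurable_itv.
have -> : F q = set0 by apply/seteqP; split => p // [_ /h].
exact: measurable0.
Qed.

Let unit_discP (z : C) : unit_disc z <-> normc z < 1.
Proof. by rewrite /unit_disc/= -ltcR. Qed.

Lemma measurable_disc : measurable D.
Proof.
apply: open_measurable_box => z /unit_discP z1.
exists (1 - normc z) => [|w wz]; first lra.
apply/unit_discP.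
have := le_normcD (w - z) z; rewrite subrK.
lra.
Qed.

Let continuous_eps (f : C -> C) z : complex_derivable f z ->
  forall e : R, 0 < e -> exists2 d : R, 0 < d &
    forall w, normc (w - z) < d -> normc (f w - f z) < e.
Proof.
move=> /derivable1_diffP/differentiable_continuous/cvgrPdist_lt cf e e0.
have /cf : 0 < e%:C :> C by rewrite ltcR.
move=> /nbhs_ballP[[d d'] /=]; rewrite ltcE/= => /andP[/eqP -> d0] h.
exists d => // w wz; rewrite -ltcR -[X in X < _]/(`|f w - f z|) distrC.
by apply: h; rewrite /ball/= distrC -[X in X < _]/((normc (w - z))%:C) ltcR.
Qed.

Let derive_eps (f : C -> C) z : complex_derivable f z ->
  forall e : R, 0 < e -> exists2 d : R, 0 < d &
    forall h, h != 0 -> normc h < d ->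
    normc (h^-1 * (f (h + z) - f z) - complex_derive f z) < e.
Proof.
move=> df0 e e0.
have : h^-1 *: ((f \o shift z) (h *: (1 : C^o)) - f z) @[h --> (0 : C^o)^'] -->
    (complex_derive f z : C^o).
  by rewrite /complex_derive derive1E; exact: df0.
move=> /(@cvgrPdist_lt C C^o) df.
have /df : 0 < e%:C :> C by rewrite ltcR.
move=> /nbhs_ballP[[d d'] /=]; rewrite ltcE/= => /andP[/eqP -> d0] H.
exists d => // h h0 hd.
rewrite -ltcR -[X in X < _]/(`|h^-1 * (f (h + z) - f z) - complex_derive f z|) distrC.
have -> : h + z = h *: (1 : C^o) + z by rewrite /GRing.scale/= mulr1.
by apply: H => //; rewrite /ball/= sub0r normrN -[X in X < _]/((normc h)%:C) ltcR.
Qed.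

Let measurable_part (f : C -> C) (q : C -> R) :
  (forall v w, q (v - w) = q v - q w) ->
  (forall w, `|q w| <= normc w) ->
  (forall z, unit_disc z -> complex_derivable f z) ->
  (forall z, ~ unit_disc z -> f z = 0) ->
  measurable_fun setT (fun p : R * R => q (f (p.1 +i* p.2))).
Proof.
move=> qB qle df f0.
have q0 : q 0 = 0 by rewrite -(subrr 0) qB subrr.
have -> : (fun p : R * R => q (f (p.1 +i* p.2))) =
          (fun p : R * R => q (f (p.1 +i* p.2))) \_ D.
  apply/funext => p; rewrite patchE; case: ifPn => // /negP.
  by rewrite inE => Dp; rewrite f0.
apply/(measurable_restrictT _ measurable_disc).
apply: (measurability _ (RGenOInfty.measurableE R)) => /= _ [_ [a ->] <-].
rewrite preimage_itvoy.
have := @open_measurable_box [set z | unit_disc z /\ a < q (f z)].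
apply => z [Dz az].
have e0 : 0 < q (f z) - a by lra.
have [d d0 dP] := continuous_eps (df z Dz) e0.
have n1 : normc z < 1 by apply/unit_discP.
exists (Num.min d (1 - normc z)); first by rewrite lt_min d0; lra.
move=> w; rewrite lt_min => /andP[/dP fwz wz]; split.
  apply/unit_discP; rewrite -(subrK z w).
  have := le_normcD (w - z) z; lra.
have := le_lt_trans (qle _) fwz; rewrite qB ltr_norml; lra.
Qed.

Let measurable_derive_part (f : C -> C) (q : C -> R) :
  (forall v w, q (v - w) = q v - q w) ->
  (forall w, `|q w| <= normc w) ->
  (forall (n : nat) w, q (n%:R * w) = n%:R * q w) ->
  f \in hol_pred ->
  measurable_fun D (fun p : R * R => q (complex_derive f (p.1 +i* p.2))).
Proof.
move=> qB qle qM; rewrite inE => -[df f0].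
pose h (n : nat) (p : R * R) : R :=
  n.+1%:R * (q (f ((p.1 + n.+1%:R^-1) +i* p.2)) - q (f (p.1 +i* p.2))).
apply: (@measurable_fun_cvg _ _ _ D h).
  move=> n; apply: measurable_funTS; apply: measurable_funM => //.
  have mq := measurable_part qB qle df f0.
  apply: measurable_funB => //.
  have mt : measurable_fun setT (fun p : R * R => (p.1 + n.+1%:R^-1, p.2)).
    by apply: measurable_fun_pair => //; apply: measurable_funD.
  exact: (measurableT_comp mq mt).
move=> [x y] Dp; apply/cvgrPdist_lt => e e0.
have [d d0 dP] := derive_eps (df _ Dp) e0.
have [N _ NP] := near_infty_natSinv_lt (PosNum d0).
exists N => // n /NP /= nd; rewrite /h/=.
have nn : ((n.+1%:R^-1)%:C)^-1 = n.+1%:R :> C by rewrite -fmorphV invrK rmorph_nat.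
have t0 : (n.+1%:R^-1)%:C != 0 :> C by rewrite fmorph_eq0 invr_eq0 pnatr_eq0.
have nt : normc (n.+1%:R^-1)%:C = n.+1%:R^-1 :> R.
  by rewrite /= expr0n addr0 sqrtr_sqr ger0_norm.
have := dP _ t0; rewrite nt => /(_ nd) /(le_lt_trans (qle _)).
rewrite qB nn qM qB distrC.
by rewrite /= /GRing.add/= add0r [_ + x]addrC.
Qed.

Lemma measurable_sqr_derive (f : C -> C) : f \in hol_pred ->
  measurable_fun D (fun p : R * R => (normc (complex_derive f (p.1 +i* p.2)) ^+ 2)).
Proof.
move=> fh.
apply: (@eq_measurable_fun _ _ _ _ _ (fun p : R * R =>
    Re (complex_derive f (p.1 +i* p.2)) ^+ 2 + Im (complex_derive f (p.1 +i* p.2)) ^+ 2)).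
  by move=> p _; rewrite normcE.
have natM (n : nat) w : (Re (n%:R * w) = n%:R * Re w) * (Im (n%:R * w) = n%:R * Im w).
  have -> : n%:R * w = n%:R%:C * w by rewrite rmorph_nat.
  by case: w => a b /=; rewrite !mul0r subr0 addr0.
apply: measurable_funD; apply: measurable_funX.
- by apply: (@measurable_derive_part f Re) => // [[? ?] [? ?]|n w]//; rewrite natM.
- by apply: (@measurable_derive_part f Im) => // [[? ?] [? ?]|n w]//; rewrite natM.
Qed.

Lemma sqr_normcMD (a u v : C) :
  normc (a * u + v) ^+ 2 <= 2 * normc a ^+ 2 * normc u ^+ 2 + 2 * normc v ^+ 2.
Proof.
case: a u v => [a1 a2] [u1 u2] [v1 v2]; rewrite !normcE/=.
have := sqr_ge0 (a1 * u1 - a2 * u2 - v1); have := sqr_ge0 (a1 * u2 + a2 * u1 - v2).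
nra.
Qed.

End measurability.

Section dirichlet_space.
Context {R : realType}.
Local Notation C := R[i].
Local Notation leb := (@lebesgue_measure R).

Definition dirichlet_energy (f : C -> C) : \bar R :=
  ((pi^-1)%:E * \int[(leb \x leb)%E]_(p in [set p | unit_disc (p.1 +i* p.2)])
     (normc (complex_derive f (p.1 +i* p.2)) ^+ 2)%:E)%E.

Definition hardy_sqnorm (f : C -> C) : \bar R :=
  ereal_sup [set (((2 * pi)^-1)%:E * \int[leb]_(t in `[0%R, (2 * pi)%R])
     (normc (f ((r * cos t) +i* (r * sin t))) ^+ 2)%:E)%E
   | r in [set r : R | 0 <= r < 1]].

(* Kept extended-real valued, so that no default value replaces an infinite
   norm. *)
Definition dirichlet_norm (f : C -> C) : \bar R :=
  ((hardy_sqnorm f + dirichlet_energy f) `^ 2^-1)%E.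

Definition dirichlet_pred : {pred hol R} :=
  mem [set f : hol R | (dirichlet_energy f < +oo)%E].

Lemma dirichlet_submod_closed : submod_closed dirichlet_pred.
Proof.
pose D := [set p : R * R | unit_disc (p.1 +i* p.2)].
have mD : measurable D by exact: measurable_disc.
have pi0 : (0 < (pi : R)^-1)%R by rewrite invr_gt0 pi_gt0.
split.
  rewrite inE /dirichlet_pred /= /dirichlet_energy.
  rewrite integral0_eq ?mule0// => p _.
  have -> : complex_derive ((0 : hol R) : C -> C) (p.1 +i* p.2) = 0.
    by rewrite /complex_derive derive1E; exact: (@derive_cst C C^o C^o).
  by rewrite normc0 expr0n.
have finE (f : hol R) : (dirichlet_energy f < +oo)%E =
    (\int[(leb \x leb)%E]_(p in D)
      (normc (complex_derive f (p.1 +i* p.2)) ^+ 2)%:E < +oo)%E.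
  apply/idP/idP; last by move=> h; rewrite /dirichlet_energy lte_mul_pinfty// lee_fin ltW.
  rewrite /dirichlet_energy; case: (integral _ _ _) => [r| |]//; rewrite ?ltry//.
  by rewrite gt0_muley.
have memE (h : hol R) : (h \in dirichlet_pred) =
    (\int[(leb \x leb)%E]_(p in D)
      (normc (complex_derive h (p.1 +i* p.2)) ^+ 2)%:E < +oo)%E.
  by rewrite -finE; apply/idP/idP; [exact: set_mem | exact: mem_set].
move=> a f g; rewrite (memE f) (memE g) => ff gf; rewrite memE.
have mh (h : hol R) : measurable_fun D (fun p : R * R =>
    (normc (complex_derive h (p.1 +i* p.2)) ^+ 2)%:E).
  by apply/measurable_EFinP; exact: (measurable_sqr_derive (hol_funP h)).
have h0 (h : hol R) (p : R * R) : D p ->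
    (0 <= (normc (complex_derive h (p.1 +i* p.2)) ^+ 2)%:E)%E.
  by move=> _; rewrite lee_fin sqr_ge0.
have fgE : hol_fun (a *: f + g) = (fun w => a * f w + g w) by [].
pose k : R := 2 * normc a ^+ 2.
have k0 : 0 <= k by rewrite mulr_ge0// sqr_ge0.
apply: (@le_lt_trans _ _ (\int[(leb \x leb)%E]_(p in D)
    (k%:E * (normc (complex_derive f (p.1 +i* p.2)) ^+ 2)%:E +
     2%:E * (normc (complex_derive g (p.1 +i* p.2)) ^+ 2)%:E))%E).
  apply: ge0_le_integral => //.
  - exact: h0.
  - exact: mh.
  - by apply: emeasurable_funD; apply: measurable_funeM; exact: mh.
  - move=> p Dp; rewrite -!EFinM -EFinD lee_fin.
    rewrite fgE complex_deriveMD ?sqr_normcMD//.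
      by have [df _] := set_mem (hol_funP f); exact: df.
    by have [dg _] := set_mem (hol_funP g); exact: dg.
have cf0 (c : R) (h : hol R) : 0 <= c -> forall p : R * R, D p ->
    (0 <= c%:E * (normc (complex_derive h (p.1 +i* p.2)) ^+ 2)%:E)%E.
  by move=> c0 p Dp; apply: mule_ge0; [rewrite lee_fin | exact: h0].
have cmf (c : R) (h : hol R) : measurable_fun D (fun p : R * R =>
    c%:E * (normc (complex_derive h (p.1 +i* p.2)) ^+ 2)%:E)%E.
  by apply: measurable_funeM; exact: mh.
have cint (c : R) (h : hol R) : 0 <= c ->
    (\int[(leb \x leb)%E]_(p in D)
      (normc (complex_derive h (p.1 +i* p.2)) ^+ 2)%:E < +oo)%E ->
    (\int[(leb \x leb)%E]_(p in D)
      (c%:E * (normc (complex_derive h (p.1 +i* p.2)) ^+ 2)%:E) < +oo)%E.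
  move=> c0 hfin.
  rewrite (ge0_integralZl_EFin (leb \x leb)%E mD (h0 h) (mh h) c0).
  by apply: lte_mul_pinfty; rewrite ?lee_fin.
rewrite (ge0_integralD (leb \x leb)%E mD (cf0 k f k0) (cmf k f) (cf0 2 g (ler0n _ 2)) (cmf 2 g)).
by apply: lte_add_pinfty; apply: cint.
Qed.

HB.instance Definition _ := GRing.isSubmodClosed.Build C (hol R) dirichlet_pred
  dirichlet_submod_closed.

Record dirichlet := Dirichlet {
  dirichlet_hol :> hol R;
  dirichlet_holP : dirichlet_hol \in dirichlet_pred }.

HB.instance Definition _ := [isSub for dirichlet_hol].
HB.instance Definition _ := [Choice of dirichlet by <:].
HB.instance Definition _ := [SubChoice_isSubLmodule of dirichlet by <:].

Definition dirichlet_continuous (T : dirichlet -> hol R) : Prop :=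
  forall (f : dirichlet) (e : R), 0 < e -> exists2 d : R, 0 < d &
    forall g : dirichlet, (dirichlet_norm (g - f)%R < d%:E)%E ->
      (dirichlet_norm (T g - T f)%R < e%:E)%E.

Definition finite_blaschke (B : C -> C) : Prop :=
  exists (N : nat) (a : 'I_N -> C) (c : C),
    [/\ forall n, unit_disc (a n), `|c| = 1 &
        forall z, unit_disc z ->
          B z = c * \prod_(n < N) ((a n - z) / (1 - (a n)^*%C * z))].

Definition constant_on_disc (f : C -> C) : Prop :=
  exists c : C, forall z, unit_disc z -> f z = c.

Definition unimodular_constant (f : C -> C) : Prop :=
  exists2 c : C, `|c| = 1 & forall z, unit_disc z -> f z = c.

Definition disc_automorphism (f : hol R) : Prop :=
  exists g : hol R,
    [/\ forall z, unit_disc z -> unit_disc (f z),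
        forall z, unit_disc z -> unit_disc (g z),
        forall z, unit_disc z -> g (f z) = z &
        forall z, unit_disc z -> f (g z) = z].

Definition bounded_blaschke_preserver (T : dirichlet -> hol R) : Prop :=
  [/\ forall f, T f \in dirichlet_pred,
      linear T,
      dirichlet_continuous T &
      forall f : dirichlet, finite_blaschke f -> finite_blaschke (T f)].

Definition weighted_composition (phi psi : hol R) (T : dirichlet -> hol R) : Prop :=
  forall (f : dirichlet) z, unit_disc z -> T f z = psi z * f (phi z).

(* Invertibility of [T] as a continuous linear operator of the Dirichlet space. *)
Definition dirichlet_invertible (T : dirichlet -> hol R) : Prop :=
  exists T' S : dirichlet -> dirichlet,
    [/\ forall f, T f = T' f :> hol R,
        cancel T' S, cancel S T',
        linear S & dirichlet_continuous (fun f => S f : hol R)].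

End dirichlet_space.
Arguments dirichlet R : clear implicits.

(* Main.v *)
(* With [a_n] the Taylor coefficients of [f], the squared Dirichlet norm is [sum (1 + kappa n) |a_n|^2] for a
   constant [kappa > 0]: Parseval's identity gives the Hardy part, and averaging over rotations the energy.

   Sufficiency. On the unit circle [|phi| = |psi| = 1] and the derivative [theta] of [arg phi] lies between
   two positive constants. The powers of [phi] are orthogonal for the weight [theta], so for a polynomial [p]
   the norm of [psi * (p o phi)] is at most a constant times the norm of [p]; general [f] follow coefficientwise.

   Necessity. Let [h_n = T z^n] and [b_a = (a - z) / (1 - a^* z)]. As [T (z^n b_a)] is a Blaschke product it is
   bounded by 1, and its expansion in [a] shows [|a h_n - h_{n+1} - a^* h_{n+2}| <= 1 + 4 |a|^2], up to the
   circle. There the three functions are unimodular, and letting [a] tend to 0 in a suitable direction gives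
   [h_n h_{n+2} = h_{n+1}^2], first on the circle and then on the disc. Hence [h_0 h_{n+1} = h_1 h_n], and
   [|h_n| <= 1] for all [n] forces [|h_1| <= |h_0|], so that [h_1 = h_0 phi] with [phi] a Blaschke product and
   [h_n = psi phi^n] with [psi = h_0]. If [phi] were a constant [d], the polynomials
   [sum_{k <= n} d^*^k z^k / k], divided by the harmonic numbers, would tend to 0 while [T] maps them to [psi].
   Density of the polynomials concludes.

   Surjectivity. The constant 1 is in the range, so [psi] has no zeros; [z] is in the range, so [phi] is
   injective, and a Blaschke product of degree at least 2 is not. *)

Require Import Defs.
From HB Require Import structures.
From mathcomp Require Import all_boot all_order all_algebra.
From mathcomp Require Import all_classical all_reals all_analysis.
From mathcomp Require Import measurable_realfun complex.
From mathcomp Require Import ring lra.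

Set Implicit Arguments.
Unset Strict Implicit.
Unset Printing Implicit Defensive.

Import Order.TTheory GRing.Theory Num.Theory.
Import numFieldNormedType.Exports.
Import Normc.

Local Open Scope classical_set_scope.
Local Open Scope ring_scope.
Local Open Scope complex_scope.

(** Holomorphy in the statement is complex differentiability at each point, and the norm is
    extended-real. Taylor expansions are reached through averages over circles: in the coordinate
    log w an annulus is a rectangle, so Goursat's lemma makes such averages independent of the
    radius. Norms are handled through the partial sums of their coefficient series, which are always
    finite; a norm estimate becomes a bound uniform in the length of the sum. Constants are not
    optimized, since continuity asks only for some bound.

    The expansion of z^n b_a in powers of z is infinite, while |T f| <= 1 comes from f being a
    Blaschke product. The identity 1 / (1 - a^* z) = (1 - a^* b_a) / (1 - |a|^2) turns the remainder
    after the first-order part into a finite combination of Blaschke products, and this is the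
    source of the explicit bound 1 + 4 |a|^2.

    That b_a composed with a Blaschke product is again a Blaschke product is obtained by algebra:
    the composition is a quotient of polynomials, and its numerator is factored over the complex
    numbers. *)

Section normc_facts.
Context {R : realType}.
Local Notation C := R[i].
Implicit Types z w : C.

Lemma sqr_normc z : normc z ^+ 2 = complex.Re z ^+ 2 + complex.Im z ^+ 2.
Proof. by case: z => a b /=; rewrite sqr_sqrtr// addr_ge0 ?sqr_ge0. Qed.

Lemma normc_ge0 z : 0 <= normc z.
Proof. by case: z => a b /=; exact: sqrtr_ge0. Qed.
Hint Resolve normc_ge0 : core.

Lemma ler_Re_normc z : `|complex.Re z| <= normc z.
Proof.
rewrite -(@ler_pXn2r _ 2)// ?nnegrE// sqr_normc real_normK ?num_real//.
by rewrite lerDl sqr_ge0.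
Qed.

Lemma ler_Im_normc z : `|complex.Im z| <= normc z.
Proof.
rewrite -(@ler_pXn2r _ 2)// ?nnegrE// sqr_normc real_normK ?num_real//.
by rewrite lerDr sqr_ge0.
Qed.

Lemma ler_normc_ReIm z : normc z <= `|complex.Re z| + `|complex.Im z|.
Proof.
rewrite -(@ler_pXn2r _ 2)// ?nnegrE ?addr_ge0// sqr_normc sqrrD !real_normK ?num_real//.
by rewrite lerD2r lerDl mulrn_wge0// mulr_ge0.
Qed.

Lemma normc_eq0 z : (normc z == 0) = (z == 0).
Proof. by apply/eqP/eqP => [/eq0_normc//|->]; rewrite normc0. Qed.

Lemma normc_gt0 z : (0 < normc z) = (z != 0).
Proof. by rewrite lt_def normc_eq0 normc_ge0 andbT. Qed.

Lemma normcC (x : R) : normc x%:C = `|x|.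
Proof. by rewrite /= expr0n addr0 sqrtr_sqr. Qed.

Lemma normcnat (n : nat) : normc (n%:R : C) = n%:R.
Proof. by rewrite -(rmorph_nat (real_complex R)) normcC ger0_norm. Qed.

Lemma normc_i : normc ('i : C) = 1.
Proof. by rewrite /= expr0n add0r expr1n sqrtr1. Qed.

Lemma normc_conj z : normc z^*%C = normc z.
Proof. by case: z => a b /=; rewrite sqrrN. Qed.

Lemma normcX z n : normc (z ^+ n) = normc z ^+ n.
Proof. by elim: n => [|n IH]; rewrite ?expr0 ?normc1// !exprS normcM IH. Qed.

Lemma normc_distC z w : normc (z - w) = normc (w - z).
Proof. by rewrite -normcN opprB. Qed.

Lemma normc_sum (I : Type) (s : seq I) (P : pred I) (F : I -> C) :
  normc (\sum_(i <- s | P i) F i) <= \sum_(i <- s | P i) normc (F i).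
Proof.
elim/big_rec2: _ => [|i y1 y2 _ H]; first by rewrite normc0.
by apply: (le_trans (le_normcD _ _)); rewrite lerD2l.
Qed.

Lemma normc_prod (I : Type) (s : seq I) (P : pred I) (F : I -> C) :
  normc (\prod_(i <- s | P i) F i) = \prod_(i <- s | P i) normc (F i).
Proof.
by elim/big_rec2: _ => [|i y1 y2 _ <-]; [rewrite normc1|rewrite normcM].
Qed.

Lemma lerB_normc z w : normc z - normc w <= normc (z - w).
Proof. by rewrite lerBlDr; have := le_normcD (z - w) w; rewrite subrK. Qed.

Lemma normcJE z : z * z^*%C = (normc z ^+ 2)%:C.
Proof.
rewrite sqr_normc; case: z => a b /=.
by apply/eqP; rewrite eq_complex /=; apply/andP; split; apply/eqP; ring.
Qed.

Lemma unit_discE z : unit_disc z = (normc z < 1) :> Prop.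
Proof. by apply: propext; rewrite /unit_disc/= -ltcR. Qed.

Lemma norm_normc z w : (`|z| = w) <-> ((normc z)%:C = w).
Proof. by []. Qed.

Lemma normc_small0 z : (forall e : R, 0 < e -> normc z <= e) -> z = 0.
Proof.
move=> h; apply/eqP; rewrite -normc_eq0 eq_le normc_ge0 andbT.
by apply/ler_addgt0Pr => e e0; rewrite add0r h.
Qed.

Lemma normc_limit0 z (k : R) :
  (forall e : R, 0 < e -> normc z <= k * e) -> z = 0.
Proof.
move=> h; apply: normc_small0 => e e0.
have k0 : 0 < `|k| + 1 by rewrite ltr_wpDl.
apply: (le_trans (h (e / (`|k| + 1)) _)); first by rewrite divr_gt0.
rewrite mulrA ler_pdivrMr// mulrC ler_pM2l//.
by rewrite (le_trans (ler_norm _))// lerDl.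
Qed.

End normc_facts.
#[global] Hint Resolve normc_ge0 : core.

(** * Continuity of complex-valued functions in epsilon form *)

Section continuity.
Context {R : realType} {V : zmodType} {nV : V -> R}.
Local Notation C := R[i].
Implicit Types (F G : V -> C) (z : C) (t : V).

(** The size [n] on the domain is a parameter, so that functions of a real variable ([ccont]) and of
    a complex variable ([ceps]) share one set of closure lemmas. *)
Definition econt_at (n : V -> R) F t := forall e : R, 0 < e -> exists2 d : R, 0 < d &
  forall s, n (s - t) < d -> normc (F s - F t) < e.

Local Notation econt := (econt_at nV).

Lemma ccont_cst z t : econt (fun=> z) t.
Proof. by move=> e e0; exists 1 => // s _; rewrite subrr normc0. Qed.

Lemma ccontD F G t : econt F t -> econt G t -> econt (fun s => F s + G s) t.
Proof.
move=> cF cG e e0; have e20 : 0 < e / 2 by rewrite divr_gt0.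
have [d1 d10 H1] := cF _ e20; have [d2 d20 H2] := cG _ e20.
exists (Num.min d1 d2); first by rewrite lt_min d10.
move=> s; rewrite lt_min => /andP[/H1 {}H1 /H2 {}H2].
rewrite opprD addrACA; apply: (le_lt_trans (le_normcD _ _)); lra.
Qed.

Lemma ccontM F G t : econt F t -> econt G t -> econt (fun s => F s * G s) t.
Proof.
move=> cF cG e e0.
pose k := normc (F t) + normc (G t) + 1.
have k0 : 0 < k by rewrite /k ltr_wpDl// addr_ge0.
have ek0 : 0 < e / k by rewrite divr_gt0.
have [d1 d10 H1] := cF _ ek0; have [d2 d20 H2] := cG _ ek0.
have [d3 d30 H3] := cG _ (ltr01).
exists (Num.min d1 (Num.min d2 d3)); first by rewrite !lt_min d10 d20.
move=> s; rewrite !lt_min => /andP[/H1 {}H1 /andP[/H2 {}H2 /H3 {}H3]].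
have -> : F s * G s - F t * G t = (F s - F t) * G s + F t * (G s - G t) by ring.
apply: (le_lt_trans (le_normcD _ _)); rewrite !normcM.
have Gs : normc (G s) < normc (G t) + 1.
  have := le_normcD (G s - G t) (G t); rewrite subrK; lra.
have -> : e = e / k * (normc (G t) + 1) + normc (F t) * (e / k).
  by rewrite /k in k0 *; field; rewrite gt_eqF.
rewrite ltr_leD//; last by rewrite ler_wpM2l// ltW.
by rewrite ltr_pM.
Qed.

Lemma ccontZ z F t : econt F t -> econt (fun s => z * F s) t.
Proof. by move=> cF; apply: ccontM => //; exact: ccont_cst. Qed.

Lemma ccontN F t : econt F t -> econt (fun s => - F s) t.
Proof. by move=> /(ccontZ (-1)); under eq_fun do rewrite mulN1r. Qed.

Lemma ccontB F G t : econt F t -> econt G t -> econt (fun s => F s - G s) t.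
Proof. by move=> cF cG; exact: (ccontD cF (ccontN cG)). Qed.

Lemma ccontX F n t : econt F t -> econt (fun s => F s ^+ n) t.
Proof.
move=> cF; elim: n => [|n IH].
  by under eq_fun do rewrite expr0; exact: ccont_cst.
by under eq_fun do rewrite exprS; exact: ccontM.
Qed.

Lemma ccontJ F t : econt F t -> econt (fun s => (F s)^*%C) t.
Proof.
move=> cF e e0; have [d d0 H] := cF _ e0; exists d => // s /H.
by rewrite -rmorphB normc_conj.
Qed.

Lemma ccont_sum (I : Type) (r : seq I) (F : I -> V -> C) t :
  (forall i, econt (F i) t) -> econt (fun s => \sum_(i <- r) F i s) t.
Proof.
move=> h; elim: r => [|i r IH].
  by under eq_fun do rewrite big_nil; exact: ccont_cst.
by under eq_fun do rewrite big_cons; exact: (ccontD (h i) IH).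
Qed.

Lemma ccont_normc2 F t : econt F t -> econt (fun s => (normc (F s) ^+ 2)%:C) t.
Proof.
move=> cF; have := ccontM cF (ccontJ cF).
by under eq_fun do rewrite normcJE.
Qed.

End continuity.

Notation ccont := (econt_at Num.norm).
Notation ceps := (econt_at (@normc _)).

(** * Complex derivatives in epsilon form *)

Section cdiff.
Context {R : realType}.
Local Notation C := R[i].
Implicit Types (f g : C -> C) (z c d : C).

(** The increment [h] is multiplied out: there is no quotient, hence no exclusion of [h = 0], and
    the derivative [c] is part of the relation. *)
Definition cdiff f z c := forall e : R, 0 < e -> exists2 d : R, 0 < d &
  forall h, normc h < d -> normc (f (z + h) - f z - c * h) <= e * normc h.

Lemma cdiffP f z : complex_derivable f z -> cdiff f z (complex_derive f z).
Proof.
move=> df0 e e0.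
have : h^-1 *: ((f \o shift z) (h *: (1 : C^o)) - f z) @[h --> (0 : C^o)^'] -->
    (complex_derive f z : C^o).
  by rewrite /complex_derive derive1E; exact: df0.
move=> /(@cvgrPdist_lt C C^o) df.
have /df : 0 < e%:C :> C by rewrite ltcR.
move=> /nbhs_ballP[[d d'] /=]; rewrite ltcE/= => /andP[/eqP -> d0] H.
exists d => // h hd.
have [->|h0] := eqVneq h 0.
  by rewrite addr0 mulr0 subrr subr0 normc0 mulr0.
have {H}: `|complex_derive f z - h^-1 *: ((f \o shift z) (h *: (1 : C^o)) - f z)| < e%:C.
  by apply: H => //; rewrite /ball/= sub0r normrN -[X in X < _]/((normc h)%:C) ltcR.
rewrite -[X in X < _]/((normc _)%:C) ltcR normc_distC => H.
have -> : f (z + h) - f z - complex_derive f z * h =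
   (h^-1 *: ((f \o shift z) (h *: (1 : C^o)) - f z) - complex_derive f z) * h.
  rewrite /GRing.scale/= mulr1 [h + z]addrC mulrBl; congr (_ - _).
  by rewrite mulrAC mulVf// mul1r.
by rewrite normcM ler_wpM2r// ltW.
Qed.

Lemma cdiff_cvg f z c : cdiff f z c ->
  h^-1 *: ((f \o shift z) (h *: (1 : C^o)) - f z) @[h --> (0 : C^o)^'] --> (c : C^o).
Proof.
move=> df; apply/(@cvgrPdist_lt C C^o) => -[e e'].
rewrite ltcE/= => /andP[/eqP -> e0].
have [d d0 H] := df _ (divr_gt0 e0 (ltr0n R 2) : 0 < e / 2).
apply/nbhs_ballP; exists (d%:C) => /=; first by rewrite ltcR.
move=> h /=; rewrite /ball/= sub0r normrN -[X in X < _]/((normc h)%:C) ltcR => hd h0.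
rewrite -[X in X < _]/((normc _)%:C) -[X in _ < X]/(e%:C) ltcR normc_distC.
have -> : h^-1 *: ((f \o shift z) (h *: (1 : C^o)) - f z) - c =
   h^-1 * (f (z + h) - f z - c * h).
  by rewrite mulrBr [h^-1 * (c * h)]mulrCA mulVf// mulr1 /GRing.scale/= mulr1 [h + z]addrC.
rewrite normcM normcV mulrC ltr_pdivrMr ?normc_gt0//.
apply: (le_lt_trans (H _ hd)).
by rewrite ltr_pM2r ?normc_gt0// ltr_pdivrMr// mulr_natr mulr2n ltrDl.
Qed.

Lemma cdiff_derivable f z c : cdiff f z c -> complex_derivable f z.
Proof. by move=> /cdiff_cvg h; apply/cvg_ex; exists c. Qed.

Lemma cdiff_is_derive f z c : cdiff f z c <-> is_derive (z : C^o) 1 (f : C^o -> C^o) c.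
Proof.
split=> [df|[df <-]]; last by rewrite -derive1E; exact: cdiffP.
apply: DeriveDef; first exact: cdiff_derivable df.
exact: (cvg_lim (@norm_hausdorff C C^o) (cdiff_cvg df)).
Qed.

Lemma cdiff_cst a z : cdiff (fun=> a) z 0.
Proof.
by move=> e e0; exists 1 => // h _; rewrite subrr mul0r subr0 normc0 mulr_ge0// ltW.
Qed.

Lemma cdiff_id z : cdiff id z 1.
Proof.
move=> e e0; exists 1 => // h _.
by rewrite mul1r [z + h]addrC addrK subrr normc0 mulr_ge0// ltW.
Qed.

Lemma cdiffD f g z c d : cdiff f z c -> cdiff g z d ->
  cdiff (fun w => f w + g w) z (c + d).
Proof.
by move=> /cdiff_is_derive df /cdiff_is_derive dg; apply/cdiff_is_derive; exact: is_deriveD.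
Qed.

Lemma cdiff_lip f z c : cdiff f z c -> exists2 d : R, 0 < d &
  forall h, normc h < d -> normc (f (z + h) - f z) <= (normc c + 1) * normc h.
Proof.
move=> /(_ 1 ltr01)[d d0 H]; exists d => // h /H {}H.
have := le_normcD (f (z + h) - f z - c * h) (c * h); rewrite subrK normcM; lra.
Qed.

Lemma cdiff_cont f z c : cdiff f z c -> ceps f z.
Proof.
move=> /cdiff_lip[d d0 H] e e0.
have k0 : 0 < normc c + 1 by rewrite ltr_wpDl.
exists (Num.min d (e / (normc c + 1))); first by rewrite lt_min d0 divr_gt0.
move=> w; rewrite lt_min => /andP[/H]; rewrite [z + _]addrC subrK => H1.
by rewrite ltr_pdivlMr// mulrC; exact: le_lt_trans.
Qed.

Lemma cdiffM f g z c d : cdiff f z c -> cdiff g z d ->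
  cdiff (fun w => f w * g w) z (c * g z + f z * d).
Proof.
move=> /cdiff_is_derive df /cdiff_is_derive dg; apply/cdiff_is_derive.
by apply: is_derive_eq (is_deriveM df dg) _; rewrite addrC [g z *: _]mulrC.
Qed.

Lemma cdiffZ a f z c : cdiff f z c -> cdiff (fun w => a * f w) z (a * c).
Proof.
move=> df; have := cdiffM (cdiff_cst a z) df.
by rewrite mul0r add0r.
Qed.

Lemma cdiffN f z c : cdiff f z c -> cdiff (fun w => - f w) z (- c).
Proof.
move=> df; have := cdiffZ (-1) df; rewrite mulN1r.
by under eq_fun do rewrite mulN1r.
Qed.

Lemma cdiffB f g z c d : cdiff f z c -> cdiff g z d ->
  cdiff (fun w => f w - g w) z (c - d).
Proof. by move=> df dg; exact: (cdiffD df (cdiffN dg)). Qed.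

Lemma cdiffX n z : cdiff (fun w => w ^+ n) z (n%:R * z ^+ n.-1).
Proof.
elim: n => [|n IH].
  by rewrite mul0r; under eq_fun do rewrite expr0; exact: cdiff_cst.
have := cdiffM (cdiff_id z) IH; under eq_fun do rewrite -exprS.
suff -> : 1 * z ^+ n + z * (n%:R * z ^+ n.-1) = n.+1%:R * z ^+ n.+1.-1 by [].
case: n {IH} => [|n] /=; first by rewrite !mul0r mulr0 addr0.
by rewrite exprS -[n.+2%:R]natr1; ring.
Qed.

Lemma cdiff_sum (I : Type) (s : seq I) (F : I -> C -> C) (c : I -> C) z :
  (forall i, cdiff (F i) z (c i)) ->
  cdiff (fun w => \sum_(i <- s) F i w) z (\sum_(i <- s) c i).
Proof.
move=> h; elim: s => [|i s IH].
  by rewrite big_nil; under eq_fun do rewrite big_nil; exact: cdiff_cst.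
rewrite big_cons; under eq_fun do rewrite big_cons.
exact: (cdiffD (h i) IH).
Qed.

Lemma cdiff_near f g z c (d : R) : 0 < d ->
  (forall w, normc (w - z) < d -> f w = g w) -> cdiff f z c -> cdiff g z c.
Proof.
move=> d0 fg df e e0; have [d' d'0 H] := df _ e0.
exists (Num.min d d'); first by rewrite lt_min d0.
move=> h; rewrite lt_min => /andP[hd /H].
by rewrite -!fg// ?subrr ?normc0// [z + h]addrC addrK.
Qed.

Lemma cdiff_comp f g z c d : cdiff g z d -> cdiff f (g z) c ->
  cdiff (fun w => f (g w)) z (c * d).
Proof.
move=> dg df e e0.
have [d1 d10 H1] := cdiff_lip dg.
pose k := normc d + 1 + normc c; have k0 : 0 < k by rewrite /k addrAC ltr_wpDl// addr_ge0.
have ek0 : 0 < e / k by rewrite divr_gt0.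
have [d2 d20 H2] := df _ ek0; have [d3 d30 H3] := dg _ ek0.
have [d4 d40 H4] := cdiff_cont dg d20.
exists (Num.min d1 (Num.min d3 d4)); first by rewrite !lt_min d10 d30.
move=> h; rewrite !lt_min => /andP[/H1 {}H1 /andP[/H3 {}H3 hd4]].
have := H4 (z + h); rewrite [z + h]addrC addrK [h + z]addrC => /(_ hd4) /H2.
rewrite [g z + _]addrC subrK => {}H2.
have -> : f (g (z + h)) - f (g z) - c * d * h =
   (f (g (z + h)) - f (g z) - c * (g (z + h) - g z)) + c * (g (z + h) - g z - d * h) by ring.
apply: (le_trans (le_normcD _ _)); rewrite normcM.
have -> : e * normc h = e / k * ((normc d + 1) * normc h) + normc c * (e / k * normc h).
  by rewrite /k in k0 *; field; rewrite gt_eqF.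
rewrite lerD//; last exact: ler_wpM2l.
by apply: (le_trans H2); rewrite ler_wpM2l// ltW.
Qed.

Lemma cdiffV f z c : cdiff f z c -> f z != 0 ->
  cdiff (fun w => (f w)^-1) z (- c / f z ^+ 2).
Proof.
move=> /cdiff_is_derive[df <-] f0; apply/cdiff_is_derive.
apply: DeriveDef; first exact: (@derivableV C C^o).
by rewrite (@deriveV C C^o)// mulrC mulrN -mulNr.
Qed.

Lemma cdiff_inv z : z != 0 -> cdiff (fun w => w^-1) z (- z ^- 2).
Proof. by move=> z0; have := cdiffV (cdiff_id z) z0; rewrite mulN1r. Qed.

Lemma ccont_ceps f (F : R -> C) t : ceps f (F t) -> ccont F t -> ccont (fun s => f (F s)) t.
Proof.
move=> cf cF e e0; have [d d0 H] := cf _ e0.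
by have [d' d'0 H'] := cF _ d0; exists d' => // s /H'/H.
Qed.

Lemma ccont_comp f (F : R -> C) t c :
  cdiff f (F t) c -> ccont F t -> ccont (fun s => f (F s)) t.
Proof. by move=> /cdiff_cont; exact: ccont_ceps. Qed.

End cdiff.

(** * Real and imaginary parts, the exponential and the unit circle *)

Section derivatives_in_coordinates.
Context {R : realType}.
Local Notation C := R[i].

Lemma is_derive_eps (f : R -> R) (x c : R) : is_derive x 1 f c ->
  forall e : R, 0 < e -> exists2 d : R, 0 < d &
    forall h, `|h| < d -> `|f (x + h) - f x - c * h| <= e * `|h|.
Proof.
move=> [df dfc] e e0.
have : h^-1 *: ((f \o shift x) (h *: (1 : R^o)) - f x) @[h --> (0 : R^o)^'] --> c.
  by rewrite -dfc; exact: df.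
move=> /cvgrPdist_lt /(_ e e0) /nbhs_ballP[d /= d0 H].
exists d => // h hd; have [->|h0] := eqVneq h 0.
  by rewrite addr0 mulr0 subrr subr0 !normr0 mulr0.
have := H h; rewrite /ball/= sub0r normrN => /(_ hd h0) /ltW.
have -> : f (x + h) - f x - c * h =
   - (c - h^-1 *: ((f \o shift x) (h *: (1 : R^o)) - f x)) * h.
  by rewrite /GRing.scale/= mulr1 [h + x]addrC; field.
by rewrite normrM normrN => ?; rewrite ler_wpM2r.
Qed.

Lemma eps_is_derive (f : R -> R) (x c : R) :
  (forall e : R, 0 < e -> exists2 d : R, 0 < d &
    forall h, `|h| < d -> `|f (x + h) - f x - c * h| <= e * `|h|) ->
  is_derive x 1 f c.
Proof.
move=> H.
have cv : h^-1 *: ((f \o shift x) (h *: (1 : R^o)) - f x) @[h --> (0 : R^o)^'] --> c.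
  apply/cvgrPdist_le => e e0.
  have [d d0 {}H] := H _ e0.
  apply/nbhs_ballP; exists d => //= h; rewrite /ball/= sub0r normrN => hd h0.
  have := H h hd; rewrite -ler_pdivrMr ?normr_gt0//.
  rewrite -normfV -normrM; apply: le_trans.
  rewrite -[X in _ <= X]normrN /GRing.scale/= mulr1 [h + x]addrC.
  by rewrite le_eqVlt; apply/orP; left; apply/eqP; congr (`| _ |); field.
apply: DeriveDef; first by apply/cvg_ex; exists c.
exact: (cvg_lim (@norm_hausdorff R R^o) cv).
Qed.

Lemma is_derive_ReIm (f : C -> C) (t : R) c : cdiff f t%:C c ->
  is_derive t 1 (fun s => complex.Re (f s%:C)) (complex.Re c) *
  is_derive t 1 (fun s => complex.Im (f s%:C)) (complex.Im c).
Proof.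
move=> df; split; apply: eps_is_derive => e /df[d d0 H]; exists d => // h hd;
  have := H h%:C; rewrite normcC rmorphD => /(_ hd).
  apply: le_trans; apply: le_trans (ler_Re_normc _).
  case: (f (t%:C + h%:C)) => ? ?; case: (f t%:C) => ? ?; case: {H df}c => ? ? /=.
  by rewrite mulr0 subr0.
apply: le_trans; apply: le_trans (ler_Im_normc _).
case: (f (t%:C + h%:C)) => ? ?; case: (f t%:C) => ? ?; case: {H df}c => ? ? /=.
by rewrite mulr0 add0r.
Qed.

Lemma ccont_ReIm (F : R -> C) t : ccont F t ->
  {for t, continuous (fun s => complex.Re (F s))} *
  {for t, continuous (fun s => complex.Im (F s))}.
Proof.
move=> cF; split; apply/cvgrPdist_lt => e /cF[d d0 H];
  apply/nbhs_ballP; exists d => //= s; rewrite /ball/= distrC => /H;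
  apply: le_lt_trans; rewrite distrC.
  by have := ler_Re_normc (F s - F t); case: (F s) => ? ?; case: (F t).
by have := ler_Im_normc (F s - F t); case: (F s) => ? ?; case: (F t).
Qed.

Definition cexp (z : C) : C :=
  (expR (complex.Re z))%:C * (cos (complex.Im z) +i* sin (complex.Im z)).

Definition circ (t : R) : C := cos t +i* sin t.

Lemma normc_circ t : normc (circ t) = 1.
Proof. by rewrite /= cos2Dsin2 sqrtr1. Qed.

Lemma circ_neq0 t : circ t != 0.
Proof. by rewrite -normc_eq0 normc_circ oner_eq0. Qed.

Lemma circD s t : circ (s + t) = circ s * circ t.
Proof.
rewrite /circ cosD sinD; apply/eqP; rewrite eq_complex/= eqxx/=.
by rewrite addrC.
Qed.

Lemma circ0 : circ 0 = 1.
Proof. by rewrite /circ cos0 sin0. Qed.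

Lemma circ2pi : circ (2 * pi) = 1.
Proof. by rewrite /circ mulr_natl cos2pi sin2pi. Qed.

Lemma circJ t : (circ t)^*%C = (circ t)^-1.
Proof.
apply: (mulfI (circ_neq0 t)); rewrite normcJE normc_circ expr1n divff ?circ_neq0//.
Qed.

Lemma cexpD z w : cexp (z + w) = cexp z * cexp w.
Proof.
case: z w => [a b] [c d]; rewrite /cexp/= expRD -!/(circ _) circD rmorphM /=.
by ring.
Qed.

Lemma normc_cexp z : normc (cexp z) = expR (complex.Re z).
Proof. by rewrite /cexp normcM -/(circ _) normc_circ mulr1 normcC ger0_norm ?expR_ge0. Qed.

Lemma cexp_polar (r t : R) : 0 < r -> cexp (ln r +i* t) = r%:C * circ t.
Proof. by move=> r0; rewrite /cexp/= lnK. Qed.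

(** The functional equation reduces the claim to the point 0, where it follows from the first-order
    expansions of exp, cos and sin. *)
Lemma cdiff_cexp z : cdiff cexp z (cexp z).
Proof.
suff H : forall e : R, 0 < e -> exists2 d : R, 0 < d &
  forall h, normc h < d -> normc (cexp h - 1 - h) <= e * normc h.
  move=> e e0; have k0 : 0 < normc (cexp z) by rewrite normc_cexp expR_gt0.
  have [d d0 {}H] := H _ (divr_gt0 e0 k0); exists d => // h /H {}H.
  have -> : cexp (z + h) - cexp z - cexp z * h = cexp z * (cexp h - 1 - h).
    by rewrite cexpD; ring.
  rewrite normcM mulrC -ler_pdivlMr//; apply: (le_trans H).
  by rewrite mulrAC.
(* The errors are [3 e1 |h|] in the real part and [4 e1 |h|] in the imaginary part, whence the 8;
   [e1 <= 1] gives [|1 + x| <= 2] and [|sin y| <= 2 |h|]. *)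
move=> e e0; pose e1 := Num.min (e / 8) 1.
have e10 : 0 < e1 by rewrite lt_min divr_gt0 /=.
have e11 : e1 <= 1 by rewrite ge_min lexx orbT.
have e1e : e1 <= e / 8 by rewrite ge_min lexx.
have [d1 d10 H1] := is_derive_eps (is_derive_expR (0 : R)) e10.
have [d2 d20 H2] := is_derive_eps (is_derive_cos (0 : R)) e10.
have [d3 d30 H3] := is_derive_eps (is_derive_sin (0 : R)) e10.
exists (Num.min (Num.min d1 d2) (Num.min d3 e1)); first by rewrite 3?lt_min d10 d20 d30 e10.
case=> x y; rewrite 3?lt_min => /andP[/andP[h1 h2] /andP[h3 h4]].
have xh := ler_Re_normc (x +i* y); have yh := ler_Im_normc (x +i* y).
move: xh yh h1 h2 h3 h4; set N := normc _; rewrite [complex.Re _]/= [complex.Im _]/=.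
move=> xh yh h1 h2 h3 h4.
have := H1 x (le_lt_trans xh h1); rewrite add0r expR0 mul1r => {}H1.
have := H2 y (le_lt_trans yh h2); rewrite add0r cos0 sin0 oppr0 mul0r subr0 => {}H2.
have := H3 y (le_lt_trans yh h3); rewrite add0r cos0 sin0 subr0 mul1r => {}H3.
have N0 : 0 <= N by exact: normc_ge0.
have xN : e1 * `|x| <= e1 * N by rewrite ler_wpM2l// ltW.
have yN : e1 * `|y| <= e1 * N by rewrite ler_wpM2l// ltW.
have c1 : `|cos y| <= 1 by rewrite cos_max.
have s1 : `|sin y| <= 1 by rewrite sin_max.
apply: (le_trans (ler_normc_ReIm _)).
have -> : complex.Re (cexp (x +i* y) - 1 - (x +i* y)) =
   (expR x - 1 - x) * cos y + (1 + x) * (cos y - 1) by rewrite /cexp/=; ring.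
have -> : complex.Im (cexp (x +i* y) - 1 - (x +i* y)) =
   (expR x - 1 - x) * sin y + x * sin y + (sin y - y) by rewrite /cexp/=; ring.
have e1N : 0 <= e1 * N by rewrite mulr_ge0// ltW.
have t1 : `|(expR x - 1 - x) * cos y| <= e1 * N.
  by rewrite normrM -[X in _ <= X]mulr1 ler_pM//; exact: le_trans xN.
have t2 : `|(expR x - 1 - x) * sin y| <= e1 * N.
  by rewrite normrM -[X in _ <= X]mulr1 ler_pM//; exact: le_trans xN.
have t3 : `|(1 + x) * (cos y - 1)| <= 2 * (e1 * N).
  rewrite normrM ler_pM//; last exact: le_trans yN.
  apply: (le_trans (ler_normD _ _)); rewrite normr1; lra.
have sy : `|sin y| <= 2 * N.
  have : `|sin y| <= `|sin y - y| + `|y| by rewrite -{1}(subrK y (sin y)) ler_normD.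
  have : e1 * N <= N by rewrite ler_piMl.
  lra.
have t4 : `|x * sin y| <= e1 * (2 * N).
  by rewrite normrM ler_pM//; apply: (le_trans xh); exact: ltW.
have t5 : `|sin y - y| <= e1 * N by exact: le_trans yN.
have n1 := ler_normD ((expR x - 1 - x) * cos y) ((1 + x) * (cos y - 1)).
have n2 := ler_normD ((expR x - 1 - x) * sin y + x * sin y) (sin y - y).
have n3 := ler_normD ((expR x - 1 - x) * sin y) (x * sin y).
have : e1 * N <= e / 8 * N by rewrite ler_wpM2r.
lra.
Qed.

Lemma circE t : circ t = cexp ('i%C * t%:C).
Proof. by rewrite /cexp /= !(mul0r, mul1r, mulr0, addr0, add0r, subr0, oppr0) expR0 mul1r. Qed.

Lemma ccont_circ t : ccont circ t.
Proof.
rewrite (_ : circ = fun s => cexp ('i%C * s%:C)); last exact/funext/circE.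
apply: (ccont_comp (cdiff_cexp _)); apply: ccontZ => e e0; exists e => // s.
by rewrite -normcC rmorphB.
Qed.

End derivatives_in_coordinates.

(** * Integrals of complex-valued functions *)

Section integrals.
Context {R : realType}.
Local Notation C := R[i].
Local Notation mu := (@lebesgue_measure R).
Implicit Types (F G : R -> C) (a b t M : R) (z c : C).

Definition cint a b F : C :=
  (\int[mu]_(t in `[a, b]) complex.Re (F t))%R +i*
  (\int[mu]_(t in `[a, b]) complex.Im (F t))%R.

Definition cconton a b F := forall t, a <= t <= b -> ccont F t.

Lemma cconton_ReIm a b F : cconton a b F ->
  {within `[a, b], continuous (fun s => complex.Re (F s))} *
  {within `[a, b], continuous (fun s => complex.Im (F s))}.
Proof.
move=> cF; split; apply: continuous_in_subspaceT => t /set_mem /=;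
by rewrite in_itv/= => /cF /ccont_ReIm[].
Qed.

Lemma cconton_integrable a b F : cconton a b F ->
  mu.-integrable `[a, b] (EFin \o (fun s => complex.Re (F s))) *
  mu.-integrable `[a, b] (EFin \o (fun s => complex.Im (F s))).
Proof.
move=> /cconton_ReIm[c1 c2].
by split; apply: continuous_compact_integrable => //; exact: segment_compact.
Qed.

Lemma eq_cint a b F G : (forall t, a <= t <= b -> F t = G t) -> cint a b F = cint a b G.
Proof.
move=> FG; rewrite /cint; congr (_ +i* _);
  by apply: eq_Rintegral => t /set_mem/=; rewrite in_itv/= => /FG ->.
Qed.

Lemma cintD a b F G : cconton a b F -> cconton a b G ->
  cint a b (fun t => F t + G t) = cint a b F + cint a b G.
Proof.
move=> /cconton_integrable[f1 f2] /cconton_integrable[g1 g2].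
rewrite /cint [RHS]/GRing.add/=; congr (_ +i* _).
  rewrite -RintegralD//; apply: eq_Rintegral => t _.
  by case: (F t); case: (G t).
rewrite -RintegralD//; apply: eq_Rintegral => t _.
by case: (F t); case: (G t).
Qed.

Lemma cintZ a b c F : cconton a b F -> cint a b (fun t => c * F t) = c * cint a b F.
Proof.
move=> /cconton_integrable[f1 f2].
have i1 (k : R) : mu.-integrable `[a, b] (EFin \o (fun s => k * complex.Re (F s))).
  by apply: (@integrableZl _ _ _ mu _ _ k (EFin \o (fun s => complex.Re (F s)))).
have i2 (k : R) : mu.-integrable `[a, b] (EFin \o (fun s => k * complex.Im (F s))).
  by apply: (@integrableZl _ _ _ mu _ _ k (EFin \o (fun s => complex.Im (F s)))).
case: c => c d; rewrite /cint [RHS]/GRing.mul/=; congr (_ +i* _).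
  rewrite -!RintegralZl// -RintegralB//; apply: eq_Rintegral => t _.
  by case: (F t).
rewrite -!RintegralZl// -RintegralD//; apply: eq_Rintegral => t _.
by case: (F t).
Qed.

Lemma cint_cst a b c : a <= b -> cint a b (fun=> c) = (b - a)%:C * c.
Proof.
move=> ab; rewrite /cint !Rintegral_cst//= lebesgue_measure_itv/= lte_fin.
case: c => c d; apply/eqP; rewrite eq_complex/= !mul0r subr0 addr0.
case: ltP => [_|ba]; first by rewrite /= !(mulrC (b - a)) !eqxx.
by have -> : a = b; [apply/eqP; rewrite eq_le ab ba|rewrite subrr !mulr0 !mul0r eqxx].
Qed.

Lemma ler_Rint_cst a b (f : R -> R) M : a <= b ->
  mu.-integrable `[a, b] (EFin \o f) ->
  (forall t, a <= t <= b -> `|f t| <= M) ->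
  `|\int[mu]_(t in `[a, b]) f t| <= M * (b - a).
Proof.
move=> ab fi fM; apply: (le_trans (le_normr_Rintegral _ fi)) => //.
have -> : M * (b - a) = \int[mu]_(t in `[a, b]) M.
  rewrite Rintegral_cst//= lebesgue_measure_itv/= lte_fin.
  case: ltP => //= ba.
  by have -> : a = b; [apply/eqP; rewrite eq_le ab ba|rewrite subrr].
apply: le_Rintegral => //.
- exact: (integrable_norm fi).
- by apply: continuous_compact_integrable; [exact: segment_compact|apply: continuous_subspaceT => ?; exact: cvg_cst].
Qed.

(** The factor 2 comes from estimating real and imaginary parts separately. All uses are limits or
    bounds up to a constant. *)
Lemma normc_cint a b F M : a <= b -> cconton a b F ->
  (forall t, a <= t <= b -> normc (F t) <= M) ->
  normc (cint a b F) <= 2 * (M * (b - a)).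
Proof.
move=> ab /cconton_integrable[f1 f2] FM.
apply: (le_trans (ler_normc_ReIm _)); rewrite mulr_natl mulr2n lerD//=.
  by apply: ler_Rint_cst => // t /FM; exact: le_trans (ler_Re_normc _).
by apply: ler_Rint_cst => // t /FM; exact: le_trans (ler_Im_normc _).
Qed.

Lemma cint_split a (c : R) b F : a <= c <= b -> cconton a b F ->
  cint a b F = cint a c F + cint c b F.
Proof.
move=> /andP[ac cb] /cconton_integrable[f1 f2].
have H (f : R -> R) : mu.-integrable `[a, b] (EFin \o f) ->
   \int[mu]_(t in `[a, b]) f t = \int[mu]_(t in `[a, c]) f t + \int[mu]_(t in `[c, b]) f t.
  move=> fi; have := @Rintegral_itvB R f (BLeft a) (BRight b) c fi.
  rewrite !bnd_simp => /(_ ac cb) H.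
  rewrite -[\int[mu]_(t in `[c, b]) f t]Rintegral_itv_obnd_cbnd -?H ?subrKC//.
  by apply: integrableS fi => //; apply: subset_itvr; rewrite bnd_simp.
by rewrite /cint (H _ f1) (H _ f2).
Qed.

Lemma cint_FTC a b (f : C -> C) F : a < b -> (forall t, a <= t <= b -> cdiff f t%:C (F t)) ->
  cconton a b F -> cint a b F = f b%:C - f a%:C.
Proof.
move=> ab dF /cconton_ReIm[c1 c2].
have main (u u' : R -> R) : {within `[a, b], continuous u'} ->
    (forall t, a <= t <= b -> is_derive t 1 u (u' t)) ->
    \int[mu]_(t in `[a, b]) u' t = u b - u a.
  move=> cu' df.
  have cf t : a <= t <= b -> {for t, continuous u}.
    by move=> /df[dft _]; exact/differentiable_continuous/derivable1_diffP.
  rewrite /Rintegral (@continuous_FTC2 _ u' u a b ab cu')//.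
    split => [t|//|//].
    - by rewrite in_itv/= => /andP[/ltW at_ /ltW tb]; have [] := df t; rewrite ?at_ ?tb.
    - by apply/cvg_at_right_filter/cf; rewrite lexx ltW.
    - by apply/cvg_at_left_filter/cf; rewrite lexx ltW.
  move=> t; rewrite in_itv/= => /andP[/ltW at_ /ltW tb].
  by rewrite derive1E; have [] := df t; rewrite ?at_ ?tb.
rewrite /cint.
rewrite (main _ _ c1 (fun t ht => (is_derive_ReIm (dF t ht)).1)).
rewrite (main _ _ c2 (fun t ht => (is_derive_ReIm (dF t ht)).2)).
by case: (f a%:C); case: (f b%:C).
Qed.

End integrals.

Ltac ceq := apply/eqP; rewrite eq_complex/=; apply/andP; split; apply/eqP; ring.

(** * Goursat's lemma on rectangles *)

Section goursat.
Context {R : realType}.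
Local Notation C := R[i].
Implicit Types (g : C -> C) (a b c d x y : R) (l z : C).

(** The counterclockwise boundary integral over a rectangle: bottom minus top, then right minus left
    with [dz = 'i dy]. *)
Definition rect_int g a b c d : C :=
  cint a b (fun x => g (x +i* c) - g (x +i* d)) +
  'i%C * cint c d (fun y => g (b +i* y) - g (a +i* y)).

Definition cdiff_rect g a b c d := forall x y, a <= x <= b -> c <= y <= d ->
  exists l, cdiff g (x +i* y) l.

Lemma ccont_hline y t : ccont (fun x => x +i* y : C) t.
Proof.
move=> e e0; exists e => // s; rewrite -normcC.
by congr (normc _ < _); apply/eqP; rewrite eq_complex/= subrr !eqxx.
Qed.

Lemma ccont_vline x t : ccont (fun y => x +i* y : C) t.
Proof.
move=> e e0; exists e => // s se.
have -> : x +i* s - x +i* t = 'i%C * (s - t)%:C.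
  by ceq.
by rewrite normcM normc_i normcC mul1r.
Qed.

Lemma cconton_hline g a b c d y : cdiff_rect g a b c d -> c <= y <= d ->
  cconton a b (fun x => g (x +i* y)).
Proof.
move=> dg cyd t atb; have [l dl] := dg _ _ atb cyd.
exact: (ccont_comp dl (ccont_hline y t)).
Qed.

Lemma cconton_vline g a b c d x : cdiff_rect g a b c d -> a <= x <= b ->
  cconton c d (fun y => g (x +i* y)).
Proof.
move=> dg axb t ctd; have [l dl] := dg _ _ axb ctd.
exact: (ccont_comp dl (ccont_vline x t)).
Qed.

Lemma ccontonB a b F G : @cconton R a b F -> cconton a b G -> cconton a b (fun t => F t - G t).
Proof. by move=> cF cG t tab; apply: ccontB; [exact: cF|exact: cG]. Qed.

Lemma rect_int_splitx g a m b c d : a <= m <= b -> c <= d -> cdiff_rect g a b c d ->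
  rect_int g a b c d = rect_int g a m c d + rect_int g m b c d.
Proof.
move=> /andP[am mb] cd dg; rewrite /rect_int.
have cc : c <= c <= d by rewrite lexx. have dd : c <= d <= d by rewrite lexx cd.
have aa : a <= a <= b by rewrite lexx (le_trans am).
have bb : a <= b <= b by rewrite lexx (le_trans am).
have mm : a <= m <= b by rewrite am.
rewrite (cint_split mm); last by apply: ccontonB; exact: (cconton_hline dg).
have -> : cint c d (fun y => g (b +i* y) - g (a +i* y)) =
   cint c d (fun y => g (m +i* y) - g (a +i* y)) + cint c d (fun y => g (b +i* y) - g (m +i* y)).
  rewrite -cintD; first by apply: eq_cint => t _; ring.
  - by apply: ccontonB; exact: (cconton_vline dg).
  - by apply: ccontonB; exact: (cconton_vline dg).
by ring.
Qed.

Lemma rect_int_splity g a b c m d : c <= m <= d -> a <= b -> cdiff_rect g a b c d ->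
  rect_int g a b c d = rect_int g a b c m + rect_int g a b m d.
Proof.
move=> /andP[cm md] ab dg; rewrite /rect_int.
have aa : a <= a <= b by rewrite lexx. have bb : a <= b <= b by rewrite lexx ab.
have cc : c <= c <= d by rewrite lexx (le_trans cm).
have dd : c <= d <= d by rewrite lexx (le_trans cm).
have mm : c <= m <= d by rewrite cm.
rewrite (cint_split mm); last by apply: ccontonB; exact: (cconton_vline dg).
have -> : cint a b (fun x => g (x +i* c) - g (x +i* d)) =
   cint a b (fun x => g (x +i* c) - g (x +i* m)) + cint a b (fun x => g (x +i* m) - g (x +i* d)).
  rewrite -cintD; first by apply: eq_cint => t _; ring.
  - by apply: ccontonB; exact: (cconton_hline dg).
  - by apply: ccontonB; exact: (cconton_hline dg).
by ring.
Qed.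

(* The affine part [g z + l * (p - z)] of [g] integrates to 0, so only its
   distance to [g] matters. *)
Lemma rect_int_affine g a b c d z l (e : R) : a <= b -> c <= d ->
  cdiff_rect g a b c d ->
  (forall x y, a <= x <= b -> c <= y <= d ->
    normc (g (x +i* y) - g z - l * (x +i* y - z)) <= e) ->
  normc (rect_int g a b c d) <= 4 * (e * (b - a + (d - c))).
Proof.
move=> ab cd dg H.
have cc : c <= c <= d by rewrite lexx. have dd : c <= d <= d by rewrite lexx cd.
have aa : a <= a <= b by rewrite lexx. have bb : a <= b <= b by rewrite lexx ab.
pose G1 x := g (x +i* c) - g (x +i* d) - l * (0 +i* (c - d)).
pose G2 y := g (b +i* y) - g (a +i* y) - l * ((b - a) +i* 0).
have cG1 : cconton a b G1.
  apply: ccontonB; last by move=> t _; exact: ccont_cst.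
  by apply: ccontonB; exact: (cconton_hline dg).
have cG2 : cconton c d G2.
  apply: ccontonB; last by move=> t _; exact: ccont_cst.
  by apply: ccontonB; exact: (cconton_vline dg).
have E : rect_int g a b c d = cint a b G1 + 'i%C * cint c d G2.
  rewrite /rect_int.
  have -> : cint a b (fun x => g (x +i* c) - g (x +i* d)) =
      cint a b G1 + (b - a)%:C * (l * (0 +i* (c - d))).
    rewrite -cint_cst// -cintD//; last by move=> t _; exact: ccont_cst.
    by apply: eq_cint => t _; rewrite /G1; ring.
  have -> : cint c d (fun y => g (b +i* y) - g (a +i* y)) =
      cint c d G2 + (d - c)%:C * (l * ((b - a) +i* 0)).
    rewrite -cint_cst// -cintD//; last by move=> t _; exact: ccont_cst.
    by apply: eq_cint => t _; rewrite /G2; ring.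
  have -> : (0 +i* (c - d)) = 'i%C * (c - d)%:C :> C.
    by ceq.
  have -> : (d - c)%:C = - (c - d)%:C :> C by rewrite -rmorphN opprB.
  by rewrite complexr0; ring.
have b1 : normc (cint a b G1) <= 2 * ((2 * e) * (b - a)).
  apply: normc_cint => // t tab; rewrite /G1.
  have -> : g (t +i* c) - g (t +i* d) - l * (0 +i* (c - d)) =
     (g (t +i* c) - g z - l * (t +i* c - z)) - (g (t +i* d) - g z - l * (t +i* d - z)).
    have -> : (0 +i* (c - d)) = t +i* c - t +i* d :> C.
      by apply/eqP; rewrite eq_complex/= subrr !eqxx.
    by ring.
  apply: (le_trans (le_normcD _ _)); rewrite normcN.
  by have := H _ _ tab cc; have := H _ _ tab dd; lra.
have b2 : normc (cint c d G2) <= 2 * ((2 * e) * (d - c)).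
  apply: normc_cint => // t tcd; rewrite /G2.
  have -> : g (b +i* t) - g (a +i* t) - l * ((b - a) +i* 0) =
     (g (b +i* t) - g z - l * (b +i* t - z)) - (g (a +i* t) - g z - l * (a +i* t - z)).
    have -> : ((b - a) +i* 0) = b +i* t - a +i* t :> C.
      by apply/eqP; rewrite eq_complex/= subrr !eqxx.
    by ring.
  apply: (le_trans (le_normcD _ _)); rewrite normcN.
  by have := H _ _ aa tcd; have := H _ _ bb tcd; lra.
rewrite E; apply: (le_trans (le_normcD _ _)).
rewrite normcM normc_i mul1r; lra.
Qed.

Lemma cdiff_rect_sub g a b c d a' b' c' d' : a <= a' -> b' <= b -> c <= c' -> d' <= d ->
  cdiff_rect g a b c d -> cdiff_rect g a' b' c' d'.
Proof.
move=> aa bb cc dd dg x y /andP[ax xb] /andP[cy yd]; apply: dg.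
  by rewrite (le_trans aa ax) (le_trans xb bb).
by rewrite (le_trans cc cy) (le_trans yd dd).
Qed.

Section bisection.
Variable g : C -> C.
Local Notation rect := ((R * R) * (R * R))%type.
Local Notation Phi Q := (rect_int g Q.1.1 Q.1.2 Q.2.1 Q.2.2).

(** Of the two halves, at least one carries half of the integral in modulus, and such a half is
    kept. Halving in both directions divides the sides by 2 and the modulus by at most 4. *)
Let halfx (Q : rect) : rect :=
  let m := (Q.1.1 + Q.1.2) / 2 in
  if normc (Phi Q) / 2 <= normc (rect_int g Q.1.1 m Q.2.1 Q.2.2)
  then ((Q.1.1, m), Q.2) else ((m, Q.1.2), Q.2).

Let halfy (Q : rect) : rect :=
  let m := (Q.2.1 + Q.2.2) / 2 in
  if normc (Phi Q) / 2 <= normc (rect_int g Q.1.1 Q.1.2 Q.2.1 m)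
  then (Q.1, (Q.2.1, m)) else (Q.1, (m, Q.2.2)).

Let good (Q Q' : rect) := [/\ Q.1.1 <= Q'.1.1, Q'.1.2 <= Q.1.2, Q.2.1 <= Q'.2.1 & Q'.2.2 <= Q.2.2].
Let proper (Q : rect) := [/\ Q.1.1 <= Q.1.2, Q.2.1 <= Q.2.2 & cdiff_rect g Q.1.1 Q.1.2 Q.2.1 Q.2.2].

Let half_split (u v w : C) : u = v + w -> (normc u / 2 <= normc v) = false ->
  normc u / 2 <= normc w.
Proof.
move=> -> /negbT; rewrite -ltNge => H; have := le_normcD v w; lra.
Qed.

Let halfxP Q : proper Q -> let Q' := halfx Q in
  [/\ proper Q', good Q Q', normc (Phi Q) / 2 <= normc (Phi Q'),
    Q'.1.2 - Q'.1.1 = (Q.1.2 - Q.1.1) / 2 & Q'.2.2 - Q'.2.1 = Q.2.2 - Q.2.1].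
Proof.
case: Q => -[a b] [c d]; rewrite /proper /= => -[ab cd dg]; rewrite /halfx/=.
have am : a <= (a + b) / 2 by lra. have mb : (a + b) / 2 <= b by lra.
have mm : a <= (a + b) / 2 <= b by rewrite am.
case: ifPn => /= [H|/negbTE H]; split => //.
- by split => //; exact: (cdiff_rect_sub _ _ _ _ dg).
- lra.
- by split => //; exact: (cdiff_rect_sub _ _ _ _ dg).
- exact: (half_split (rect_int_splitx mm cd dg)).
- lra.
Qed.

Let halfyP Q : proper Q -> let Q' := halfy Q in
  [/\ proper Q', good Q Q', normc (Phi Q) / 2 <= normc (Phi Q'),
    Q'.1.2 - Q'.1.1 = Q.1.2 - Q.1.1 & Q'.2.2 - Q'.2.1 = (Q.2.2 - Q.2.1) / 2].
Proof.
case: Q => -[a b] [c d]; rewrite /proper /= => -[ab cd dg]; rewrite /halfy/=.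
have am : c <= (c + d) / 2 by lra. have mb : (c + d) / 2 <= d by lra.
have mm : c <= (c + d) / 2 <= d by rewrite am.
case: ifPn => /= [H|/negbTE H]; split => //.
- by split => //; exact: (cdiff_rect_sub _ _ _ _ dg).
- lra.
- by split => //; exact: (cdiff_rect_sub _ _ _ _ dg).
- exact: (half_split (rect_int_splity mm ab dg)).
- lra.
Qed.

Let stepP Q : proper Q -> let Q' := halfy (halfx Q) in
  [/\ proper Q', good Q Q', normc (Phi Q) / 4 <= normc (Phi Q'),
    Q'.1.2 - Q'.1.1 = (Q.1.2 - Q.1.1) / 2 & Q'.2.2 - Q'.2.1 = (Q.2.2 - Q.2.1) / 2].
Proof.
move=> pQ; have [p1 [g11 g12 g13 g14] n1 w1 h1] := halfxP pQ.
have [p2 [g21 g22 g23 g24] n2 w2 h2] := halfyP p1.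
split => //; rewrite ?w2 ?w1 ?h2 ?h1//.
- by split; [exact: le_trans g21|exact: le_trans g12|exact: le_trans g23|exact: le_trans g14].
- lra.
Qed.

Let nested (u v : nat -> R) : (forall n, u n <= u n.+1) -> (forall n, v n.+1 <= v n) ->
  (forall n, u n <= v n) -> exists x, forall n, u n <= x <= v n.
Proof.
move=> hu hv huv.
have mu m n : (m <= n)%N -> u m <= u n.
  by move=> /subnK <-; elim: (n - m)%N => // k IH; exact: le_trans (hu _).
have mv m n : (m <= n)%N -> v n <= v m.
  by move=> /subnK <-; elim: (n - m)%N => // k IH; exact: le_trans (hv _) _.
have ub n : ubound (range u) (v n).
  move=> _ [k _ <-]; have [kn|/ltnW nk] := leqP k n.
    exact: le_trans (mu _ _ kn) (huv _).
  exact: le_trans (huv _) (mv _ _ nk).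
exists (sup (range u)) => n; apply/andP; split.
  by apply: ub_le_sup; [exists (v 0%N); exact: ub|exists n].
by apply: ge_sup; [exists (u 0%N); exists 0%N|exact: ub].
Qed.

(** Bisection gives nested rectangles whose integrals have modulus at least [4^-n] times the
    original one. Near their common point [g] differs from an affine function by at most [e] times
    the distance, so for large [n] these integrals are also at most [4 e (S / 2^n)^2]. The powers of
    2 cancel and [e] is arbitrary. *)
Lemma rect_int_eq0 a b c d : a <= b -> c <= d -> cdiff_rect g a b c d ->
  rect_int g a b c d = 0.
Proof.
move=> ab cd dg.
pose Q n := iter n (fun Q => halfy (halfx Q)) ((a, b), (c, d)).
have pQ n : proper (Q n).
  by elim: n => [|n /stepP[]//]; split.
have nQ n : normc (rect_int g a b c d) / 4 ^+ n <= normc (Phi (Q n)).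
  elim: n => [|n IH]; first by rewrite expr0 divr1.
  have [_ _ H _ _] := stepP (pQ n); apply: le_trans H.
  by rewrite exprSr invfM mulrA ler_wpM2r.
have wQ n : (Q n).1.2 - (Q n).1.1 = (b - a) / 2 ^+ n.
  elim: n => [|n IH]; first by rewrite expr0 divr1.
  have [_ _ _ H _] := stepP (pQ n).
  by rewrite [LHS]H IH exprSr invfM mulrA.
have hQ n : (Q n).2.2 - (Q n).2.1 = (d - c) / 2 ^+ n.
  elim: n => [|n IH]; first by rewrite expr0 divr1.
  have [_ _ _ _ H] := stepP (pQ n).
  by rewrite [LHS]H IH exprSr invfM mulrA.
have gQ n : good (Q n) (Q n.+1) by have [] := stepP (pQ n).
have [x xQ] := @nested (fun n => (Q n).1.1) (fun n => (Q n).1.2)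
  (fun n => let: And4 h _ _ _ := gQ n in h) (fun n => let: And4 _ h _ _ := gQ n in h)
  (fun n => let: And3 h _ _ := pQ n in h).
have [y yQ] := @nested (fun n => (Q n).2.1) (fun n => (Q n).2.2)
  (fun n => let: And4 _ _ h _ := gQ n in h) (fun n => let: And4 _ _ _ h := gQ n in h)
  (fun n => let: And3 _ h _ := pQ n in h).
have [l dl] := dg x y (xQ 0%N) (yQ 0%N).
(* Half of the perimeter bounds the diameter of the rectangle and is also the length factor in
   [rect_int_affine]; hence the square of [S] in the final bound. *)
set S := b - a + (d - c); have S0 : 0 <= S by rewrite addr_ge0// subr_ge0.
apply: (@normc_limit0 _ _ (4 * S ^+ 2)) => e e0.
have [del del0 H] := dl _ e0.
have [n nP] : exists n, S / 2 ^+ n < del.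
  have : (fun n => S * (2^-1) ^+ n) @ \oo --> (0 : R).
    rewrite -[X in _ --> X](mulr0 S); apply: cvgMr; apply: cvg_expr.
    by rewrite ger0_norm ?invr_ge0// invf_lt1// ltr1n.
  move=> /cvgrPdist_lt /(_ _ del0)[n _ /(_ n (leqnn n))].
  rewrite sub0r normrN => /(le_lt_trans (ler_norm _)); rewrite exprVn => ?.
  by exists n.
have SE : S / 2 ^+ n = (Q n).1.2 - (Q n).1.1 + ((Q n).2.2 - (Q n).2.1).
  by rewrite wQ hQ -mulrDl.
have [p1 p2 p3] := pQ n.
have := @rect_int_affine g _ _ _ _ (x +i* y) l (e * (S / 2 ^+ n)) p1 p2 p3.
rewrite -SE => HH.
have {}HH : normc (Phi (Q n)) <= 4 * (e * (S / 2 ^+ n) * (S / 2 ^+ n)).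
  apply: HH => s t sQ tQ.
  have st : normc (s +i* t - x +i* y) <= S / 2 ^+ n.
    apply: (le_trans (ler_normc_ReIm _)); rewrite /= SE.
    move: sQ tQ (xQ n) (yQ n) => /andP[? ?] /andP[? ?] /andP[? ?] /andP[? ?].
    by rewrite lerD// ler_norml; apply/andP; split; lra.
  have := H (s +i* t - x +i* y) (le_lt_trans st nP).
  rewrite [_ + (_ - _)]addrC subrK => /le_trans; apply.
  by rewrite ler_wpM2l// ltW.
have := le_trans (nQ n) HH.
rewrite ler_pdivrMr ?exprn_gt0// => /le_trans; apply.
rewrite le_eqVlt; apply/orP; left; apply/eqP.
have -> : (4 : R) ^+ n = 2 ^+ n * 2 ^+ n by rewrite -exprMn; congr (_ ^+ n); ring.
by field; rewrite expf_neq0.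
Qed.

End bisection.
End goursat.

(** * Averages over circles *)

Section circle_average.
Context {R : realType}.
Local Notation C := R[i].
Implicit Types (F G : R -> C) (f : C -> C) (r t M : R) (z w l : C).

Definition ccirc F := forall t, ccont F t.

Definition avg F : C := ((2 * pi)^-1)%:C * cint 0 (2 * pi) F.

Lemma twopi_gt0 : 0 < 2 * pi :> R.
Proof. by rewrite mulr_gt0 ?pi_gt0. Qed.

Lemma invtwopi_ge0 : 0 <= (2 * pi)^-1 :> R.
Proof. by rewrite invr_ge0 ltW// twopi_gt0. Qed.

Lemma ccirc_on F : ccirc F -> cconton 0 (2 * pi) F.
Proof. by move=> cF t _; exact: cF. Qed.

Lemma eq_avg F G : F =1 G -> avg F = avg G.
Proof. by move=> FG; congr (_ * _); apply: eq_cint => t _; exact: FG. Qed.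

Lemma avgD F G : ccirc F -> ccirc G -> avg (fun t => F t + G t) = avg F + avg G.
Proof. by move=> cF cG; rewrite /avg (cintD (ccirc_on cF) (ccirc_on cG)); exact: mulrDr. Qed.

Lemma avgZ w F : ccirc F -> avg (fun t => w * F t) = w * avg F.
Proof. by move=> cF; rewrite /avg (cintZ w (ccirc_on cF)); exact: mulrCA. Qed.

Lemma avgB F G : ccirc F -> ccirc G -> avg (fun t => F t - G t) = avg F - avg G.
Proof.
move=> cF cG; rewrite -[- avg G]mulN1r -avgZ// -avgD//.
  by apply: eq_avg => t; rewrite mulN1r.
by move=> t; apply: ccontZ.
Qed.

Lemma avg_cst w : avg (fun=> w) = w.
Proof.
rewrite /avg cint_cst ?ltW ?twopi_gt0// subr0 mulrA -rmorphM mulVf ?mul1r//.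
by rewrite gt_eqF ?twopi_gt0.
Qed.

Lemma avg_sum (I : Type) (s : seq I) (F : I -> R -> C) : (forall i, ccirc (F i)) ->
  avg (fun t => \sum_(i <- s) F i t) = \sum_(i <- s) avg (F i).
Proof.
move=> cF; elim: s => [|i s IH].
  by rewrite big_nil; under eq_avg do rewrite big_nil; exact: avg_cst.
rewrite big_cons -IH -avgD//; first by apply: eq_avg => t; rewrite big_cons.
by move=> t; apply: ccont_sum => j; exact: cF.
Qed.

Lemma normc_avg F M : ccirc F -> (forall t, 0 <= t <= 2 * pi -> normc (F t) <= M) -> normc (avg F) <= 2 * M.
Proof.
move=> cF FM; rewrite /avg normcM normcC (ger0_norm invtwopi_ge0).
have := @normc_cint _ 0 (2 * pi) F M (ltW twopi_gt0) (ccirc_on cF) FM.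
rewrite subr0 => H; rewrite mulrC ler_pdivrMr ?twopi_gt0//.
by rewrite -mulrA.
Qed.

Let i_neq0 : 'i%C != 0 :> C.
Proof. by rewrite -normc_eq0 normc_i oner_eq0. Qed.

(** Up to the factor ['i], [F t * circ t] is the derivative of [f (circ t)], and [circ] takes the
    same value at 0 and at [2 * pi]. *)
Lemma avg_FTC f F : (forall t, cdiff f (circ t) (F t)) -> ccirc F ->
  avg (fun t => F t * circ t) = 0.
Proof.
move=> df cF; have cFc : ccirc (fun t => F t * circ t).
  by move=> t; apply: ccontM => //; exact: ccont_circ.
apply: (mulfI i_neq0); rewrite mulr0 -avgZ// /avg.
rewrite (@cint_FTC _ _ _ (fun z => f (cexp ('i%C * z))) _ twopi_gt0).
- by rewrite -!circE circ0 circ2pi subrr mulr0.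
- move=> t _; rewrite (_ : 'i%C * (F t * circ t) = F t * (circ t * ('i%C * 1))).
    by rewrite circE; apply: (cdiff_comp (cdiff_comp (cdiffZ _ (cdiff_id _)) (cdiff_cexp _)));
      rewrite -circE; exact: df.
  by rewrite mulr1; ring.
- by move=> t _; apply: ccontZ; exact: cFc.
Qed.

Lemma avgJ F : ccirc F -> avg (fun t => (F t)^*%C) = (avg F)^*%C.
Proof.
move=> /ccirc_on /cconton_integrable[_ f2]; rewrite /avg rmorphM; congr (_ * _); first by rewrite /= oppr0.
rewrite /cint /=; congr (_ +i* _); first by apply: eq_Rintegral => t _; case: (F t).
rewrite -[- _]mulN1r -RintegralZl//; apply: eq_Rintegral => t _.
by rewrite mulN1r; case: (F t).
Qed.

Lemma Re_avg_ge0 F : (forall t, 0 <= complex.Re (F t)) -> 0 <= complex.Re (avg F).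
Proof.
move=> F0; rewrite /avg; have := invtwopi_ge0.
have : 0 <= complex.Re (cint 0 (2 * pi) F) by apply: Rintegral_ge0 => t _; exact: F0.
by case: (cint _ _ _) => x y /= x0 p0; rewrite mul0r subr0 mulr_ge0.
Qed.

Lemma avg_circX k : avg (fun t => circ t ^+ k) = (k == 0%N)%:R :> C.
Proof.
case: k => [|k]; first by under eq_avg do rewrite expr0; rewrite avg_cst.
under eq_avg do rewrite exprSr.
apply: (avg_FTC (f := fun w => k.+1%:R^-1 * w ^+ k.+1)) => t.
  have k0 : k.+1%:R != 0 :> C by rewrite pnatr_eq0.
  by have := cdiffZ k.+1%:R^-1 (cdiffX k.+1 (circ t)); rewrite mulrA mulVf// mul1r.
by apply: ccontX; exact: ccont_circ.
Qed.

Lemma avg_circX_conj (k l : nat) : avg (fun t => circ t ^+ k * (circ t ^+ l)^*%C) = (k == l)%:R :> C.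
Proof.
have cX n : ccirc (fun t => circ t ^+ n) by move=> t; apply: ccontX; exact: ccont_circ.
have E t : circ t * (circ t)^*%C = 1 by rewrite normcJE normc_circ expr1n.
wlog kl : k l / (l <= k)%N => [H|].
  have [/H//|/ltnW/H {}H] := leqP l k.
  rewrite eq_sym -[RHS]conjc_nat -H -avgJ.
    by apply: eq_avg => t; rewrite [RHS]rmorphM [RHS]mulrC; congr (_ * _); exact: esym (conjcK _).
  by move=> t; apply: ccontM; [exact: cX|apply: ccontJ; exact: cX].
rewrite -[k](subnK kl) (eq_avg (G := fun t => circ t ^+ (k - l))) ?avg_circX; last first.
  by move=> t; rewrite rmorphXn exprD -mulrA -exprMn E expr1n mulr1.
by rewrite -{4}[l]add0n eqn_add2r.
Qed.

Lemma circr_ccont r t : ccont (fun s => r%:C * circ s) t.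
Proof. exact: ccontZ (ccont_circ t). Qed.

Lemma normc_circr r t : 0 <= r -> normc (r%:C * circ t) = r.
Proof. by move=> r0; rewrite normcM normc_circ normcC mulr1 ger0_norm. Qed.

(** The exponential maps a rectangle of height [2 * pi] onto the annulus. The pulled-back function
    agrees on the two horizontal sides, so Goursat's lemma equates the integrals over the vertical
    sides, which are the two circles. *)
Lemma avg_annulus f r1 r2 : 0 < r1 -> r1 <= r2 ->
  (forall w, r1 <= normc w <= r2 -> exists l, cdiff f w l) ->
  avg (fun t => f (r1%:C * circ t)) = avg (fun t => f (r2%:C * circ t)).
Proof.
move=> r10 r12 df; have r20 := lt_le_trans r10 r12.
pose g z := f (cexp z).
have l12 : ln r1 <= ln r2 by rewrite ler_ln.
have dg : cdiff_rect g (ln r1) (ln r2) 0 (2 * pi).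
  move=> x y /andP[x1 x2] _.
  have [|l dl] := df (cexp (x +i* y)).
    by rewrite normc_cexp/= -[r1]lnK// -[r2]lnK// !ler_expR x1.
  by exists (l * cexp (x +i* y)); exact: (cdiff_comp (cdiff_cexp _) dl).
have := rect_int_eq0 l12 (ltW twopi_gt0) dg; rewrite /rect_int.
have -> : cint (ln r1) (ln r2) (fun x => g (x +i* 0) - g (x +i* (2 * pi))) = 0.
  rewrite (@eq_cint _ _ _ _ (fun=> 0)) ?cint_cst ?mulr0// => t _.
  apply/eqP; rewrite subr_eq0; apply/eqP; congr f; rewrite /cexp /=.
  by rewrite -!/(circ _) circ0 circ2pi.
rewrite add0r => /eqP; rewrite mulf_eq0.
rewrite (negbTE i_neq0).
have mm x : x = ln r1 \/ x = ln r2 -> ln r1 <= x <= ln r2.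
  by move=> [] ->; rewrite lexx l12.
rewrite /= (@eq_cint _ _ _ _ (fun y => g (ln r2 +i* y) + (-1) * g (ln r1 +i* y))); last first.
  by move=> t _; rewrite mulN1r.
rewrite cintD; last 2 first.
- by apply: (cconton_vline dg); apply: mm; right.
- by move=> t tI; apply: ccontZ; apply: (cconton_vline dg) => //; apply: mm; left.
rewrite cintZ ?mulN1r ?subr_eq0; last by apply: (cconton_vline dg); apply: mm; left.
move=> /eqP H; rewrite /avg; congr (_ * _).
transitivity (cint 0 (2 * pi) (fun y => g (ln r1 +i* y))).
  by apply: eq_cint => t _; rewrite /g cexp_polar.
by rewrite -H; apply: eq_cint => t _; rewrite /g cexp_polar.
Qed.

End circle_average.

(** * Cauchy's formula on circles centred at the origin *)

Section cauchy.
Context {R : realType}.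
Local Notation C := R[i].
Implicit Types (f : C -> C) (r t M : R) (z w l : C).

Definition holo (r : R) f := forall z, normc z < r -> exists l, cdiff f z l.

(** Joint continuity at each point of the segment [r = r0] becomes uniform in [t] by compactness of
    [[a, b]]. *)
Lemma uniform_tube (H : R -> R -> C) r0 a b :
  (forall t e, 0 < e -> exists2 d : R, 0 < d &
    forall r s, `|r - r0| < d -> `|s - t| < d -> normc (H r s - H r0 t) < e) ->
  forall e : R, 0 < e -> exists2 d : R, 0 < d &
    forall r t, `|r - r0| < d -> a <= t <= b -> normc (H r t - H r0 t) < e.
Proof.
move=> cH e e0; have e20 : 0 < e / 2 by rewrite divr_gt0.
have /compact_near_coveringP := @segment_compact R a b.
move=> /(_ R (nbhs r0) (fun r t => normc (H r t - H r0 t) < e) _).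
case; last first.
  move=> d /= d0 dP; exists d => // r t rr tab.
  by apply: (dP r); rewrite /= /ball_ ?in_itv//= distrC.
move=> t _; have [d d0 dP] := cH t _ e20.
exists (ball t d, ball r0 d); first by split; exact: nbhsx_ballx.
move=> [s r] [/= st rr]; rewrite /ball/= in st rr.
rewrite distrC in st; rewrite distrC in rr.
have h1 := dP r s rr st; have h2 := dP r0 s; rewrite subrr normr0 in h2.
have {}h2 := h2 d0 st.
have -> : H r s - H r0 s = (H r s - H r0 t) - (H r0 s - H r0 t) by ring.
apply: (le_lt_trans (le_normcD _ _)); rewrite normcN; lra.
Qed.

(** Stated for continuous [f] with [cauchy_quot] in view: at the point [z] itself that quotient is
    shown to be continuous, and differentiable only elsewhere. *)
Lemma avg_ceps f r0 (r1 : R) : 0 <= r0 < r1 -> (forall w, normc w < r1 -> ceps f w) ->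
  forall e : R, 0 < e -> exists2 d : R, 0 < d &
    forall r, `|r - r0| < d ->
    normc (avg (fun t => f (r%:C * circ t)) - avg (fun t => f (r0%:C * circ t))) <= e.
Proof.
move=> /andP[r00 r01] cf.
have nr r t : `|r - r0| < r1 - r0 -> normc (r%:C * circ t) < r1.
  move=> h; rewrite normcM normc_circ mulr1 normcC.
  have : `|r| <= `|r - r0| + `|r0| by rewrite -{1}(subrK r0 r) ler_normD.
  by rewrite (ger0_norm r00); lra.
have cr r : `|r - r0| < r1 - r0 -> ccirc (fun t => f (r%:C * circ t)).
  by move=> rr t; apply: ccont_ceps; [exact/cf/nr|exact: circr_ccont].
move=> e e0; have e20 : 0 < e / 2 by rewrite divr_gt0.
have [|d d0 dP] := @uniform_tube (fun r t => f (r%:C * circ t)) r0 0 (2 * pi) _ _ e20.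
  move=> t {}e {}e0 {e20}; have [|d d0 dP] := cf (r0%:C * circ t) _ _ e0.
    by apply: nr; rewrite subrr normr0 subr_gt0.
  have k0 : 0 < r0 + 1 by rewrite ltr_wpDl.
  have [d1 d10 d1P] := ccont_circ t (divr_gt0 d0 (mulr_gt0 (ltr0n R 2) k0)).
  exists (Num.min (d / 2) d1); first by rewrite lt_min d10 divr_gt0.
  move=> r s; rewrite !lt_min => /andP[h1 _] /andP[_ /d1P h2]; apply: dP.
  have -> : r%:C * circ s - r0%:C * circ t =
     (r - r0)%:C * circ s + r0%:C * (circ s - circ t) by rewrite rmorphB/=; ring.
  apply: (le_lt_trans (le_normcD _ _)); rewrite !normcM normc_circ mulr1 !normcC.
  rewrite (ger0_norm r00).
  rewrite invfM mulrA ltr_pdivlMr// in h2.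
  have := normc_ge0 (circ s - circ t); lra.
exists (Num.min d (r1 - r0)); first by rewrite lt_min d0 subr_gt0.
move=> r; rewrite lt_min => /andP[rd rr].
have cr0 : ccirc (fun t => f (r0%:C * circ t)) by apply: cr; rewrite subrr normr0 subr_gt0.
rewrite -avgB; [|exact: cr|exact: cr0].
rewrite -[leRHS](divfK (x := 2)) ?pnatr_eq0// mulrC; apply: normc_avg.
  by move=> t; apply: ccontB; [exact: cr|exact: cr0].
by move=> t tI; exact/ltW/dP.
Qed.

(* [w (f w - f z) / (w - z)], whose circular averages vanish on both sides of
   the circle through [z]. *)
Definition cauchy_quot f z l w := w * (if w == z then l else (f w - f z) / (w - z)).

Lemma cauchy_quot_cdiff r f z l w : holo r f -> normc w < r -> w != z ->
  exists l', cdiff (cauchy_quot f z l) w l'.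
Proof.
move=> hf wr wz; have [lf dlf] := hf _ wr.
have wz0 : w - z != 0 by rewrite subr_eq0.
have dw : cdiff (fun w => w - z) w (1 - 0) by apply: cdiffB; [exact: cdiff_id|exact: cdiff_cst].
have dq := cdiffM (cdiff_id w) (cdiffM (cdiffB dlf (cdiff_cst (f z) w)) (cdiffV dw wz0)).
eexists; apply: (cdiff_near (d := normc (w - z)) _ _ dq); first by rewrite normc_gt0.
move=> v; rewrite /cauchy_quot; case: eqP => // -> .
by rewrite normc_distC ltxx.
Qed.

Lemma cauchy_quot_ceps r f z l w : holo r f -> normc w < r -> cdiff f z l ->
  ceps (cauchy_quot f z l) w.
Proof.
move=> hf wr dl; have [->|wz] := eqVneq w z; last first.
  by have [l' dl'] := cauchy_quot_cdiff l hf wr wz; exact: cdiff_cont dl'.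
suff cq : ceps (fun w => if w == z then l else (f w - f z) / (w - z)) z.
  exact: (ccontM (cdiff_cont (cdiff_id z)) cq).
move=> e e0; have e20 : 0 < e / 2 by rewrite divr_gt0.
have [d d0 dP] := dl _ e20; exists d => // v vd; rewrite eqxx.
case: eqP => [_|/eqP vz]; first by rewrite subrr normc0.
have vz0 : v - z != 0 by rewrite subr_eq0.
have -> : (f v - f z) / (v - z) - l = (f v - f z - l * (v - z)) / (v - z).
  by field.
rewrite normcM normcV ltr_pdivrMr ?normc_gt0//.
have := dP _ vd; rewrite [z + _]addrC subrK => /le_lt_trans; apply.
by rewrite ltr_pM2r ?normc_gt0//; lra.
Qed.

(** As a function of the radius, the average is constant below [normc z] and constant above it,
    continuous at 0 and at [normc z], and 0 at radius 0 because of the factor [w] in [cauchy_quot].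
    So it vanishes throughout. *)
Lemma avg_cauchy_quot r0 f z l r : holo r0 f -> cdiff f z l -> normc z < r < r0 ->
  avg (fun t => cauchy_quot f z l (r%:C * circ t)) = 0.
Proof.
move=> hf dl /andP[zr rr0].
have cK w : normc w < r0 -> ceps (cauchy_quot f z l) w.
  by move=> wr; exact: cauchy_quot_ceps hf wr dl.
pose M r := avg (fun t => cauchy_quot f z l (r%:C * circ t)).
have cM s : 0 <= s < r0 -> forall e : R, 0 < e -> exists2 d : R, 0 < d &
    forall r, `|r - s| < d -> normc (M r - M s) <= e.
  by move=> sr; exact: (avg_ceps sr cK).
have M0 : M 0 = 0.
  rewrite /M (@eq_avg _ _ (fun=> 0)) ?avg_cst// => t.
  by rewrite /cauchy_quot mul0r mul0r.
have Mc s1 s2 : 0 < s1 -> s1 <= s2 -> s2 < r0 -> (s2 < normc z) || (normc z < s1) ->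
    M s1 = M s2.
  move=> s10 s12 s2r zs; apply: avg_annulus => // w /andP[w1 w2].
  apply: (cauchy_quot_cdiff l hf); first exact: le_lt_trans s2r.
  apply: contraTneq zs => <-; rewrite negb_or -!leNgt w2 w1//.
have z0 := normc_ge0 z.
(* Continuity in the radius transfers to [s] a value that is taken at radii arbitrarily close to
   [s]. *)
have jump s s' : 0 <= s < r0 -> (forall d : R, 0 < d -> exists2 s1, `|s1 - s| < d & M s1 = M s') ->
    M s = M s'.
  move=> sr H; apply/eqP; rewrite eq_sym -subr_eq0; apply/eqP/normc_small0 => e e0.
  have [d d0 dP] := cM _ sr _ e0; have [s1 s1d <-] := H _ d0; exact: dP.
have Mz : M (normc z) = 0.
  have [/eqP|zn] := eqVneq (normc z) 0.
    by rewrite normc_eq0 => /eqP ->; rewrite normc0.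
  have z1 : 0 < normc z by rewrite lt_def zn.
  have zr0 : normc z < r0 by exact: lt_trans rr0.
  have M1 s : 0 < s < normc z -> M s = 0.
    move=> /andP[s0 sz]; rewrite -M0; symmetry; apply: jump; first by rewrite lexx (lt_trans z1).
    move=> d d0; exists (Num.min (d / 2) s).
      rewrite subr0 ger0_norm; first by rewrite gt_min ltr_pdivrMr// mulr_natr mulr2n ltrDl d0.
      by rewrite le_min !ltW// divr_gt0.
    apply: Mc; rewrite ?lt_min ?s0 ?divr_gt0// ?ge_min ?lexx ?orbT// ?sz//.
    exact: lt_trans sz _.
  transitivity (M (normc z / 2)); last by apply: M1; lra.
  apply: jump; first by rewrite z0.
  move=> d d0; pose s := Num.max (normc z / 2) (normc z - d / 2); exists s.
    have s1 : normc z - d / 2 <= s by rewrite le_max lexx orbT.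
    have s2 : s < normc z by rewrite gt_max; apply/andP; split; lra.
    by rewrite ler0_norm; lra.
  have s1 : normc z / 2 <= s by rewrite le_max lexx.
  have s2 : s < normc z by rewrite gt_max; apply/andP; split; lra.
  by rewrite !M1//; apply/andP; split; lra.
rewrite -/(M r) -Mz; symmetry; apply: jump; first by rewrite z0 (lt_trans zr).
move=> d d0; pose s := Num.min r (normc z + d / 2).
have s1 : s <= normc z + d / 2 by rewrite ge_min lexx orbT.
have s2 : normc z < s by rewrite lt_min zr/=; lra.
have s3 : s <= r by rewrite ge_min lexx.
exists s; first by rewrite ger0_norm; lra.
apply: Mc => //; rewrite ?s2 ?orbT//; lra.
Qed.

Lemma normc_circr_sub r t z : 0 <= r -> r - normc z <= normc (r%:C * circ t - z).
Proof. by move=> rp; have := lerB_normc (r%:C * circ t) z; rewrite normc_circr. Qed.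

Lemma circr_sub_neq0 r t z : normc z < r -> r%:C * circ t - z != 0.
Proof.
move=> zr; rewrite -normc_gt0 (lt_le_trans _ (normc_circr_sub _ _ _)) ?subr_gt0//.
exact: le_trans (ltW zr).
Qed.

Lemma ccirc_kernel r z : normc z < r -> ccirc (fun t => (r%:C * circ t - z)^-1).
Proof.
move=> zr t; have w0 := circr_sub_neq0 t zr.
have dw : cdiff (fun w => w - z) (r%:C * circ t) (1 - 0).
  by apply: cdiffB; [exact: cdiff_id|exact: cdiff_cst].
exact: (ccont_comp (cdiffV dw w0) (circr_ccont r t)).
Qed.

(** The average does not depend on the radius, and the kernel tends to 1 uniformly as the radius
    grows. *)
Lemma avg_cauchy_kernel z r : normc z < r ->
  avg (fun t => r%:C * circ t / (r%:C * circ t - z)) = 1.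
Proof.
move=> zr; have z0 := normc_ge0 z; have r0 : 0 < r by exact: le_lt_trans zr.
pose k w := w / (w - z).
apply/eqP; rewrite -subr_eq0; apply/eqP/(@normc_limit0 _ _ 2) => e e0.
(* Chosen so that [normc z <= e * (s - normc z)]: on the circle of radius [s] the kernel then
   differs from 1 by at most [e]. *)
pose s := Num.max r (normc z + normc z / e).
have rs : r <= s by rewrite le_max lexx.
have zs : normc z < s by exact: lt_le_trans rs.
have s1 : normc z + normc z / e <= s by rewrite le_max lexx orbT.
have wz w : normc z < normc w -> w - z != 0.
  by move=> h; rewrite subr_eq0; apply: contraTneq h => ->; rewrite ltxx.
have -> : avg (fun t => k (r%:C * circ t)) = avg (fun t => k (s%:C * circ t)).
  apply: avg_annulus => // w /andP[rw _].
  have w0 := wz _ (lt_le_trans zr rw).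
  have dw : cdiff (fun w => w - z) w (1 - 0) by apply: cdiffB; [exact: cdiff_id|exact: cdiff_cst].
  by eexists; exact: (cdiffM (cdiff_id w) (cdiffV dw w0)).
have s0 : 0 <= s by rewrite (le_trans _ (ltW zs)).
have ck : ccirc (fun t => k (s%:C * circ t)).
  by move=> t; apply: ccontM; [exact: circr_ccont|exact: ccirc_kernel].
rewrite -[X in _ - X](avg_cst 1) -avgB//; last by move=> t; exact: ccont_cst.
apply: normc_avg; first by move=> t; apply: ccontB => //; exact: ccont_cst.
move=> t _; have w0 := circr_sub_neq0 t zs.
have -> : k (s%:C * circ t) - 1 = z / (s%:C * circ t - z) by rewrite /k; field.
rewrite normcM normcV ler_pdivrMr ?normc_gt0//.
have h := normc_circr_sub t z s0.
apply: (@le_trans _ _ (e * (s - normc z))); last by rewrite ler_wpM2l// ltW.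
rewrite mulrC -ler_pdivrMr//; lra.
Qed.

Lemma cauchy_formula r0 f z r : holo r0 f -> normc z < r < r0 ->
  f z = avg (fun t => f (r%:C * circ t) * (r%:C * circ t / (r%:C * circ t - z))).
Proof.
move=> hf /andP[zr rr0]; have z0 := normc_ge0 z; have r00 : 0 < r by exact: le_lt_trans zr.
have [l dl] := hf z (lt_trans zr rr0).
have h := @avg_cauchy_quot _ f z l r hf dl.
rewrite zr rr0 in h; have {}h := h isT.
have cc t : ccont (fun s => r%:C * circ s / (r%:C * circ s - z)) t.
  by apply: ccontM; [exact: circr_ccont|exact: ccirc_kernel].
have cf t : ccont (fun s => f (r%:C * circ s)) t.
  have [|l' dl'] := hf (r%:C * circ t); first by rewrite normc_circr// ltW.
  exact: (ccont_comp dl' (circr_ccont r t)).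
rewrite -[LHS]mulr1 -(avg_cauchy_kernel zr) -avgZ//.
apply/eqP; rewrite eq_sym -subr_eq0 -avgB//; last 2 first.
- by move=> t; apply: ccontM; [exact: cf|exact: cc].
- by move=> t; apply: ccontZ; exact: cc.
rewrite -h; apply/eqP/eq_avg => t; rewrite /cauchy_quot.
have := circr_sub_neq0 t zr; rewrite subr_eq0 => /negbTE ->.
by field; exact: circr_sub_neq0.
Qed.

End cauchy.

(** * Taylor coefficients and uniform remainder bounds *)

Section taylor.
Context {R : realType}.
Local Notation C := R[i].
Implicit Types (f : C -> C) (r t M : R) (z w l : C).

(* Any radius in [(0, 1)] gives the same coefficients. *)
Definition coef f (n : nat) : C :=
  avg (fun t => f ((2^-1)%:C * circ t) / ((2^-1)%:C * circ t) ^+ n).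

Lemma holo_circ_ccont r0 f r : holo r0 f -> 0 <= r < r0 ->
  ccirc (fun t => f (r%:C * circ t)).
Proof.
move=> hf /andP[r00 rr] t; have [|l dl] := hf (r%:C * circ t); first by rewrite normc_circr.
exact: (ccont_comp dl (circr_ccont r t)).
Qed.

Lemma holo_le r0 r1 f : r1 <= r0 -> holo r0 f -> holo r1 f.
Proof. by move=> rr hf z zr; apply: hf; exact: lt_le_trans rr. Qed.

Lemma circr_neq0 r t : 0 < r -> r%:C * circ t != 0.
Proof. by move=> r0; rewrite -normc_gt0 normc_circr// ltW. Qed.

Lemma ccont_circrV r n : 0 < r -> ccirc (fun t => ((r%:C * circ t) ^+ n)^-1).
Proof.
move=> r0 t; have h : (r%:C * circ t) ^+ n != 0 by rewrite expf_neq0 ?circr_neq0.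
apply: (ccont_comp (cdiff_inv h)).
by apply: ccontX; exact: circr_ccont.
Qed.

Lemma coefE r0 f r n : 1 <= r0 -> holo r0 f -> 0 < r < r0 ->
  coef f n = avg (fun t => f (r%:C * circ t) / (r%:C * circ t) ^+ n).
Proof.
move=> r01 hf /andP[rp rr].
have h r1 r2 : 0 < r1 -> r1 <= r2 -> r2 < r0 ->
  avg (fun t => f (r1%:C * circ t) / (r1%:C * circ t) ^+ n) =
  avg (fun t => f (r2%:C * circ t) / (r2%:C * circ t) ^+ n).
  move=> r10 r12 r2r; apply: (@avg_annulus _ (fun w => f w / w ^+ n)) => //.
  move=> w /andP[w1 w2]; have [l dl] := hf w (le_lt_trans w2 r2r).
  have w0 : w ^+ n != 0 by rewrite expf_neq0// -normc_gt0 (lt_le_trans r10).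
  by eexists; exact: (cdiffM dl (cdiffV (cdiffX n w) w0)).
have [rh|/ltW rh] := leP r 2^-1.
  by rewrite (h r 2^-1)//; lra.
by rewrite /coef (h 2^-1 r)//; lra.
Qed.

Lemma holo_circ_max r0 f r : holo r0 f -> 0 <= r < r0 -> exists t0,
  forall t, 0 <= t <= 2 * pi -> normc (f (r%:C * circ t)) <= normc (f (r%:C * circ t0)).
Proof.
move=> hf rr.
have cf : {within `[0, 2 * pi], continuous (fun t => normc (f (r%:C * circ t)) ^+ 2)}.
  have c2 : ccirc (fun t => (normc (f (r%:C * circ t)) ^+ 2)%:C).
    by move=> t; apply: ccont_normc2; exact: (holo_circ_ccont hf rr).
  by have [] := cconton_ReIm (ccirc_on c2).
have [t0 _ H] := EVT_max (ltW twopi_gt0) cf.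
exists t0 => t tI.
have {}H := H t; rewrite in_itv in H; have {}H := H tI.
by rewrite -(@ler_pXn2r _ 2) ?nnegrE ?normc_ge0.
Qed.

(** In Cauchy's formula, removing [n] terms of the geometric series from the kernel [w / (w - z)]
    leaves [(z / w) ^+ n * (w / (w - z))]. *)
Lemma taylor_remainder r0 f r M z n : 1 <= r0 -> holo r0 f -> normc z < r < r0 ->
  (forall t, 0 <= t <= 2 * pi -> normc (f (r%:C * circ t)) <= M) ->
  normc (f z - \sum_(k < n) coef f k * z ^+ k) <=
  2 * (M * ((normc z / r) ^+ n * (r / (r - normc z)))).
Proof.
move=> r01 hf /andP[zr rr] fM; have rp : 0 < r by exact: le_lt_trans zr.
have cf : ccirc (fun t => f (r%:C * circ t)).
  by apply: (holo_circ_ccont hf); rewrite ltW.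
have cfV k : ccirc (fun t => z ^+ k * (f (r%:C * circ t) / (r%:C * circ t) ^+ k)).
  by move=> t; apply: ccontZ; apply: ccontM; [exact: cf|exact: ccont_circrV].
have -> : \sum_(k < n) coef f k * z ^+ k =
    avg (fun t => \sum_(k < n) z ^+ k * (f (r%:C * circ t) / (r%:C * circ t) ^+ k)).
  rewrite avg_sum; last by move=> k; exact: cfV.
  apply: eq_bigr => k _; rewrite (@coefE r0 _ r)// ?rp// mulrC avgZ//.
  by move=> t; apply: ccontM; [exact: cf|exact: ccont_circrV].
have cK : ccirc (fun t => f (r%:C * circ t) * (r%:C * circ t / (r%:C * circ t - z))).
  move=> t; apply: ccontM; first exact: cf.
  by apply: ccontM; [exact: circr_ccont|exact: ccirc_kernel].
have cS : ccirc (fun t => \sum_(k < n) z ^+ k * (f (r%:C * circ t) / (r%:C * circ t) ^+ k)).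
  by move=> t; apply: ccont_sum => k; exact: cfV.
rewrite (@cauchy_formula _ r0 f z r)// ?zr// -avgB//.
apply: normc_avg; first by move=> t; apply: ccontB; [exact: cK|exact: cS].
move=> t tI; have w0 := circr_neq0 t rp; have wz := circr_sub_neq0 t zr.
set w := r%:C * circ t in w0 wz *.
have -> : f w * (w / (w - z)) - \sum_(k < n) z ^+ k * (f w / w ^+ k) =
   f w * ((z / w) ^+ n * (w / (w - z))).
  have -> : \sum_(k < n) z ^+ k * (f w / w ^+ k) = f w * \sum_(k < n) (z / w) ^+ k.
    rewrite mulr_sumr; apply: eq_bigr => k _.
    by rewrite expr_div_n mulrCA.
  rewrite -mulrBr; congr (_ * _).
  have := subrX1 (z / w) n => H.
  have -> : (z / w) ^+ n = 1 + (z / w - 1) * \sum_(i < n) (z / w) ^+ i by rewrite -H; ring.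
  by field; rewrite wz.
rewrite !normcM normcX !normcM !normcV normc_circr; last exact: ltW.
have rp' := ltW rp; have qn : 0 <= (normc z / r) ^+ n by rewrite exprn_ge0// divr_ge0.
rewrite -normcM normc_circr//.
apply: ler_pM => //; [by rewrite mulr_ge0// divr_ge0|exact: fM|].
rewrite ler_wpM2l// ler_wpM2l//.
rewrite lef_pV2 ?posrE ?subr_gt0 ?normc_gt0//.
by apply: normc_circr_sub; exact: ltW.
Qed.

(** The difference [f (z + h) - f z] is estimated by Cauchy's formula at both points, which replaces
    differentiation under the integral. *)
Lemma cauchy_derivative_bound r0 f r M z l : holo r0 f -> normc z < r < r0 ->
  (forall t, 0 <= t <= 2 * pi -> normc (f (r%:C * circ t)) <= M) -> cdiff f z l ->
  normc l <= 4 * (M * r / (r - normc z) ^+ 2).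
Proof.
move=> hf /andP[zr rr] fM dl; have rp : 0 < r by exact: le_lt_trans zr.
have M0 : 0 <= M.
  by apply: le_trans (fM 0 _) => //; rewrite lexx ltW// twopi_gt0.
pose del := r - normc z; have del0 : 0 < del by rewrite subr_gt0.
apply/ler_addgt0Pr => e e0.
have [d d0 dP] := dl _ e0.
(* The increment is at most half of the distance [del] from [z] to the circle, so the two kernel
   denominators are at least [del] and [del / 2]. *)
pose x := Num.min (d / 2) (del / 2); have x0 : 0 < x by rewrite lt_min !divr_gt0.
have xd : x <= d / 2 by rewrite ge_min lexx.
have xdel : x <= del / 2 by rewrite ge_min lexx orbT.
pose h : C := x%:C; have nh : normc h = x by rewrite normcC gtr0_norm.
have hd : normc h < d by rewrite nh; lra.
have zhr : normc (z + h) < r.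
  have := le_normcD z h; rewrite nh; rewrite /del in xdel del0; lra.
have cf : ccirc (fun t => f (r%:C * circ t)).
  by apply: (holo_circ_ccont hf); rewrite ltW.
have cK w : normc w < r -> ccirc (fun t => f (r%:C * circ t) * (r%:C * circ t / (r%:C * circ t - w))).
  move=> wr t; apply: ccontM; first exact: cf.
  by apply: ccontM; [exact: circr_ccont|exact: ccirc_kernel].
have H : normc (f (z + h) - f z) <= 2 * (M * r * x / (del * (del / 2))).
  rewrite (@cauchy_formula _ r0 f z r) ?zr// (@cauchy_formula _ r0 f (z + h) r) ?zhr//.
  rewrite -avgB; [|exact: cK|exact: cK].
  apply: normc_avg; first by move=> t; apply: ccontB; exact: cK.
  move=> t tI; have wz := circr_sub_neq0 t zr; have wzh := circr_sub_neq0 t zhr.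
  have n1 := normc_circr_sub t z (ltW rp); have n2 := normc_circr_sub t (z + h) (ltW rp).
  have nw : normc (r%:C * circ t) = r by rewrite normc_circr// ltW.
  move: (fM t tI) n1 n2 nw; set w := r%:C * circ t in wz wzh *; move=> fw n1 n2 nw.
  have -> : f w * (w / (w - (z + h))) - f w * (w / (w - z)) =
      f w * w * h / ((w - z) * (w - (z + h))) by field; rewrite ?wz ?wzh.
  clearbody w; have rp' := ltW rp; have x0' := ltW x0.
  rewrite !normcM normcV normcM nw nh.
  apply: ler_pM; [by rewrite !mulr_ge0|by rewrite invr_ge0 mulr_ge0| |].
    by rewrite ler_wpM2r// ler_wpM2r.
  have zh := le_normcD z h; rewrite nh in zh.
  rewrite lef_pV2 ?posrE ?mulr_gt0 ?divr_gt0 ?normc_gt0//.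
  have del0' := ltW del0.
  apply: ler_pM => //; first by rewrite divr_ge0.
  by rewrite /del in xdel *; lra.
have : normc l * x <= (4 * (M * r / del ^+ 2) + e) * x.
  rewrite -nh -normcM.
  have -> : l * h = (f (z + h) - f z) - (f (z + h) - f z - l * h) by ring.
  apply: (le_trans (le_normcD _ _)); rewrite normcN mulrDl lerD//; last exact: dP.
  apply: (le_trans H); rewrite le_eqVlt nh; apply/orP; left; apply/eqP.
  by field; rewrite gt_eqF.
by rewrite ler_pM2r.
Qed.

Lemma holo_sub_poly r0 f (c : nat -> C) n : holo r0 f ->
  holo r0 (fun w => f w - \sum_(k < n) c k * w ^+ k).
Proof.
move=> hf z /hf[l dl]; eexists; apply: (cdiffB dl).
by apply: cdiff_sum => k; exact: (cdiffZ _ (cdiffX k z)).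
Qed.

(** Two radii are inserted between [r] and [r0]. The remainder formula on the circle of radius [r2]
    gives the ratio [q = r1 / r2] for [normc z <= r1], and the derivative bound applied to the
    remainder passes from [r1] down to [r]. The case [r = 1 < r0] serves Blaschke products on the
    unit circle. *)
Lemma taylor_uniform r0 f r : 1 <= r0 -> holo r0 f -> 0 <= r < r0 ->
  exists M q, [/\ 0 <= M, 0 <= q < 1 & forall n z, normc z <= r ->
    normc (f z - \sum_(k < n) coef f k * z ^+ k) <= M * q ^+ n /\
    forall l, cdiff f z l ->
      normc (l - \sum_(k < n) coef f k * (k%:R * z ^+ k.-1)) <= M * q ^+ n].
Proof.
move=> r01 hf /andP[rp rr].
pose r1 := (2 * r + r0) / 3; pose r2 := (r + 2 * r0) / 3.
have rr1 : r < r1 by rewrite /r1; lra.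
have r10 : 0 < r1 by lra.
have r12 : r1 < r2 by rewrite /r1 /r2; lra.
have r20 : r2 < r0 by rewrite /r2; lra.
have r2p : 0 < r2 by lra.
clearbody r1 r2.
have [|t0 fB] := @holo_circ_max r0 f r2 hf; first by rewrite ltW.
have B0 := normc_ge0 (f (r2%:C * circ t0)).
set B := normc _ in B0 fB; clearbody B.
pose q := r1 / r2; pose M1 := 2 * (B * (r2 / (r2 - r1))).
have q0 : 0 <= q by rewrite divr_ge0// ltW.
have q1 : q < 1 by rewrite ltr_pdivrMr// mul1r.
have M10 : 0 <= M1 by rewrite mulr_ge0// mulr_ge0// divr_ge0 ?subr_ge0// ltW.
have rem n z : normc z <= r1 -> normc (f z - \sum_(k < n) coef f k * z ^+ k) <= M1 * q ^+ n.
  move=> zr; have zr2 : normc z < r2 by exact: le_lt_trans r12.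
  apply: (le_trans (@taylor_remainder r0 f r2 B z n r01 hf _ fB)); first by rewrite zr2.
  rewrite /M1 -!mulrA ler_pM2l// ler_wpM2l// [X in _ <= X]mulrA [X in _ <= X]mulrC.
  have r2p' := ltW r2p; have zq : 0 <= normc z / r2 by rewrite divr_ge0.
  have zr2' : 0 <= r2 - normc z by rewrite subr_ge0 ltW.
  apply: ler_pM; [by rewrite exprn_ge0|by rewrite divr_ge0| |].
    by rewrite lerXn2r ?nnegrE// /q ler_pM2r// invr_gt0.
  rewrite ler_pM2l// lef_pV2 ?posrE ?subr_gt0//.
  by rewrite lerD2l lerN2.
clearbody M1 q; exists (M1 + 4 * (M1 * r1 / (r1 - r) ^+ 2)), q.
have M20 : 0 <= 4 * (M1 * r1 / (r1 - r) ^+ 2).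
  have r10' := ltW r10; have rr1' : 0 <= r1 - r by rewrite subr_ge0 ltW.
  by rewrite mulr_ge0// divr_ge0 ?exprn_ge0// mulr_ge0.
split; [exact: addr_ge0|by rewrite q0|].
move=> n z zr; have qn : 0 <= q ^+ n by rewrite exprn_ge0.
split.
  apply: (le_trans (rem n z (le_trans zr (ltW rr1)))).
  by rewrite ler_wpM2r// lerDl.
move=> l dl.
have dp : cdiff (fun w => f w - \sum_(k < n) coef f k * w ^+ k) z
   (l - \sum_(k < n) coef f k * (k%:R * z ^+ k.-1)).
  by apply: (cdiffB dl); apply: cdiff_sum => k; exact: (cdiffZ _ (cdiffX k z)).
have hp := @holo_sub_poly r0 f (coef f) n hf.
have zr1 : normc z < r1 by exact: le_lt_trans rr1.
apply: (le_trans (cauchy_derivative_bound (M := M1 * q ^+ n) (r := r1) hp _ _ dp)).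
- by rewrite zr1 (lt_trans r12).
- by move=> t _; apply: rem; rewrite normc_circr// ltW.
rewrite [X in _ <= X]mulrDl; apply: ler_wpDl; first exact: mulr_ge0.
have E x : 4 * (M1 * q ^+ n * r1 * x) = 4 * M1 * r1 * q ^+ n * x by ring.
have E' x : 4 * (M1 * r1 * x) * q ^+ n = 4 * M1 * r1 * q ^+ n * x by ring.
rewrite E E' ler_wpM2l ?mulr_ge0//; first exact: ltW.
rewrite lef_pV2 ?posrE ?exprn_gt0 ?subr_gt0//.
have zr' : 0 <= r1 - normc z by rewrite subr_ge0 ltW.
have rr1' : 0 <= r1 - r by rewrite subr_ge0 ltW.
by rewrite lerXn2r ?nnegrE// lerD2l lerN2.
Qed.

Lemma coef_cvg f (u : nat -> C -> C) r0 n : 1 <= r0 -> holo r0 f -> (forall m, holo r0 (u m)) ->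
  (forall e : R, 0 < e -> exists N : nat, forall m, (N <= m)%N ->
     forall t, 0 <= t <= 2 * pi ->
     normc (u m ((2^-1)%:C * circ t) - f ((2^-1)%:C * circ t)) <= e) ->
  forall e : R, 0 < e -> exists N : nat, forall m, (N <= m)%N ->
     normc (coef (u m) n - coef f n) <= e.
Proof.
move=> r01 hf hu H e e0.
have h0 : 0 < 2^-1 :> R by rewrite invr_gt0.
have h1 : 0 <= (2^-1 : R) < r0 by apply/andP; split; [exact: ltW|lra].
have p2 : 0 < (2 : R) ^+ n.+1 by rewrite exprn_gt0.
have [N NP] := H _ (divr_gt0 e0 p2).
exists N => m /NP {}NP.
have cc g : holo r0 g -> ccirc (fun t => g ((2^-1)%:C * circ t) / ((2^-1)%:C * circ t) ^+ n).
  by move=> hg t; apply: ccontM; [exact: holo_circ_ccont hg h1 t|exact: ccont_circrV].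
rewrite /coef -avgB; [|exact: cc|exact: cc].
have -> : e = 2 * (e / 2 ^+ n.+1 * 2 ^+ n).
  by rewrite exprS; field; rewrite expf_neq0.
apply: normc_avg; first by move=> t; apply: ccontB; exact: cc.
move=> t tI; rewrite -mulrBl normcM normcV normcX normc_circr; last exact: ltW.
by rewrite exprVn invrK ler_wpM2r ?exprn_ge0//; exact: NP.
Qed.

Lemma coef_lin f g a r0 n : 1 <= r0 -> holo r0 f -> holo r0 g ->
  coef (fun z => a * f z + g z) n = a * coef f n + coef g n.
Proof.
move=> r01 hf hg; have h0 : 0 < 2^-1 :> R by rewrite invr_gt0.
have h1 : 0 <= (2^-1 : R) < r0 by apply/andP; split; [exact: ltW|lra].
have cc g' : holo r0 g' -> ccirc (fun t => g' ((2^-1)%:C * circ t) / ((2^-1)%:C * circ t) ^+ n).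
  by move=> hg' t; apply: ccontM; [exact: holo_circ_ccont hg' h1 t|exact: ccont_circrV].
rewrite /coef -avgZ; last exact: cc.
rewrite -avgD; [|by move=> t; apply: ccontZ; exact: cc|exact: cc].
by apply: eq_avg => t; rewrite mulrDl mulrA.
Qed.

Lemma coef_power k n : coef (fun z => z ^+ k) n = (k == n)%:R.
Proof.
have h0 : 0 < 2^-1 :> R by rewrite invr_gt0.
rewrite -(avg_circX_conj k n).
have cX : ccirc (fun t => circ t ^+ k * (circ t ^+ n)^*%C : C).
  move=> t; apply: ccontM; last apply: ccontJ; apply: ccontX; exact: ccont_circ.
pose a : C := (2^-1)%:C ^+ k / (2^-1)%:C ^+ n.
transitivity (a * avg (fun t => circ t ^+ k * (circ t ^+ n)^*%C : C)).
  rewrite -avgZ//; apply: eq_avg => t.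
  have -> : (circ t ^+ n)^*%C = ((circ t) ^+ n)^-1 by rewrite -exprVn -circJ; exact: rmorphXn.
  by rewrite /a !exprMn invfM mulrACA.
rewrite avg_circX_conj /a; case: eqP => [->|]; last by rewrite mulr0.
by rewrite divff ?mulr1// expf_neq0// fmorph_eq0 gt_eqF.
Qed.

Lemma coef_polynomial (c : nat -> C) m n :
  coef (fun z => \sum_(k < m) c k * z ^+ k) n = if (n < m)%N then c n else 0.
Proof.
have hX k : holo 1 (fun z => z ^+ k) by move=> z _; eexists; exact: cdiffX.
have hp j : holo 1 (fun z => \sum_(k < j) c k * z ^+ k).
  move=> z _; eexists; apply: cdiff_sum => k; exact: (cdiffZ _ (cdiffX k z)).
elim: m => [|m IH].
  by rewrite /coef (@eq_avg _ _ (fun=> 0)) ?avg_cst// => t; rewrite big_ord0 mul0r.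
have E : (fun z => \sum_(k < m.+1) c k * z ^+ k) =
    (fun z => c m * z ^+ m + \sum_(k < m) c k * z ^+ k).
  by apply/funext => z; rewrite big_ord_recr addrC.
rewrite E (coef_lin _ _ (lexx 1) (hX m) (hp m)) IH coef_power ltnS.
by case: (ltngtP n m) => [_|_|->]; rewrite ?mulr0 ?mulr1 ?add0r ?addr0.
Qed.

End taylor.

Arguments coef : simpl never.
Arguments avg : simpl never.

(** * Parseval's identity *)

Section parseval.
Context {R : realType}.
Local Notation C := R[i].
Local Notation mu := (@lebesgue_measure R).

(** Used with [W = 1] and [u = circ] for Parseval's identity, and with [u] a Blaschke product on the
    circle and [W] its angular derivative for composition operators. *)
Lemma avg_orthogonal (W u : R -> C) (N : C) (a b : nat -> C) n :
  ccirc W -> ccirc u ->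
  (forall k l, avg (fun t => W t * (u t ^+ k * (u t ^+ l)^*%C)) = (k == l)%:R * N) ->
  avg (fun t => W t * ((\sum_(k < n) a k * u t ^+ k) *
                       (\sum_(k < n) b k * u t ^+ k)^*%C)) =
  N * \sum_(k < n) a k * (b k)^*%C.
Proof.
move=> cW cu H.
have cX k : ccirc (fun t => u t ^+ k) by move=> t; apply: ccontX.
have cT k l : ccirc (fun t => W t * (u t ^+ k * (u t ^+ l)^*%C)).
  by move=> t; apply: ccontM => //; apply: ccontM; [|apply: ccontJ]; exact: cX.
transitivity (avg (fun t => \sum_(k < n) \sum_(l < n)
    (a k * (b l)^*%C) * (W t * (u t ^+ k * (u t ^+ l)^*%C)))).
  apply: eq_avg => t; rewrite rmorph_sum /= mulr_suml mulr_sumr.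
  apply: eq_bigr => k _; rewrite !mulr_sumr; apply: eq_bigr => l _.
  by rewrite [(b l * _)^*%C]rmorphM /=; ring.
rewrite avg_sum; last by move=> k t; apply: ccont_sum => l; apply: ccontZ; exact: cT.
rewrite mulr_sumr; apply: eq_bigr => k _.
rewrite avg_sum; last by move=> l t; apply: ccontZ; exact: cT.
rewrite (bigD1 k)//= big1 => [|l lk]; first by rewrite addr0 avgZ// H eqxx mul1r mulrC.
have kl : (k == l :> nat) = false by rewrite val_eqE eq_sym (negbTE lk).
by rewrite avgZ// H kl mul0r mulr0.
Qed.

Lemma normc2_sum_real n (c : nat -> C) :
  \sum_(k < n) c k * (c k)^*%C = (\sum_(k < n) normc (c k) ^+ 2)%:C.
Proof. by rewrite rmorph_sum; apply: eq_bigr => k _; rewrite normcJE. Qed.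

Lemma cvg_geo (M q : R) : 0 <= q < 1 -> (fun n => M * q ^+ n) @ \oo --> (0 : R).
Proof.
move=> /andP[q0 q1]; rewrite -[X in _ --> X](mulr0 M); apply: cvgMr; apply: cvg_expr.
by rewrite ger0_norm.
Qed.

Lemma geo_small (M q e : R) : 0 <= q < 1 -> 0 < e ->
  exists N : nat, forall n, (N <= n)%N -> M * q ^+ n < e.
Proof.
move=> qq e0; have /cvgrPdist_lt /(_ _ e0)[N _ NP] := cvg_geo M qq.
exists N => n /NP; rewrite sub0r normrN; exact: le_lt_trans (ler_norm _).
Qed.

Lemma ccirc_uniform (F : R -> C) (P : nat -> R -> C) (M q : R) : 0 <= q < 1 ->
  (forall n, ccirc (P n)) -> (forall n t, normc (F t - P n t) <= M * q ^+ n) -> ccirc F.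
Proof.
move=> qq cP H t e e0; have e3 : 0 < e / 3 by rewrite divr_gt0.
have [N /(_ N (leqnn N)) NP] := geo_small M qq e3.
have [d d0 dP] := cP N t _ e3; exists d => // s /dP {}dP.
have -> : F s - F t = (F s - P N s) + (P N s - P N t) - (F t - P N t) by ring.
apply: (le_lt_trans (le_normcD _ _)); rewrite normcN.
have := le_normcD (F s - P N s) (P N s - P N t).
have := H N s; have := H N t; lra.
Qed.

Lemma ccirc_poly (x : nat -> C) n : ccirc (fun t => \sum_(k < n) x k * circ t ^+ k : C).
Proof.
by move=> t; apply: ccont_sum => k; apply: ccontZ; apply: ccontX; exact: ccont_circ.
Qed.

(** The polarized form serves twice: with [F = G] for square means, and with [F = z G'] for the
    energy of a function on the closed disc. *)
Lemma parseval_pairing (F G : R -> C) (x y : nat -> C) (M q : R) : 0 <= M -> 0 <= q < 1 ->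
  (forall n t, normc (F t - \sum_(k < n) x k * circ t ^+ k) <= M * q ^+ n) ->
  (forall n t, normc (G t - \sum_(k < n) y k * circ t ^+ k) <= M * q ^+ n) ->
  forall e, 0 < e -> exists N : nat, forall n, (N <= n)%N ->
    normc (\sum_(k < n) x k * (y k)^*%C - avg (fun t => F t * (G t)^*%C)) <= e.
Proof.
move=> M0 q01 hF hG e e0.
have cF : ccirc F by apply: (ccirc_uniform q01 (fun n => ccirc_poly x n) hF).
have cG : ccirc G by apply: (ccirc_uniform q01 (fun n => ccirc_poly y n) hG).
(* The two cross terms are at most [(M q^n) (2 M)] and [M (M q^n)]; the outer 2 is the one of
   [normc_avg]. *)
have [N NP] := geo_small (2 * (3 * M ^+ 2)) q01 e0; exists N => n /NP /ltW; apply: le_trans.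
have -> : \sum_(k < n) x k * (y k)^*%C =
    avg (fun t => (\sum_(k < n) x k * circ t ^+ k) * (\sum_(k < n) y k * circ t ^+ k)^*%C).
  rewrite -[LHS]mul1r -(@avg_orthogonal (fun=> 1) circ 1 x y n).
  - by apply: eq_avg => t; rewrite mul1r.
  - by move=> t; exact: ccont_cst.
  - exact: ccont_circ.
  - by move=> k l; rewrite mulr1 -avg_circX_conj; apply: eq_avg => t; rewrite mul1r.
have cP := ccirc_poly x n; have cQ := ccirc_poly y n.
rewrite -avgB; last 2 first.
- by move=> t; apply: ccontM; [exact: cP|apply: ccontJ; exact: cQ].
- by move=> t; apply: ccontM; [exact: cF|apply: ccontJ; exact: cG].
rewrite -[2 * _ * _]mulrA; apply: normc_avg.
  by move=> t; apply: ccontB; apply: ccontM; [exact: cP|apply: ccontJ; exact: cQ|exact: cF|apply: ccontJ; exact: cG].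
move=> t _; set p := \sum_(_ < _) _; set r := \sum_(_ < _) _.
have hp : normc (F t - p) <= M * q ^+ n by exact: hF.
have hr : normc (G t - r) <= M * q ^+ n by exact: hG.
have F0 : normc (F t) <= M by have := hF 0%N t; rewrite big_ord0 subr0 expr0 mulr1.
have G0 : normc (G t) <= M by have := hG 0%N t; rewrite big_ord0 subr0 expr0 mulr1.
clearbody p r.
have qn1 : q ^+ n <= 1 by case/andP: q01 => q0 /ltW q1; rewrite exprn_ile1.
have r2 : normc r <= 2 * M.
  have := le_normcD (G t) (- (G t - r)); rewrite subKr normcN.
  have : M * q ^+ n <= M by rewrite ler_piMr.
  by lra.
have -> : p * r^*%C - F t * (G t)^*%C = (p - F t) * r^*%C + F t * (r - G t)^*%C.
  by rewrite rmorphB; ring.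
apply: (le_trans (le_normcD _ _)); rewrite !normcM !normc_conj normc_distC (normc_distC r).
rewrite (_ : 3 * M ^+ 2 * q ^+ n = (M * q ^+ n) * (2 * M) + M * (M * q ^+ n)); last by ring.
by apply: lerD; apply: ler_pM.
Qed.

Lemma ereal_int_avg (f : R -> R) : ccirc (fun t => (f t)%:C : C) ->
  (\int[mu]_(t in `[0%R, (2 * pi)%R]) (f t)%:E =
   (2 * pi * complex.Re (avg (fun t => (f t)%:C : C)))%:E)%E.
Proof.
move=> /ccirc_on /cconton_integrable[/= f1 f2]; rewrite /avg /cint /=.
rewrite mul0r subr0 mulrA divff ?mul1r ?gt_eqF ?twopi_gt0//.
by rewrite fineK//; exact: integrable_fin_num.
Qed.

Lemma parseval_uniform (F : R -> C) (c : nat -> C) (M q : R) : 0 <= q < 1 ->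
  (forall n t, normc (F t - \sum_(k < n) c k * circ t ^+ k) <= M * q ^+ n) ->
  ccirc F /\
  (\int[mu]_(t in `[0%R, (2 * pi)%R]) (normc (F t) ^+ 2)%:E =
   (2 * pi)%:E * \sum_(0 <= k <oo) (normc (c k) ^+ 2)%:E)%E.
Proof.
move=> qq H; have [q0 q1] := andP qq.
have cF : ccirc F by exact: (ccirc_uniform qq (ccirc_poly c) H).
split => //; rewrite ereal_int_avg; last by move=> t; exact: ccont_normc2.
rewrite EFinM; congr (_ * _)%E.
set A := avg _.
have M0 : 0 <= M by have := le_trans (normc_ge0 _) (H 0%N 0); rewrite expr0 mulr1.
have cvgA : (fun n => \sum_(0 <= k < n) normc (c k) ^+ 2) @ \oo --> complex.Re A.
  apply/cvgrPdist_le => e e0; have [N NP] := parseval_pairing M0 qq H H e0.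
  exists N => // n Nn; apply: le_trans (NP n Nn).
  rewrite big_mkord normc2_sum_real (@eq_avg _ _ (fun t => (normc (F t) ^+ 2)%:C)) -/A.
    by rewrite distrC; apply: le_trans (ler_Re_normc _); case: A.
  by move=> t; exact: normcJE.
symmetry; have -> : (complex.Re A)%:E =
    limn (EFin \o (fun n => \sum_(0 <= k < n) normc (c k) ^+ 2)).
  apply/esym/cvg_lim => //; apply: cvg_EFin => //.
  by apply: nearW => n.
congr (limn _); apply/funext => n /=.
by rewrite sumEFin.
Qed.

(** Parseval on the circle of radius [r] gives the series with factors [r^(2k)], which is termwise
    at most the full one. Conversely, each partial sum of the full series is the limit of its
    [r]-version as [r] tends to 1 from below. *)
Lemma hardy_sqnormE (f : C -> C) : holo 1 f ->
  (hardy_sqnorm f = \sum_(0 <= k <oo) (normc (coef f k) ^+ 2)%:E)%E.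
Proof.
move=> hf; rewrite /hardy_sqnorm.
have circle_mean (r : R) : 0 <= r < 1 ->
  (((2 * pi)^-1)%:E * \int[mu]_(t in `[0%R, (2 * pi)%R])
     (normc (f ((r * cos t) +i* (r * sin t))) ^+ 2)%:E =
   \sum_(0 <= k <oo) (normc (coef f k) ^+ 2 * r ^+ k ^+ 2)%:E)%E.
  move=> rr; have [M [q [M0 qq H]]] := taylor_uniform (lexx 1) hf rr.
  have r0 : 0 <= r by case/andP: rr.
  have E t : ((r * cos t) +i* (r * sin t)) = r%:C * circ t :> C.
    by apply/eqP; rewrite eq_complex/=; apply/andP; split; apply/eqP; ring.
  under eq_integral do rewrite E.
  have [] := @parseval_uniform (fun t => f (r%:C * circ t)) (fun k => coef f k * r%:C ^+ k) M q qq.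
    move=> n t; have := (H n (r%:C * circ t) _).1; rewrite normc_circr// => /(_ (lexx r)).
    suff -> : \sum_(k < n) coef f k * r%:C ^+ k * circ t ^+ k =
      \sum_(k < n) coef f k * (r%:C * circ t) ^+ k by [].
    by apply: eq_bigr => k _; rewrite exprMn mulrA.
  move=> _ ->; rewrite muleA -EFinM mulVf ?gt_eqF ?twopi_gt0// mul1e.
  apply: eq_eseriesr => k _; congr (_%:E).
  by rewrite normcM exprMn normcX normcC ger0_norm.
apply/eqP; rewrite eq_le; apply/andP; split.
  apply: ge_ereal_sup => _ [r /= rr <-]; rewrite circle_mean//.
  apply: lee_nneseries => k; first by rewrite lee_fin mulr_ge0 ?sqr_ge0.
  move=> _; have /andP[r0 r1] := rr.
  by rewrite lee_fin ler_piMr ?sqr_ge0// exprn_ile1 ?exprn_ge0// exprn_ile1// ltW.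
apply: lime_le; first by apply: is_cvg_nneseries => k _ _; rewrite lee_fin sqr_ge0.
apply: nearW => n; rewrite sumEFin.
set S := \sum_(0 <= k < n) _.
set s := ereal_sup _.
have Sr (r : R) : 0 <= r < 1 -> ((\sum_(0 <= k < n) normc (coef f k) ^+ 2 * r ^+ k ^+ 2)%:E <= s)%E.
  move=> rr; apply: (@le_trans _ _ (\sum_(0 <= k <oo) (normc (coef f k) ^+ 2 * r ^+ k ^+ 2)%:E)%E).
    rewrite -sumEFin; apply: nneseries_lim_ge => k _ _; rewrite lee_fin mulr_ge0 ?sqr_ge0//.
  rewrite -circle_mean//; apply: ereal_sup_ubound; by exists r.
have : (0 <= s)%E.
  apply: le_trans (Sr 0 _); last by rewrite lexx ltr01.
  by rewrite lee_fin sumr_ge0// => k _; rewrite mulr_ge0 ?sqr_ge0.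
case: s Sr => [s|_ _|//]; last by rewrite leey.
move=> Sr; rewrite lee_fin => s0; rewrite lee_fin.
have cS : (fun r : R => \sum_(0 <= k < n) normc (coef f k) ^+ 2 * r ^+ k ^+ 2) r @[r --> 1^'-] --> S.
  apply: cvg_at_left_filter.
  have -> : S = \sum_(0 <= k < n) normc (coef f k) ^+ 2 * 1 ^+ k ^+ 2.
    by apply: eq_bigr => k _; rewrite !expr1n mulr1.
  elim: n {S Sr} => [|n IH].
    by rewrite big_nil; under eq_fun do rewrite big_nil; exact: cvg_cst.
  rewrite big_nat_recr//=; under eq_fun do rewrite big_nat_recr//=.
  apply: cvgD => //; apply: cvgMr.
  by rewrite -exprM; under eq_fun do rewrite -exprM; exact: exprn_continuous.
apply: (cvgr_to_le cS).
near=> r; rewrite -lee_fin; apply: Sr; apply/andP; split; near: r.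
  by apply: nbhs_left_ge; exact: ltr01.
exact: nbhs_left_lt.
Unshelve. all: by end_near. Qed.

End parseval.

(** * Tonelli's theorem with the plane as one factor *)

Lemma tonelli_prod d1 d2 d3 (T1 : measurableType d1) (T2 : measurableType d2)
    (T3 : measurableType d3) (R : realType)
    (m1 : {sigma_finite_measure set T1 -> \bar R})
    (m2 : {sigma_finite_measure set T2 -> \bar R})
    (m3 : {sigma_finite_measure set T3 -> \bar R}) (f : T1 * (T2 * T3) -> \bar R) :
  sigma_finite setT (m2 \x m3)%E ->
  measurable_fun setT f -> (forall x, (0 <= f x)%E) ->
  (\int[m1]_t \int[(m2 \x m3)%E]_p f (t, p) = \int[(m2 \x m3)%E]_p \int[m1]_t f (t, p))%E.
Proof.
move=> sf mf f0.
(* The product measure is packed as a sigma-finite measure so that it can itself be a factor of a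
   product. *)
pose mx := Measure_isSigmaFinite.Build _ _ _ (m2 \x m3)%E sf.
pose M : {sigma_finite_measure set (T2 * T3)%type -> \bar R} :=
  HB.pack_for {sigma_finite_measure set (T2 * T3)%type -> \bar R} (Measure.sort (m2 \x m3)%E) mx.
exact: (@fubini_tonelli _ _ _ _ R m1 M f mf f0).
Qed.

Lemma tonelli_lebesgue2 (R : realType) (f : R * (R * R) -> \bar R) :
  measurable_fun setT f -> (forall x, (0 <= f x)%E) ->
  (\int[@lebesgue_measure R]_t \int[(@lebesgue_measure R \x @lebesgue_measure R)%E]_p f (t, p) =
   \int[(@lebesgue_measure R \x @lebesgue_measure R)%E]_p \int[@lebesgue_measure R]_t f (t, p))%E.
Proof.
move=> mf f0; set mu := @lebesgue_measure R.
have sf : sigma_finite setT (mu \x mu)%E.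
  exists (fun n => (`[(- n%:R)%R, n%:R] `*` `[(- n%:R)%R, n%:R])%classic).
    apply/esym/seteqP; split => // -[x y] _.
    have [n nP] : exists n : nat, `|x| + `|y| < n%:R.
      by exists (Num.truncn (`|x| + `|y|)).+1; exact: truncnS_gt.
    exists n => //; split; rewrite /= in_itv/= -ler_norml.
      by apply: ltW; apply: le_lt_trans nP; rewrite lerDl.
    by apply: ltW; apply: le_lt_trans nP; rewrite lerDr.
  move=> n; split; first by apply: measurableX; exact: measurable_itv.
  rewrite product_measure1E//= lebesgue_measure_itv/=.
  by case: ifPn => _; rewrite -?EFinB -?EFinM ?mule0 ltry.
exact: (@tonelli_prod _ _ _ _ _ _ R mu mu mu f sf mf f0).
Qed.

(** * Rotation invariance of plane measure *)

Section plane.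
Context {R : realType}.
Local Notation C := R[i].
Local Notation leb := (@lebesgue_measure R).
Local Notation leb2 := (leb \x leb)%E.
Implicit Types (G : R * R -> \bar R) (a c s : R).

Lemma integral_shift (g : R -> \bar R) a : measurable_fun setT g -> (forall x, (0 <= g x)%E) ->
  (\int[leb]_x g (x + a)%R = \int[leb]_x g x)%E.
Proof.
move=> mg g0.
have ma : measurable_fun setT ((fun x => x + a) : R -> measurableTypeR R).
  by apply: measurable_funD => //.
transitivity (\int[pushforward leb ((fun x => (x + a)%R) : R -> measurableTypeR R)]_x g x)%E.
  by rewrite ge0_integral_pushforward//.
apply: eq_measure_integral => //= A mA _; apply/esym/lebesgue_measure_unique => //= _ [[b c]] _ <-.
rewrite /pushforward/=.
have -> : (+%R^~ a : R -> R) @^-1` `]b, c] = `](b - a), (c - a)]%classic.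
  by apply/seteqP; split => x /=; rewrite !in_itv/= ltrBlDr lerBrDr.
rewrite !lebesgue_measure_itv/= !lte_fin ltrD2r.
by case: ifP => // _; congr (_%:E); ring.
Qed.

Lemma integral_shear G a : measurable_fun setT G -> (forall p, (0 <= G p)%E) ->
  (\int[leb2]_p G ((p.1 + a * p.2)%R, p.2) = \int[leb2]_p G p)%E.
Proof.
move=> mG G0.
have mS : measurable_fun setT (fun p : R * R => (p.1 + a * p.2, p.2)).
  apply: measurable_fun_pair => //; apply: measurable_funD => //.
  by apply: measurable_funM.
rewrite (fubini_tonelli2 (m1 := leb) (m2 := leb) (fun p => G (p.1 + a * p.2, p.2)))//; last first.
  exact: (measurableT_comp mG mS).
rewrite (fubini_tonelli2 (m1 := leb) (m2 := leb) G mG G0).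
apply: eq_integral => y _; rewrite /fubini_G /=.
apply: (@integral_shift (fun x => G (x, y)) (a * y)) => //.
by apply: (measurableT_comp mG); apply: measurable_fun_pair.
Qed.

Lemma integral_swap G : measurable_fun setT G -> (forall p, (0 <= G p)%E) ->
  (\int[leb2]_p G (p.2, p.1) = \int[leb2]_p G p)%E.
Proof.
move=> mG G0.
have mS : measurable_fun setT (fun p : R * R => (p.2, p.1)) by apply: measurable_fun_pair.
rewrite (fubini_tonelli2 (m1 := leb) (m2 := leb) (fun p => G (p.2, p.1)))//; last first.
  exact: (measurableT_comp mG mS).
by rewrite (fubini_tonelli1 (m1 := leb) (m2 := leb) G mG G0).
Qed.

Definition rotate2 c s (p : R * R) : R * R := (c * p.1 - s * p.2, s * p.1 + c * p.2).

Lemma measurable_rotate2 c s : measurable_fun setT (rotate2 c s).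
Proof.
by apply: measurable_fun_pair; [apply: measurable_funB|apply: measurable_funD];
  apply: measurable_funM.
Qed.

(* A rotation other than the half-turn is a product of three shears. *)
Lemma integral_rotate2 G c s : c ^+ 2 + s ^+ 2 = 1 -> measurable_fun setT G -> (forall p, (0 <= G p)%E) ->
  (\int[leb2]_p G (rotate2 c s p) = \int[leb2]_p G p)%E.
Proof.
have main c' s' G' : c' ^+ 2 + s' ^+ 2 = 1 -> 1 + c' != 0 ->
    measurable_fun setT G' -> (forall p, (0 <= G' p)%E) ->
    (\int[leb2]_p G' (rotate2 c' s' p) = \int[leb2]_p G' p)%E.
  (* [tau] is the tangent of half the angle: the outer two shears have parameter [- tau], the middle
     one [s']. *)
  move=> cs c1 mG G0; pose tau := s' / (1 + c').
  have mT : measurable_fun setT (fun p : R * R => (p.2, p.1)) by apply: measurable_fun_pair.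
  have mS b : measurable_fun setT (fun p : R * R => (p.1 + b * p.2, p.2)).
    apply: measurable_fun_pair => //; apply: measurable_funD => //.
    by apply: measurable_funM.
  have mS' b : measurable_fun setT (fun p : R * R => (p.1, p.2 + b * p.1)).
    apply: measurable_fun_pair => //; apply: measurable_funD => //.
    by apply: measurable_funM.
  pose G1 p := G' (p.1 + - tau * p.2, p.2).
  have mG1 : measurable_fun setT G1 by exact: (measurableT_comp mG (mS _)).
  pose G2 (p : R * R) := G1 (p.2, p.1).
  have mG2 : measurable_fun setT G2 by exact: (measurableT_comp mG1 mT).
  pose G3 p := G2 (p.1 + s' * p.2, p.2).
  have mG3 : measurable_fun setT G3 by exact: (measurableT_comp mG2 (mS _)).
  pose G4 (p : R * R) := G3 (p.2, p.1).
  have mG4 : measurable_fun setT G4 by exact: (measurableT_comp mG3 mT).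
  rewrite -(integral_shear (- tau) mG G0) -(integral_swap mG1) => [|p]; last exact: G0.
  rewrite -(integral_shear s' mG2) => [|p]; last exact: G0.
  rewrite -(integral_swap mG3) => [|p]; last exact: G0.
  rewrite -(integral_shear (- tau) mG4) => [|p]; last exact: G0.
  have t1 : tau * (1 + c') = s' by rewrite /tau mulfVK.
  have t2 : tau * s' = 1 - c'.
    by apply: (mulIf c1); rewrite mulrAC t1 -expr2 -[s' ^+ 2](addKr (c' ^+ 2)) cs; ring.
  apply: eq_integral => -[x y] _; rewrite /G4 /G3 /G2 /G1 /rotate2 /=; congr (G' (_, _)).
    have -> : x + - tau * y + - tau * (y + s' * (x + - tau * y)) =
      x - tau * s' * x - (tau + tau - tau * (tau * s')) * y by ring.
    rewrite t2 (_ : tau + tau - tau * (1 - c') = tau * (1 + c')); last by ring.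
    by rewrite t1; ring.
  have -> : y + s' * (x + - tau * y) = s' * x + (1 - tau * s') * y by ring.
  by rewrite t2; ring.
move=> cs mG G0; have [c1|] := eqVneq (1 + c) 0; last by move=> ?; exact: main.
have cE : c = -1 by rewrite -[c](addKr 1) c1 addr0.
have s0 : s = 0.
  by apply/eqP; rewrite -sqrf_eq0 -[s ^+ 2](addKr (c ^+ 2)) cs cE sqrrN expr1n addNr.
have h01 : (0 : R) ^+ 2 + 1 ^+ 2 = 1 by rewrite expr0n expr1n add0r.
have h1 : (1 : R) + 0 != 0 by rewrite addr0 oner_eq0.
(* The half-turn is the square of the quarter-turn, to which the three shears apply. *)
pose G1 p := G (rotate2 0 1 p).
have mG1 : measurable_fun setT G1 by exact: (measurableT_comp mG (measurable_rotate2 0 1)).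
rewrite -(main 0 1 G)// -/(G1 _) -(main 0 1 G1)//; last by move=> p; exact: G0.
apply: eq_integral => -[x y] _.
by rewrite /G1 /rotate2 /= cE s0; congr (G (_, _)); ring.
Qed.

Local Notation D := [set p : R * R | unit_disc (p.1 +i* p.2)].

(** Each rotation preserves the integral of [F] over the disc. Integrating over the angle and
    exchanging the two integrals replaces [F] by its average over rotations. *)
Lemma integral_disc_avg (F W : R * R -> \bar R) :
  measurable_fun D F -> (forall p, D p -> (0 <= F p)%E) -> measurable_fun D W ->
  (forall p, D p -> (0 <= W p)%E) ->
  (forall p, D p -> \int[leb]_(t in `[0%R, (2 * pi)%R]) F (rotate2 (cos t) (sin t) p) =
     (2 * pi)%:E * W p)%E ->
  (\int[leb2]_(p in D) F p = \int[leb2]_(p in D) W p)%E.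
Proof.
move=> mF F0 mW W0 H; have mD : measurable D := measurable_disc.
have pi0 : (0 : R) < 2 * pi by exact: twopi_gt0.
pose I : set R := `[0%R, (2 * pi)%R]%classic.
have mI : measurable I by exact: measurable_itv.
pose G := F \_ D.
have mG : measurable_fun setT G by apply/(measurable_restrictT _ mD).
have G0 p : (0 <= G p)%E by rewrite /G patchE; case: ifPn => // /set_mem; exact: F0.
pose K (q : R * (R * R)) : \bar R := ((\1_I q.1)%:E * G (rotate2 (cos q.1) (sin q.1) q.2))%E.
have mcos : measurable_fun setT (@cos R).
  by apply: continuous_measurable_fun; exact: continuous_cos.
have msin : measurable_fun setT (@sin R).
  by apply: continuous_measurable_fun; exact: continuous_sin.
have mR : measurable_fun setT (fun q : R * (R * R) => rotate2 (cos q.1) (sin q.1) q.2).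
  have m1 : measurable_fun setT (fun q : R * (R * R) => cos q.1) by exact: measurableT_comp mcos _.
  have m2 : measurable_fun setT (fun q : R * (R * R) => sin q.1) by exact: measurableT_comp msin _.
  have m3 : measurable_fun setT (fun q : R * (R * R) => q.2.1) by apply: measurableT_comp.
  have m4 : measurable_fun setT (fun q : R * (R * R) => q.2.2) by apply: measurableT_comp.
  by apply: measurable_fun_pair; [apply: measurable_funB|apply: measurable_funD];
    apply: measurable_funM.
have mK : measurable_fun setT K.
  apply: emeasurable_funM; last exact: (measurableT_comp mG mR).
  apply/measurable_EFinP; apply: measurableT_comp => //; exact: measurable_indic.
have K0 q : (0 <= K q)%E by rewrite /K mule_ge0// lee_fin.
have T : (\int[leb]_t \int[leb2]_p K (t, p) = \int[leb2]_p \int[leb]_t K (t, p))%E.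
  exact: tonelli_lebesgue2.
have L : (\int[leb]_t \int[leb2]_p K (t, p) = (2 * pi)%:E * \int[leb2]_p G p)%E.
  transitivity (\int[leb]_t ((\1_I t)%:E * \int[leb2]_p G p))%E.
    apply: eq_integral => t _; rewrite /K /=.
    rewrite ge0_integralZl//; last first.
    - exact: (measurableT_comp mG (measurable_rotate2 _ _)).
    by rewrite integral_rotate2// cos2Dsin2.
  rewrite ge0_integralZr//; last first.
  - exact: integral_ge0.
  - by apply/measurable_EFinP; exact: measurable_indic.
  rewrite integral_indic// setIT [X in (X * _)%E](_ : _ = (2 * pi)%:E)//.
  have E : leb I = (2 * pi)%:E by rewrite /I lebesgue_measure_itv/= lte_fin pi0 sube0.
  exact: E.
have Rr : (\int[leb2]_p \int[leb]_t K (t, p) = (2 * pi)%:E * \int[leb2]_(p in D) W p)%E.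
  rewrite -ge0_integralZl//; last by rewrite lee_fin ltW.
  rewrite [RHS]integral_mkcond; apply: eq_integral => p _; rewrite patchE.
  have nrot t : D (rotate2 (cos t) (sin t) p) <-> D p.
    have E : (rotate2 (cos t) (sin t) p).1 +i* (rotate2 (cos t) (sin t) p).2 = circ t * (p.1 +i* p.2).
      by rewrite /rotate2; ceq.
    rewrite -[D (rotate2 _ _ _)]/(unit_disc (_ +i* _)) -[D p]/(unit_disc (p.1 +i* p.2)) E.
    rewrite !unit_discE.
    by rewrite normcM normc_circ mul1r.
  case: ifPn => [/set_mem Dp|/negP Dp].
    rewrite -H// [RHS]integral_mkcond; apply: eq_integral => t _; rewrite /K /= patchE indicE.
    case: ifPn => tI; rewrite ?mul1e ?mul0e// /G patchE mem_set//; exact/nrot.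
  rewrite integral0_eq// => t _; rewrite /K /G /= patchE memNset ?mule0//.
  by move=> /nrot /mem_set.
have : ((2 * pi)%:E * \int[leb2]_p G p = (2 * pi)%:E * \int[leb2]_(p in D) W p)%E.
  by rewrite -L T Rr.
rewrite {1}/G -integral_mkcond => E.
have := congr1 (fun x => ((2 * pi)^-1)%:E * x)%E E.
by rewrite !muleA -EFinM mulVf ?gt_eqF// !mul1e.
Qed.

Definition sqr2 (p : R * R) : R := p.1 ^+ 2 + p.2 ^+ 2.

Lemma sqr2E (p : R * R) : sqr2 p = normc (p.1 +i* p.2) ^+ 2.
Proof. by rewrite sqr_normc. Qed.

Lemma discE (p : R * R) : D p <-> sqr2 p < 1.
Proof.
rewrite -[D p]/(unit_disc (p.1 +i* p.2)) unit_discE sqr2E.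
rewrite expr_lt1 ?normc_ge0//.
Qed.

Lemma measurable_sqr2 : measurable_fun setT sqr2.
Proof. by apply: measurable_funD; apply: measurable_funX. Qed.

Definition disc_area : \bar R := leb2 D.

Definition divx (n : nat) (p : R * R) : R := sqr2 p ^+ n + 2 * n%:R * p.1 ^+ 2 * sqr2 p ^+ n.-1.

Lemma sqr2_ge0 p : 0 <= sqr2 p.
Proof. by rewrite addr_ge0 ?sqr_ge0. Qed.

Lemma divx_ge0 n p : 0 <= divx n p.
Proof.
apply: addr_ge0; first by rewrite exprn_ge0 ?sqr2_ge0.
by rewrite mulr_ge0 ?exprn_ge0 ?sqr2_ge0// mulr_ge0 ?sqr_ge0// mulr_ge0.
Qed.

Lemma measurable_divx n : measurable_fun setT (divx n).
Proof.
apply: measurable_funD; first by apply: measurable_funX; exact: measurable_sqr2.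
apply: measurable_funM; last by apply: measurable_funX; exact: measurable_sqr2.
by apply: measurable_funM => //; apply: measurable_funX.
Qed.

(* [divx n] is the derivative of [x * sqr2 ^+ n] in [x], and [sqr2 = 1] on the circle. *)
Lemma integral_divx n : (\int[leb2]_(p in D) (divx n p)%:E = disc_area)%E.
Proof.
have mD : measurable D := measurable_disc.
pose G n := (fun p => (divx n p)%:E) \_ D.
have mG m : measurable_fun setT (G m).
  by apply/(measurable_restrictT _ mD); apply: measurable_funTS; apply/measurable_EFinP; exact: measurable_divx.
have G0 m p : (0 <= G m p)%E.
  by rewrite /G patchE; case: ifPn => // _; rewrite lee_fin divx_ge0.
have slice m y : (\int[leb]_x G m (x, y) = \int[leb]_x G 0%N (x, y))%E.
  have [y1|y1] := ltP (y ^+ 2) 1; last first.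
    apply: eq_integral => x _; rewrite /G !patchE memNset// => /discE.
    rewrite /sqr2/=; have := sqr_ge0 x; lra.
  (* The slice at height [y] runs from [- s] to [s]. At both ends [sqr2] is 1, so the fundamental
     theorem gives [2 * s] whatever the exponent. *)
  pose s := Num.sqrt (1 - y ^+ 2).
  have s2 : s ^+ 2 = 1 - y ^+ 2 by rewrite sqr_sqrtr// subr_ge0 ltW.
  have s0 : 0 < s by rewrite sqrtr_gt0 subr_gt0.
  suff E k : (\int[leb]_x G k (x, y) = (2 * s)%:E)%E by rewrite !E.
  have Dx x : D (x, y) <-> `]- s, s[%classic x.
    rewrite discE /sqr2 /= in_itv/= -ltr_norml.
    rewrite -[X in _ <-> is_true X](@ltr_pXn2r _ 2) ?nnegrE ?normr_ge0 ?(ltW s0)//.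
    by rewrite real_normK ?num_real// s2 ltrBrDr.
  transitivity (\int[leb]_(x in `](- s)%R, s[) (divx k (x, y))%:E)%E.
    rewrite [RHS]integral_mkcond; apply: eq_integral => x _; rewrite /G !patchE.
    by congr (if _ then _ else _); apply/idP/idP => /set_mem/Dx/mem_set.
  have mdx : measurable_fun setT (fun x => divx k (x, y)).
    by apply: (measurableT_comp (measurable_divx k)); apply: measurable_fun_pair.
  transitivity (\int[leb]_(x in `[(- s)%R, s]) (divx k (x, y))%:E)%E.
    rewrite [RHS]integral_itv_bndoo//.
    by apply: measurable_funTS; apply/measurable_EFinP.
  pose F x : R := x * sqr2 (x, y) ^+ k.
  have dF (x : R) : is_derive x 1 F (divx k (x, y)).
    rewrite /F /divx /sqr2 /=.
    have d1 : is_derive x 1 (fun x : R => x ^+ 2 + y ^+ 2) (2 * x).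
      by apply: is_derive_eq; rewrite /GRing.scale/=; ring.
    have d2 : is_derive x 1 (fun x : R => (x ^+ 2 + y ^+ 2) ^+ k) (k%:R * (x ^+ 2 + y ^+ 2) ^+ k.-1 * (2 * x)).
      have dX : is_derive (x ^+ 2 + y ^+ 2) 1 (fun u : R => u ^+ k) (k%:R * (x ^+ 2 + y ^+ 2) ^+ k.-1).
        by apply: DeriveDef; [exact: exprn_derivable|rewrite exp_derive /GRing.scale/= mulr1].
      exact: (@is_derive1_comp R (fun u : R => u ^+ k) (fun x : R => x ^+ 2 + y ^+ 2) x _ _ dX d1).
    by apply: is_derive_eq; rewrite /GRing.scale/=; ring.
  have ss : - s < s by lra.
  transitivity ((F s)%:E - (F (- s)%R)%:E)%E; last first.
    by rewrite -EFinB; congr (_%:E); rewrite /F /sqr2 /= sqrrN s2 subrK expr1n; ring.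
  apply: (@continuous_FTC2 R (fun x => divx k (x, y)) F (- s) s ss).
  - apply: continuous_subspaceT => x.
    rewrite /divx /sqr2 /=.
    have c1 : {for x, continuous (fun x : R => x ^+ 2 + y ^+ 2)}.
      by apply: cvgD; [exact: exprn_continuous|exact: cvg_cst].
    have cX j : {for x, continuous (fun x : R => (x ^+ 2 + y ^+ 2) ^+ j)}.
      exact: (@continuous_comp R R R (fun x : R => x ^+ 2 + y ^+ 2) (fun u : R => u ^+ j) x c1 (@exprn_continuous R j _)).
    apply: cvgD; first exact: cX.
    apply: cvgM; last exact: cX.
    by apply: cvgMr; exact: exprn_continuous.
  - split => [x _|//|//].
    + by have [] := dF x.
    + by apply/cvg_at_right_filter/differentiable_continuous/derivable1_diffP; have [] := dF (- s).
    + by apply/cvg_at_left_filter/differentiable_continuous/derivable1_diffP; have [] := dF s.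
  - by move=> x _; rewrite derive1E; have [] := dF x.
have E m : (\int[leb2]_(p in D) (divx m p)%:E = \int[leb2]_p G m p)%E.
  by rewrite integral_mkcond.
rewrite E (fubini_tonelli2 (m1 := leb) (m2 := leb) (G n) (mG n) (G0 n)).
transitivity (\int[leb2]_p G 0%N p)%E.
  rewrite (fubini_tonelli2 (m1 := leb) (m2 := leb) (G 0%N) (mG 0%N) (G0 0%N)).
  by apply: eq_integral => y _; rewrite /fubini_G; exact: slice.
rewrite -E /disc_area -[RHS]mul1e -integral_cst//.
apply: eq_integral => p _; rewrite /divx expr0 mulr0 !mul0r addr0//.
Qed.

(** The disc lies between concentric squares of area 1 and 4. *)
Lemma disc_area_fin : exists2 A : R, 0 < A & disc_area = A%:E.
Proof.
have mD : measurable D := measurable_disc.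
have lo : (1%:E <= disc_area)%E.
  have -> : 1%:E = leb2 (`]- (2^-1), 2^-1[ `*` `]- (2^-1), 2^-1[)%classic.
    rewrite product_measure1E//= !lebesgue_measure_itv/= lte_fin.
    have -> : - 2^-1 < 2^-1 :> R by lra.
    by rewrite -EFinB -EFinM; congr (_%:E); field.
  apply: le_measure; rewrite ?inE//; first by apply: measurableX; exact: measurable_itv.
  move=> [x y] [] /=; rewrite !in_itv/= => /andP[x1 x2] /andP[y1 y2].
  by apply: (proj2 (discE (x, y))); rewrite /sqr2 /=; nra.
have hi : (disc_area <= 4%:E)%E.
  have -> : 4%:E = leb2 (`[(-1)%R, 1] `*` `[(-1)%R, 1])%classic.
    rewrite product_measure1E//= !lebesgue_measure_itv/= lte_fin.
    have -> : - 1 < 1 :> R by lra.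
    by rewrite -EFinB -EFinM; congr (_%:E); ring.
  apply: le_measure; rewrite ?inE//; first by apply: measurableX; exact: measurable_itv.
  move=> [x y] /discE; rewrite /sqr2 /= => h; split; rewrite /= in_itv/=; apply/andP; split; nra.
case: disc_area lo hi => [A|//|//]; rewrite !lee_fin => lo hi.
by exists A => //; lra.
Qed.

(** [divx n] and its mirror image under the exchange of coordinates add up to
    [2 * n.+1%:R * sqr2 ^+ n], the divergence of [sqr2 ^+ n] times the position vector, and each of
    the two integrates to [disc_area]. *)
Lemma integral_sqr2X n : (\int[leb2]_(p in D) (sqr2 p ^+ n)%:E = (n.+1%:R^-1)%:E * disc_area)%E.
Proof.
have mD : measurable D := measurable_disc.
have msX : measurable_fun D (fun p => (sqr2 p ^+ n)%:E).
  by apply: measurable_funTS; apply/measurable_EFinP; apply: measurable_funX; exact: measurable_sqr2.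
have mT : measurable_fun setT (fun p : R * R => (p.2, p.1)) by apply: measurable_fun_pair.
have sw : (\int[leb2]_(p in D) (divx n (p.2, p.1))%:E = disc_area)%E.
  rewrite -(integral_divx n) integral_mkcond [RHS]integral_mkcond.
  rewrite -[RHS]integral_swap.
  - apply: eq_integral => -[x y] _; rewrite !patchE /=.
    by congr (if _ then _ else _); apply/idP/idP => /set_mem/discE; rewrite /sqr2/= addrC => h;
      apply/mem_set/discE.
  - apply/(measurable_restrictT _ mD); apply: measurable_funTS; apply/measurable_EFinP; exact: measurable_divx.
  - by move=> p; rewrite patchE; case: ifPn => // _; rewrite lee_fin divx_ge0.
have sum : (\int[leb2]_(p in D) ((2 * n.+1%:R)%:E * (sqr2 p ^+ n)%:E) = disc_area + disc_area)%E.
  rewrite -{1}(integral_divx n) -sw -ge0_integralD//.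
  - apply: eq_integral => -[x y] _; rewrite -EFinM -EFinD; congr (_%:E).
    rewrite /divx /sqr2 /= [y ^+ 2 + x ^+ 2]addrC -natr1.
    case: n {msX sw} => [|n] /=; first by rewrite !expr0; ring.
    by rewrite exprS; ring.
  - by move=> p _; rewrite lee_fin divx_ge0.
  - by apply: measurable_funTS; apply/measurable_EFinP; exact: measurable_divx.
  - by move=> p _; rewrite lee_fin divx_ge0.
  - apply: measurable_funTS; apply/measurable_EFinP; exact: (measurableT_comp (measurable_divx n) mT).
rewrite ge0_integralZl// in sum; last first.
- by move=> p _; rewrite lee_fin exprn_ge0// sqr2_ge0.
have n0 : (2 * n.+1%:R : R) != 0 by rewrite mulf_neq0 ?pnatr_eq0.
have := congr1 (fun x => ((2 * n.+1%:R)^-1)%:E * x)%E sum.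
rewrite muleA -EFinM mulVf// mul1e => ->.
have [A A0 ->] := disc_area_fin.
rewrite -EFinD -!EFinM; congr (_%:E); field.
by rewrite nat1r pnatr_eq0.
Qed.

End plane.

(** * The Dirichlet norm in terms of Taylor coefficients *)

Section dirichlet_norm_coefficients.
Context {R : realType}.
Local Notation C := R[i].
Local Notation leb := (@lebesgue_measure R).
Local Notation leb2 := (leb \x leb)%E.
Local Notation D := [set p : R * R | unit_disc (p.1 +i* p.2)].
Implicit Types f : hol R.

(* Its value is 1, but positivity is all that matters. *)
Definition kappa : R := pi^-1 * fine (@disc_area R).

Lemma kappa_gt0 : 0 < kappa.
Proof.
by have [A A0] := @disc_area_fin R; rewrite /kappa => -> /=; rewrite mulr_gt0// invr_gt0 pi_gt0.
Qed.

Lemma hol_cdiff f z : normc z < 1 -> cdiff f z (complex_derive f z).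
Proof.
by have [df _] := set_mem (hol_funP f) => z1; apply/cdiffP/df; rewrite unit_discE.
Qed.

Lemma hol_holo f : holo 1 f.
Proof. by move=> z z1; exists (complex_derive f z); exact: hol_cdiff. Qed.

Lemma hol_out f z : ~ normc z < 1 -> f z = 0.
Proof. by have [_ f0] := set_mem (hol_funP f) => z1; apply: f0; rewrite unit_discE. Qed.

(** By Parseval the rotation average of [|f'|^2] at [p] is the sum of
    [(k+1)^2 |a_(k+1)|^2 |p|^(2k)]. The integral of [|p|^(2k)] over the disc is its area divided by
    [k+1], which leaves a single factor [k+1]. *)
Lemma dirichlet_energyE f :
  (dirichlet_energy f = \sum_(0 <= k <oo) (kappa * (k.+1%:R * normc (coef f k.+1) ^+ 2))%:E)%E.
Proof.
have mD : measurable D := measurable_disc.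
rewrite /dirichlet_energy.
pose c k : R := k.+1%:R ^+ 2 * normc (coef f k.+1) ^+ 2.
have c0 k : 0 <= c k by rewrite mulr_ge0 ?sqr_ge0.
pose W p : \bar R := (\sum_(k <oo) (c k * sqr2 p ^+ k)%:E)%E.
have W0 p k : (0 <= (c k * sqr2 p ^+ k)%:E)%E.
  by rewrite lee_fin mulr_ge0// exprn_ge0// sqr2_ge0.
have mW k : measurable_fun D (fun p => (c k * sqr2 p ^+ k)%:E).
  apply: measurable_funTS; apply/measurable_EFinP; apply: measurable_funM => //.
  by apply: measurable_funX; exact: measurable_sqr2.
have -> : (\int[leb2]_(p in D) (normc (complex_derive f (p.1 +i* p.2)) ^+ 2)%:E =
           \int[leb2]_(p in D) W p)%E.
  apply: integral_disc_avg.
  - by apply/measurable_EFinP; exact: (measurable_sqr_derive (hol_funP f)).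
  - by move=> p _; rewrite lee_fin sqr_ge0.
  - by apply: ge0_emeasurable_sum => // k x Dx _; exact: W0.
  - by move=> p _; apply: nneseries_ge0 => k _ _; exact: W0.
  move=> p; rewrite -[D p]/(unit_disc (p.1 +i* p.2)) unit_discE => p1.
  set z := p.1 +i* p.2 in p1.
  have zz : 0 <= normc z < 1 by rewrite normc_ge0.
  have [M [q [M0 qq H]]] := taylor_uniform (lexx 1) (hol_holo f) zz.
  have E t : (rotate2 (cos t) (sin t) p).1 +i* (rotate2 (cos t) (sin t) p).2 = circ t * z.
    by rewrite /rotate2; ceq.
  have nz t : normc (circ t * z) = normc z by rewrite normcM normc_circ mul1r.
  under eq_integral do rewrite E.
  have [] := @parseval_uniform _ (fun t => complex_derive f (circ t * z))
     (fun k => coef f k.+1 * (k.+1%:R * z ^+ k)) M q qq.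
    (* The term of index 0 disappears under differentiation, so [n] terms of the derived series
       correspond to [n.+1] terms of the Taylor series. *)
    move=> n t; have := (H n.+1 (circ t * z) _).2; rewrite nz => /(_ (lexx _) _ (@hol_cdiff f _ _)).
    rewrite nz => /(_ p1); rewrite big_ord_recl /= mul0r mulr0 add0r.
    suff -> : \sum_(k < n) coef f k.+1 * (k.+1%:R * z ^+ k) * circ t ^+ k =
      \sum_(i < n) coef f (bump 0 i) * ((bump 0 i)%:R * (circ t * z) ^+ (bump 0 i).-1).
      move=> /le_trans; apply; rewrite ler_wpM2l// exprS ler_piMl ?exprn_ge0//.
        by case/andP: qq.
      by case/andP: qq => _ /ltW.
    by apply: eq_bigr => k _; rewrite /bump /= exprMn; ring.
  move=> _ ->; congr (_ * _)%E; apply: eq_eseriesr => k _; congr (_%:E).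
  have -> : normc (coef f k.+1 * (k.+1%:R * z ^+ k)) = normc (coef f k.+1) * (k.+1%:R * normc z ^+ k).
    by rewrite normcM; congr (_ * _); rewrite normcM normcnat normcX.
  rewrite /c sqr2E -/z !exprMn mulrA; congr (_ * _); exact: mulrC.
rewrite integral_nneseries//.
have [A A0 AE] := @disc_area_fin R.
rewrite -nneseriesZl; last by move=> k _; apply: integral_ge0.
apply: eq_eseriesr => k _.
transitivity ((pi^-1)%:E * ((c k)%:E * \int[leb2]_(p in D) (sqr2 p ^+ k)%:E))%E.
  congr (_ * _)%E; rewrite -ge0_integralZl//.
  - by apply: measurable_funTS; apply/measurable_EFinP; apply: measurable_funX; exact: measurable_sqr2.
  - by move=> p _; rewrite lee_fin exprn_ge0// sqr2_ge0.
  - by rewrite lee_fin.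
rewrite integral_sqr2X /kappa AE -!EFinM; congr (_%:E); rewrite /c [fine _]/=.
have k1 : k.+1%:R != 0 :> R by rewrite pnatr_eq0.
have cancel x : k.+1%:R ^+ 2 * x * (k.+1%:R^-1 * A) = A * (k.+1%:R * x).
  by rewrite expr2 mulrACA mulfK// [x * A]mulrC mulrCA.
by rewrite cancel mulrA.
Qed.

(** Partial sums of the squared norm: real numbers even when the norm is infinite. The argument is a
    plain function, so that formulas valid on the disc alone can be inserted. *)
Definition wnorm (g : C -> C) n : R := \sum_(k < n) (1 + kappa * k%:R) * normc (coef g k) ^+ 2.

Lemma weight_ge0 k : 0 <= 1 + kappa * k%:R.
Proof. by rewrite addr_ge0// mulr_ge0// ltW// kappa_gt0. Qed.

Lemma sqnormE f : (hardy_sqnorm f + dirichlet_energy f =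
  \sum_(0 <= k <oo) ((1 + kappa * k%:R) * normc (coef f k) ^+ 2)%:E)%E.
Proof.
rewrite (hardy_sqnormE (hol_holo f)) dirichlet_energyE.
have k0 := ltW kappa_gt0.
pose u k := (kappa * (k%:R * normc (coef f k) ^+ 2))%:E.
have u0 k : (0 <= u k)%E by rewrite lee_fin mulr_ge0// mulr_ge0 ?sqr_ge0.
have -> : (\sum_(0 <= k <oo) (kappa * (k.+1%:R * normc (coef f k.+1) ^+ 2))%:E =
  \sum_(0 <= k <oo) u k)%E.
  rewrite [RHS]nneseries_recl// {1}/u mul0r mulr0 add0e -(nneseries_addn 1 u0).
  by apply: eq_eseriesr => k _; rewrite addn1.
rewrite -nneseriesD//; last by move=> k _ _; rewrite lee_fin sqr_ge0.
by apply: eq_eseriesr => k _; rewrite -EFinD; congr (_%:E); ring.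
Qed.

Lemma sqnorm_le f (K : R) : (hardy_sqnorm f + dirichlet_energy f <= K%:E)%E <->
  forall n, wnorm f n <= K.
Proof.
rewrite sqnormE.
have t0 k : (0 <= ((1 + kappa * k%:R) * normc (coef f k) ^+ 2)%:E)%E.
  by rewrite lee_fin mulr_ge0 ?sqr_ge0 ?weight_ge0.
split=> [H n|H].
  rewrite -lee_fin; apply: le_trans H.
  rewrite /wnorm -(big_mkord xpredT (fun k => (1 + kappa * k%:R) * normc (coef f k) ^+ 2)) -sumEFin.
  exact: nneseries_lim_ge.
apply: lime_le; first by apply: is_cvg_nneseries.
by apply: nearW => n; rewrite sumEFin big_mkord lee_fin; exact: H.
Qed.

Lemma sqnorm_ge0 f : (0 <= hardy_sqnorm f + dirichlet_energy f)%E.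
Proof.
rewrite sqnormE; apply: nneseries_ge0 => k _ _.
by rewrite lee_fin mulr_ge0 ?sqr_ge0 ?weight_ge0.
Qed.

Lemma dirichlet_norm_lt f (d : R) : 0 < d -> (dirichlet_norm f < d%:E)%E =
  (hardy_sqnorm f + dirichlet_energy f < (d ^+ 2)%:E)%E.
Proof.
move=> d0; rewrite /dirichlet_norm; have := sqnorm_ge0 f.
case: (hardy_sqnorm f + dirichlet_energy f)%E => [r|_|//].
  rewrite lee_fin => r0; rewrite poweR_EFin !lte_fin powR12_sqrt//.
  by rewrite -(@ltr_pXn2r _ 2) ?nnegrE ?sqrtr_ge0 ?(ltW d0)// sqr_sqrtr.
by rewrite poweRyr ?invr_eq0// !ltNge !leey.
Qed.

Lemma dirichlet_norm_ltP f (d K : R) : 0 < d -> K < d ^+ 2 ->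
  (forall n, wnorm f n <= K) -> (dirichlet_norm f < d%:E)%E.
Proof.
move=> d0 Kd /sqnorm_le H; rewrite dirichlet_norm_lt//.
by apply: (le_lt_trans H); rewrite lte_fin.
Qed.

Lemma wnorm_lt f (d : R) n : 0 < d -> (dirichlet_norm f < d%:E)%E -> wnorm f n <= d ^+ 2.
Proof.
by move=> d0; rewrite dirichlet_norm_lt// => /ltW/sqnorm_le.
Qed.

(** Finite energy already bounds the Hardy part: [|a_k|^2 <= k |a_k|^2] for [k >= 1], and only [a_0]
    remains. *)
Lemma dirichlet_predP f : f \in dirichlet_pred <-> exists K, forall n, wnorm f n <= K.
Proof.
have -> : (f \in dirichlet_pred) = (dirichlet_energy f < +oo)%E.
  by apply/idP/idP; [exact: set_mem|exact: mem_set].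
have k0 := kappa_gt0.
have h0 : (0 <= hardy_sqnorm f)%E.
  rewrite (hardy_sqnormE (hol_holo f)); apply: nneseries_ge0 => k _ _.
  by rewrite lee_fin sqr_ge0.
have e0 : (0 <= dirichlet_energy f)%E.
  rewrite dirichlet_energyE; apply: nneseries_ge0 => k _ _.
  by rewrite lee_fin mulr_ge0 ?(ltW k0)// mulr_ge0 ?sqr_ge0.
split=> [ef|[K /sqnorm_le H]]; last first.
  apply: (@le_lt_trans _ _ (hardy_sqnorm f + dirichlet_energy f)%E); first by rewrite leeDr.
  by apply: (le_lt_trans H); rewrite ltry.
have hf : (hardy_sqnorm f < +oo)%E.
  rewrite (hardy_sqnormE (hol_holo f)) nneseries_recl; last first.
  - by [].
  - by move=> k _; rewrite lee_fin sqr_ge0.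
  apply: lte_add_pinfty; first by rewrite ltry.
  have u0 k : (0 <= (normc (coef f k) ^+ 2)%:E)%E by rewrite lee_fin sqr_ge0.
  rewrite -(nneseries_addn 1 u0).
  apply: (@le_lt_trans _ _ ((kappa^-1)%:E * dirichlet_energy f)%E).
    rewrite dirichlet_energyE -nneseriesZl; last first.
      by move=> k _; rewrite lee_fin mulr_ge0 ?(ltW k0)// mulr_ge0 ?sqr_ge0.
    apply: lee_nneseries => k; first by move=> *; exact: u0.
    move=> _.
    rewrite addn1 -EFinM lee_fin mulrA mulVf ?gt_eqF// mul1r ler_peMl ?sqr_ge0//.
    by rewrite ler1n.
  by apply: lte_mul_pinfty; rewrite ?lee_fin ?invr_ge0 ?(ltW k0).
have : (hardy_sqnorm f + dirichlet_energy f < +oo)%E by exact: lte_add_pinfty.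
have := sqnorm_ge0 f; case E : (hardy_sqnorm f + dirichlet_energy f)%E => [K| |]// _ _.
by exists K; apply/sqnorm_le; rewrite E.
Qed.

End dirichlet_norm_coefficients.

(** * Finite Blaschke products *)

Section blaschke.
Context {R : realType}.
Local Notation C := R[i].
Implicit Types (z w a c : C) (s : seq C).

Definition bfac a z : C := (a - z) / (1 - a^*%C * z).
(** Zeros form a list with repetitions: products become concatenation, and division becomes removal
    of entries. *)
Definition bprod c s z : C := c * \prod_(a <- s) bfac a z.
Definition in_disc s := forall a, a \in s -> normc a < 1.
Definition blaschke c s := normc c = 1 /\ in_disc s.

Lemma finite_blaschkeP (B : C -> C) : finite_blaschke B <->
  exists c s, blaschke c s /\ forall z, normc z < 1 -> B z = bprod c s z.
Proof.
split=> [[N [a [c [aD c1 BE]]]]|[c [s [[c1 sD] BE]]]].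
  exists c, [seq a n | n <- enum 'I_N]; split; last first.
    by move=> z z1; rewrite BE ?unit_discE// /bprod big_map big_enum.
  split; first by case/norm_normc: c1.
  by move=> x /mapP[n _ ->]; rewrite -unit_discE.
exists (size s), (fun n => nth 0 s n), c; split=> [n||z].
- by rewrite unit_discE; apply: sD; exact: mem_nth.
- by apply/norm_normc; rewrite c1.
by rewrite unit_discE => /BE ->; rewrite /bprod (big_nth 0) big_mkord.
Qed.

Lemma in_disc_cons a s : in_disc (a :: s) <-> normc a < 1 /\ in_disc s.
Proof.
split=> [H|[a1 sD] x]; last by rewrite inE => /orP[/eqP ->|/sD].
by split=> [|x xs]; apply: H; rewrite inE ?eqxx// xs orbT.
Qed.

(** The factor of a zero at 0 is [- z]; the constant [(-1) ^+ n] compensates, and the product is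
    [z ^+ n]. *)
Lemma blaschke_power n : blaschke ((-1) ^+ n) (nseq n (0 : C)).
Proof.
split; first by rewrite normcX normcN normc1 expr1n.
by move=> x; rewrite mem_nseq => /andP[_ /eqP ->]; rewrite normc0.
Qed.

Lemma in_disc_cat s s' : in_disc s -> in_disc s' -> in_disc (s ++ s').
Proof. by move=> sD sD' x; rewrite mem_cat => /orP[/sD|/sD']. Qed.

Lemma bprod_nil c z : bprod c [::] z = c.
Proof. by rewrite /bprod big_nil mulr1. Qed.

Lemma bprod_cons c a s z : bprod c (a :: s) z = bfac a z * bprod c s z.
Proof. by rewrite /bprod big_cons mulrCA. Qed.

Lemma bprod_cat c c' s s' z : bprod (c * c') (s ++ s') z = bprod c s z * bprod c' s' z.
Proof. by rewrite /bprod big_cat mulrACA. Qed.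

Lemma bfac_den_neq0 a z : normc a * normc z < 1 -> 1 - a^*%C * z != 0.
Proof.
move=> h; rewrite subr_eq0; apply: contraTneq h => /(congr1 (@normc R)).
by rewrite normc1 normcM normc_conj => <-; rewrite ltxx.
Qed.

Lemma disc_mul_lt1 a z : normc a < 1 -> normc z <= 1 -> normc a * normc z < 1.
Proof. by move=> a1 z1; apply: le_lt_trans a1; rewrite ler_piMr. Qed.

Lemma cdiff_bfac a z : normc a * normc z < 1 ->
  cdiff (bfac a) z ((- 1 - bfac a z * - a^*%C) / (1 - a^*%C * z)).
Proof.
move=> h; have d0 := bfac_den_neq0 h.
have h1 : cdiff (fun w => a - w) z (0 - 1) by apply: cdiffB; [exact: cdiff_cst|exact: cdiff_id].
have h2 : cdiff (fun w => 1 - a^*%C * w) z (0 - a^*%C * 1).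
  by apply: cdiffB; [exact: cdiff_cst|apply: cdiffZ; exact: cdiff_id].
have := cdiffM h1 (cdiffV h2 d0); congr (cdiff _ _ _).
by rewrite /bfac; field.
Qed.

(** For [normc a < 1] the sign of the right-hand side compares the two moduli inside the disc, on
    the circle and outside. *)
Lemma normcB2 a z : normc (1 - a^*%C * z) ^+ 2 - normc (a - z) ^+ 2 =
  (1 - normc a ^+ 2) * (1 - normc z ^+ 2).
Proof. by case: a z => a b [x y]; rewrite !sqr_normc /=; ring. Qed.

Lemma normc_bfac_circ a z : normc a < 1 -> normc z = 1 -> normc (bfac a z) = 1.
Proof.
move=> a1 z1; have d0 : 1 - a^*%C * z != 0 by rewrite bfac_den_neq0// z1 mulr1.
have := normcB2 a z; rewrite z1 expr1n subrr mulr0 => /eqP; rewrite subr_eq0.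
rewrite eqrXn2// => /eqP E; rewrite /bfac normcM normcV E divff// normc_eq0.
by rewrite -normc_eq0 -E normc_eq0.
Qed.

Lemma normc_bfac_lt1 a z : normc a < 1 -> normc z < 1 -> normc (bfac a z) < 1.
Proof.
move=> a1 z1; have d0 : 1 - a^*%C * z != 0 by rewrite bfac_den_neq0// disc_mul_lt1// ltW.
rewrite /bfac normcM normcV ltr_pdivrMr ?normc_gt0// mul1r.
rewrite -(@ltr_pXn2r _ 2) ?nnegrE ?normc_ge0//.
have : 0 < (1 - normc a ^+ 2) * (1 - normc z ^+ 2) by rewrite mulr_gt0// subr_gt0 expr_lt1.
by rewrite -normcB2 subr_gt0.
Qed.

Lemma normc_bfac_num a z : normc a < 1 -> 1 <= normc z ->
  normc (1 - a^*%C * z) <= normc (a - z).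
Proof.
move=> a1 z1; rewrite -(@ler_pXn2r _ 2) ?nnegrE// -subr_le0 normcB2.
by rewrite mulr_ge0_le0// ?subr_ge0 ?subr_le0 ?expr_le1 ?expr_ge1// ltW.
Qed.

Lemma bfac_self a z : normc a < 1 -> normc z < 1 -> (bfac a z == 0) = (z == a).
Proof.
move=> a1 z1; have d0 : 1 - a^*%C * z != 0 by rewrite bfac_den_neq0// disc_mul_lt1// ltW.
by rewrite /bfac mulf_eq0 invr_eq0 (negbTE d0) orbF subr_eq0 eq_sym.
Qed.

Lemma bprod_eq0 c s z : blaschke c s -> normc z < 1 -> (bprod c s z == 0) = (z \in s).
Proof.
move=> [c1 sD] z1; elim: s sD => [_|a s IH /in_disc_cons[a1 sD]].
  by rewrite bprod_nil in_nil -normc_eq0 c1 oner_eq0.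
by rewrite bprod_cons mulf_eq0 bfac_self// IH// inE.
Qed.

Lemma normc_bprod_circ c s z : blaschke c s -> normc z = 1 -> normc (bprod c s z) = 1.
Proof.
move=> [c1 sD] z1; elim: s sD => [_|a s IH /in_disc_cons[a1 sD]].
  by rewrite bprod_nil.
by rewrite bprod_cons normcM normc_bfac_circ// IH// mulr1.
Qed.

Lemma normc_bprod_le1 c s z : blaschke c s -> normc z < 1 -> normc (bprod c s z) <= 1.
Proof.
move=> [c1 sD] z1; elim: s sD => [_|a s IH /in_disc_cons[a1 sD]].
  by rewrite bprod_nil c1.
by rewrite bprod_cons normcM mulr_ile1// ?IH// ltW// normc_bfac_lt1.
Qed.

Lemma normc_bprod_lt1 c s z : blaschke c s -> s != [::] -> normc z < 1 -> normc (bprod c s z) < 1.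
Proof.
case: s => [//|a s] [c1 /in_disc_cons[a1 sD]] _ z1.
rewrite bprod_cons normcM; apply: (@le_lt_trans _ _ (normc (bfac a z))).
  by rewrite ler_piMr// normc_bprod_le1.
exact: normc_bfac_lt1.
Qed.

Lemma bprod_cdiff c s z : (forall a, a \in s -> normc a * normc z < 1) ->
  exists l, cdiff (bprod c s) z l.
Proof.
elim: s => [_|a s IH H].
  by exists 0; apply: (cdiff_near (f := fun=> c) ltr01) => [w _|]; [rewrite bprod_nil|exact: cdiff_cst].
have [x xs|l dl] := IH; first by apply: H; rewrite inE xs orbT.
have da := cdiff_bfac (H a (mem_head _ _)).
eexists; apply: (cdiff_near ltr01 _ (cdiffM da dl)) => w _.
by rewrite bprod_cons.
Qed.

Lemma bprod_holo1 c s : in_disc s -> holo 1 (bprod c s).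
Proof. by move=> sD z z1; apply: bprod_cdiff => a /sD a1; rewrite disc_mul_lt1// ltW. Qed.

Lemma bprod_radius s : in_disc s -> exists2 r0 : R, 1 < r0 & forall c, holo r0 (bprod c s).
Proof.
move=> sD; have [rho [rho0 rho1 srho]] : exists rho, [/\ 0 < rho, rho < 1 &
    forall a, a \in s -> normc a <= rho].
  elim: s sD => [_|a s IH /in_disc_cons[a1 /IH[rho [rho0 rho1 H]]]].
    by exists 2^-1; split=> //; rewrite ?invr_gt0// invf_lt1// ltr1n.
  exists (Num.max rho (normc a)); split; first by rewrite lt_max rho0.
    by rewrite gt_max rho1.
  by move=> x; rewrite inE le_max => /orP[/eqP ->|/H ->]//; rewrite lexx orbT.
(* The poles have modulus at least [1 / rho], and [1 < 2 / (1 + rho) < 1 / rho]. *)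
exists (2 / (1 + rho)); first by rewrite ltr_pdivlMr; lra.
move=> c z zr; apply: bprod_cdiff => a /srho ar.
have r1 : 0 < 1 + rho by lra.
rewrite ltr_pdivlMr// in zr.
have := ler_wpM2r (normc_ge0 z) ar; have := normc_ge0 z; nra.
Qed.

(** On the unit circle, the sum of the Poisson kernels of the zeros; hence it is positive there as
    soon as there is a zero. *)
Definition bangle s z : R := \sum_(a <- s) (1 - normc a ^+ 2) / normc (1 - a^*%C * z) ^+ 2.

(* [bangle s (e^it)] is the derivative of the argument of [bprod c s] along the circle. *)
Lemma bprod_cdiff_circ c s z : in_disc s -> normc z = 1 ->
  cdiff (bprod c s) z (z^-1 * (bangle s z)%:C * bprod c s z).
Proof.
move=> sD z1; have z0 : z != 0 by rewrite -normc_gt0 z1.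
have zJ : z * z^*%C = 1 by rewrite normcJE z1 expr1n.
elim: s sD => [_|a s IH /in_disc_cons[a1 sD]].
  rewrite /bangle big_nil mulr0 mul0r.
  by apply: (cdiff_near (f := fun=> c) ltr01) => [w _|]; [rewrite bprod_nil|exact: cdiff_cst].
have az : normc a * normc z < 1 by rewrite z1 mulr1.
have d0 := bfac_den_neq0 az.
have dJ0 : (1 - a^*%C * z)^*%C != 0 by rewrite conjc_eq0.
have E1 : ((1 - normc a ^+ 2) / normc (1 - a^*%C * z) ^+ 2)%:C =
   (1 - a * a^*%C) / ((1 - a^*%C * z) * (1 - a^*%C * z)^*%C) :> C.
  by rewrite !normcJE fmorph_div rmorphB.
have E2 : (1 - a^*%C * z)^*%C = z^-1 * (z - a).
  rewrite rmorphB rmorph1 rmorphM /= conjcK.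
  have -> : z^*%C = z^-1 by apply: (mulfI z0); rewrite zJ mulfV.
  by field.
have za : z - a != 0 by move: dJ0; rewrite E2 mulf_eq0 negb_or => /andP[].
have E3 : (- 1 - bfac a z * - a^*%C) / (1 - a^*%C * z) =
   z^-1 * ((1 - normc a ^+ 2) / normc (1 - a^*%C * z) ^+ 2)%:C * bfac a z.
  rewrite E1 E2 /bfac; field.
  by rewrite d0 z0 za.
have := cdiffM (cdiff_bfac az) (IH sD); rewrite E3 => H.
apply: (cdiff_near ltr01 (f := fun w => bfac a w * bprod c s w)) => [w _|].
  by rewrite bprod_cons.
move: H; congr (cdiff _ _ _); rewrite bprod_cons /bangle big_cons [in RHS]rmorphD /=.
by ring.
Qed.

Lemma bangle_bounds s : in_disc s -> exists2 K, 0 <= K & forall z, normc z = 1 -> 0 <= bangle s z <= K.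
Proof.
elim: s => [_|a s IH /in_disc_cons[a1 sD]].
  by exists 0 => // z _; rewrite /bangle big_nil lexx.
have [K K0 H] := IH sD.
have a2 : 0 <= 1 - normc a ^+ 2 by rewrite subr_ge0 expr_le1// ltW.
exists ((1 - normc a ^+ 2) / (1 - normc a) ^+ 2 + K).
  by rewrite addr_ge0// divr_ge0// sqr_ge0.
move=> z z1; have /andP[h1 h2] := H z z1; rewrite /bangle big_cons -/(bangle s z).
rewrite addr_ge0 ?divr_ge0 ?sqr_ge0//= lerD// ler_wpM2l//.
have aa : 0 < 1 - normc a by rewrite subr_gt0.
have d : 1 - normc a <= normc (1 - a^*%C * z).
  by have := lerB_normc 1 (a^*%C * z); rewrite normcM normc_conj z1 mulr1 normc1.
rewrite lef_pV2 ?posrE ?exprn_gt0//; last exact: lt_le_trans d.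
by rewrite ler_pXn2r ?nnegrE ?normc_ge0 ?(ltW aa).
Qed.

Lemma bangle_lower s : in_disc s -> s != [::] -> exists2 k, 0 < k & forall z, normc z = 1 -> k <= bangle s z.
Proof.
case: s => [//|a s] /in_disc_cons[a1 sD] _.
have a2 : 0 < 1 - normc a ^+ 2 by rewrite subr_gt0 expr_lt1.
exists ((1 - normc a ^+ 2) / 4); first by rewrite divr_gt0.
move=> z z1; rewrite /bangle big_cons -/(bangle s z).
have [K K0 H] := bangle_bounds sD; have /andP[h1 _] := H z z1.
apply: ler_wpDr => //; rewrite ler_wpM2l ?(ltW a2)//.
have d0 : 1 - a^*%C * z != 0 by rewrite bfac_den_neq0// z1 mulr1.
have d : normc (1 - a^*%C * z) <= 2.
  have := le_normcD 1 (- (a^*%C * z)); rewrite normcN normcM normc_conj z1 mulr1 normc1; lra.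
rewrite lef_pV2 ?posrE ?exprn_gt0// ?normc_gt0//.
have -> : (4 : R) = 2 ^+ 2 by ring.
by rewrite ler_pXn2r ?nnegrE ?normc_ge0.
Qed.

(** Serves after the cancellation of a factor vanishing at [a]: the inequality then holds away from
    [a] and is recovered at [a] by continuity. *)
Lemma normc_le_limit (f g : C -> C) a : normc a < 1 -> ceps f a -> ceps g a ->
  (forall z, normc z < 1 -> z != a -> normc (f z) <= normc (g z)) -> normc (f a) <= normc (g a).
Proof.
move=> a1 cf cg H; apply/ler_addgt0Pr => e e0.
have e20 : 0 < e / 2 by rewrite divr_gt0.
have [d1 d10 h1] := cf _ e20; have [d2 d20 h2] := cg _ e20.
pose x := Num.min (Num.min d1 d2) (1 - normc a) / 2.
have m0 : 0 < Num.min (Num.min d1 d2) (1 - normc a) by rewrite !lt_min d10 d20 subr_gt0.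
have x0 : 0 < x by rewrite divr_gt0.
have xm : x < Num.min (Num.min d1 d2) (1 - normc a) by rewrite /x; lra.
rewrite !lt_min in xm; have /andP[/andP[xd1 xd2] xa] := xm.
pose w := a + x%:C.
have wa : normc (w - a) = x by rewrite /w addrC addKr normcC gtr0_norm.
have w1 : normc w < 1.
  by have := le_normcD a x%:C; rewrite normcC gtr0_norm// -/w; lra.
have wna : w != a by rewrite -subr_eq0 -normc_eq0 wa gt_eqF.
have := H w w1 wna; have := h1 w; have := h2 w; rewrite wa => /(_ xd2) g2 /(_ xd1) f2.
have := lerB_normc (f a) (f w); rewrite normc_distC; have := lerB_normc (g w) (g a); lra.
Qed.

Lemma eq0_limit (f : C -> C) a : normc a < 1 -> ceps f a ->
  (forall z, normc z < 1 -> z != a -> f z = 0) -> f a = 0.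
Proof.
move=> a1 cf H; apply/eqP; rewrite -normc_eq0 eq_le normc_ge0 andbT.
rewrite -[leRHS](@normc0 R); apply: (normc_le_limit (g := fun=> 0) a1 cf).
  by move=> e e0; exists 1 => // w _; rewrite subrr normc0.
by move=> z z1 za; rewrite H.
Qed.

Lemma holo_ceps r0 (f : C -> C) z : holo r0 f -> normc z < r0 -> ceps f z.
Proof. by move=> hf /hf[l dl] e e0; exact: cdiff_cont dl e e0. Qed.

Lemma holoM r0 (f g : C -> C) : holo r0 f -> holo r0 g -> holo r0 (fun z => f z * g z).
Proof. by move=> hf hg z zr; have [l dl] := hf z zr; have [m dm] := hg z zr; eexists; exact: (cdiffM dl dm). Qed.

Lemma holoB r0 (f g : C -> C) : holo r0 f -> holo r0 g -> holo r0 (fun z => f z - g z).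
Proof. by move=> hf hg z zr; have [l dl] := hf z zr; have [m dm] := hg z zr; eexists; exact: (cdiffB dl dm). Qed.

Lemma holoX r0 (f : C -> C) n : holo r0 f -> holo r0 (fun z => f z ^+ n).
Proof.
move=> hf z zr; have [l dl] := hf z zr; eexists.
exact: (cdiff_comp dl (cdiffX n (f z))).
Qed.

(** The factors are cancelled one at a time. Each has a single zero in the disc, and there the
    cofactor vanishes by continuity. *)
Lemma bprod_mul_eq0 c s (u : C -> C) : blaschke c s -> holo 1 u ->
  (forall z, normc z < 1 -> bprod c s z * u z = 0) -> forall z, normc z < 1 -> u z = 0.
Proof.
move=> [c1 sD] hu; elim: s sD => [_|a s IH /in_disc_cons[a1 sD]] H.
  move=> z /H; rewrite bprod_nil => /eqP; rewrite mulf_eq0.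
  by rewrite -normc_eq0 c1 oner_eq0 => /eqP.
apply: IH => // z z1; have [->|za] := eqVneq z a.
  apply: (@eq0_limit (fun z => bprod c s z * u z)) => //.
    by apply: (@holo_ceps 1) => //; exact: (holoM (bprod_holo1 c sD)).
  move=> w w1 wa; have := H w w1; rewrite bprod_cons -mulrA => /eqP.
  by rewrite mulf_eq0 bfac_self// (negbTE wa) => /eqP.
have := H z z1; rewrite bprod_cons -mulrA => /eqP.
by rewrite mulf_eq0 bfac_self// (negbTE za) => /eqP.
Qed.

Lemma bprod_rem c a s z : a \in s -> bprod c s z = bfac a z * bprod c (rem a s) z.
Proof.
by move=> as_; rewrite -bprod_cons /bprod (perm_big _ (perm_to_rem as_)).
Qed.

(** The inequality makes each zero [a] of the smaller list a zero of the other product. Once the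
    factor of [a] is removed on both sides, the inequality persists off [a], and at [a] by
    continuity; multiplicities are thus counted by the induction. *)
Lemma bprod_divides c s c' s' : blaschke c s -> blaschke c' s' ->
  (forall z, normc z < 1 -> normc (bprod c' s' z) <= normc (bprod c s z)) ->
  exists d t, blaschke d t /\ forall z, bprod c' s' z = bprod c s z * bprod d t z.
Proof.
move=> [c1 sD] [c'1 sD']; elim: s s' sD sD' => [|a s IH] s' sD sD' H.
  have c0 : c != 0 by rewrite -normc_gt0 c1.
  exists (c' / c), s'; split; first by split=> //; rewrite normcM normcV c1 c'1 invr1 mulr1.
  by move=> z; rewrite bprod_nil /bprod mulrA [c * _]mulrC divfK.
have /in_disc_cons[a1 sD0] := sD.
have as_ : a \in s'.
  rewrite -(bprod_eq0 (c := c')) //.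
  rewrite -normc_eq0 eq_le normc_ge0 andbT; apply: (le_trans (H a a1)).
  by rewrite (_ : bprod c (a :: s) a = 0) ?normc0//; apply/eqP; rewrite bprod_eq0 ?mem_head.
have remD : in_disc (rem a s') by move=> x /mem_rem /sD'.
have HH z : normc z < 1 -> normc (bprod c' (rem a s') z) <= normc (bprod c s z).
  have off w : normc w < 1 -> w != a -> normc (bprod c' (rem a s') w) <= normc (bprod c s w).
    move=> w1 wa; have := H w w1; rewrite (bprod_rem _ _ as_) bprod_cons (normcM (bfac a w)).
    rewrite [leRHS]normcM.
    by rewrite ler_pM2l// normc_gt0 bfac_self.
  move=> z1; have [->|za] := eqVneq z a; last exact: off.
  apply: normc_le_limit => //.
    by apply: (@holo_ceps 1) => //; exact: bprod_holo1.
  by apply: (@holo_ceps 1) => //; exact: bprod_holo1.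
have [d [t [bt E]]] := IH (rem a s') sD0 remD HH.
exists d, t; split => // z.
by rewrite (bprod_rem _ _ as_) bprod_cons E mulrA.
Qed.

(** If [m < n], dividing by [z ^+ m] off 0 and letting [z] tend to 0 would give [u 0 = 0]. *)
Lemma order_at0_le m n (u t : C -> C) : holo 1 u -> holo 1 t -> u 0 != 0 ->
  (forall z, z != 0 -> z ^+ m * u z = z ^+ n * t z) -> (n <= m)%N.
Proof.
move=> hu ht u0 H; rewrite leqNgt; apply: contraNN u0 => mn.
have n0 : normc (0 : C) < 1 by rewrite normc0.
suff : u 0 - 0 ^+ (n - m) * t 0 = 0.
  by rewrite expr0n subn_eq0 leqNgt mn mul0r subr0 => /eqP.
apply: (@eq0_limit (fun z => u z - z ^+ (n - m) * t z)) => // [|z _ z0].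
  apply: (@holo_ceps 1) => //; apply: holoB => //; apply: holoM => //.
  by apply: holoX => z _; exists 1; exact: cdiff_id.
have zm : z ^+ m != 0 by rewrite expf_neq0.
by apply: (mulfI zm); rewrite mulr0 mulrBr mulrA -exprD subnKC ?(ltnW mn)// H// subrr.
Qed.

(** * Composition of a Blaschke factor with a Blaschke product *)

Section composition.
Variables (c a : C) (s : seq C).
Hypotheses (bs : blaschke c s) (s0 : s != [::]) (a1 : normc a < 1).

Let prodB (t : seq C) z : \prod_(b <- t) (b - z) = (-1) ^+ size t * \prod_(b <- t) (z - b).
Proof.
elim: t => [|b t IH]; first by rewrite !big_nil expr0 mulr1.
by rewrite !big_cons IH /= exprS; ring.
Qed.

(** With [f b] a linear factor at [1 / z^*], one power of [z] per entry turns its conjugate into a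
    linear factor at [z]. *)
Let prod_refl (t : seq C) (f g : C -> C) z : (forall b, z * (f b)^*%C = g b) ->
  z ^+ size t * (\prod_(b <- t) f b)^*%C = \prod_(b <- t) g b.
Proof.
move=> fg; elim: t => [|b t IH]; first by rewrite !big_nil conjc1 mulr1.
by rewrite !big_cons -IH -fg /= rmorphM exprS mulrACA.
Qed.

(** The sign converts the factors [b - z] into [z - b], so that [bprod c s] is [P / Q] with [P] a
    constant times a monic product. *)
Let c2 : C := (-1) ^+ size s * c.
Let P : {poly C} := c2 *: \prod_(b <- s) ('X - b%:P).
Let Qof (t : seq C) : {poly C} := \prod_(b <- t) (1 - (b^*%C) *: 'X).
Let Q := Qof s.

Let PE z : P.[z] = c2 * \prod_(b <- s) (z - b).
Proof. by rewrite hornerZ horner_prod; congr (_ * _); apply: eq_bigr => b _; rewrite !hornerE. Qed.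

Let QofE t z : (Qof t).[z] = \prod_(b <- t) (1 - b^*%C * z).
Proof. by rewrite horner_prod; apply: eq_bigr => b _; rewrite !hornerE. Qed.

Let Qof_neq0 t z : in_disc t -> normc z <= 1 -> (Qof t).[z] != 0.
Proof.
move=> tD z1; rewrite QofE prodf_seq_neq0; apply/allP => b bt; apply/implyP => _.
by rewrite bfac_den_neq0// disc_mul_lt1//; exact: tD.
Qed.

Let bprodE z : bprod c s z = P.[z] / Q.[z].
Proof. by rewrite PE QofE /bprod prodf_div prodB /c2; ring. Qed.

Let c2_normc : normc c2 = 1.
Proof. by rewrite normcM normcX normcN normc1 expr1n mul1r bs.1. Qed.

Let c2J : c2 * c2^*%C = 1.
Proof. by rewrite normcJE c2_normc expr1n. Qed.

Let S := a *: Q - P.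
Let U := Q - a^*%C *: P.

Let SE z : S.[z] = a * Q.[z] - P.[z].
Proof. by rewrite /S hornerD hornerN hornerZ. Qed.

Let UE z : U.[z] = Q.[z] - a^*%C * P.[z].
Proof. by rewrite /U hornerD hornerN hornerZ. Qed.

(** Outside the open disc [|Q| <= |P|] and [P] has no zero there, so [a Q = P] would give
    [|P| <= |a| |P| < |P|]. *)
Let S_neq0 z : 1 <= normc z -> S.[z] != 0.
Proof.
move=> z1; rewrite SE subr_eq0; apply/eqP => E.
have nPQ : normc Q.[z] <= normc P.[z].
  rewrite PE QofE normcM c2_normc mul1r !normc_prod.
  elim: s bs.2 => [_|b r IH /in_disc_cons[b1 rD]]; first by rewrite !big_nil.
  rewrite !big_cons normc_distC ler_pM ?prodr_ge0//; [exact: normc_bfac_num|exact: IH].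
have P0 : P.[z] != 0.
  rewrite PE mulf_neq0 ?prodf_seq_neq0//; first by rewrite -normc_gt0 c2_normc.
  apply/allP => b bs'; apply/implyP => _; rewrite subr_eq0; apply: contraTneq z1 => ->.
  by rewrite -ltNge; exact: bs.2.
have Pgt : 0 < normc P.[z] by rewrite normc_gt0.
have := congr1 (@normc R) E; rewrite normcM => E'.
have : normc a * normc Q.[z] <= normc a * normc P.[z] by rewrite ler_wpM2l.
rewrite E' => h; have : normc a * normc P.[z] < normc P.[z] by rewrite gtr_pMl.
move=> h'.
by lra.
Qed.

Let holo_poly (p : {poly C}) : holo 1 (fun z => p.[z]).
Proof.
move=> z _; elim/poly_ind: p => [|p b [l dl]].
  by exists 0; apply: (cdiff_near (f := fun=> 0) ltr01) => [w _|]; [rewrite horner0|exact: cdiff_cst].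
eexists; apply: (cdiff_near (f := fun w => p.[w] * w + b) ltr01) => [w _|].
  by rewrite !hornerE.
exact: (cdiffD (cdiffM dl (cdiff_id z)) (cdiff_cst b z)).
Qed.

(* The roots of [S = a Q - P] lie in the disc, and the reflection [z |-> 1/z^*] turns [S] into
   [U = Q - a^* P] up to a constant. *)
Lemma bfac_bprod_blaschke : exists c' s', [/\ blaschke c' s', s' != [::] &
  forall z, normc z < 1 -> bfac a (bprod c s z) = bprod c' s' z].
Proof.
have [k [rs Sfac]] : exists (k : C) (rs : seq C), S = k *: \prod_(r <- rs) ('X - r%:P).
  by have [rs E] := closed_field_poly_normal S; exists (lead_coef S), rs.
have Seval z : S.[z] = k * \prod_(r <- rs) (z - r).
  by rewrite Sfac hornerZ horner_prod; congr (_ * _); apply: eq_bigr => r _; rewrite !hornerE.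
have k0 : k != 0.
  have : S.[1] != 0 by apply: S_neq0; rewrite normc1.
  by apply: contra => /eqP k0; rewrite Seval k0 mul0r.
have rsD : in_disc rs.
  move=> r rrs; rewrite ltNge; apply/negP => /S_neq0; rewrite Seval mulf_eq0 negb_or.
  move=> /andP[_ /negP]; apply; rewrite prodf_seq_eq0; apply/hasP; exists r => //.
  by rewrite subrr eqxx.
pose e : C := - (c2 * k^*%C).
(* The conjugate of [S] at [w = 1 / z^*] is computed twice, from [S = a Q - P] and from the
   factorization of [S]. *)
have refl z : z != 0 -> z ^+ size rs * U.[z] = z ^+ size s * (e * (Qof rs).[z]).
  move=> z0; pose w := (z^*%C)^-1.
  have wJ : w^*%C = z^-1 by rewrite conjc_inv conjcK.
  have zw : z * w^*%C = 1 by rewrite wJ mulfV.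
  have g1 b : z * (1 - b^*%C * w)^*%C = z - b.
    by rewrite rmorphB rmorph1 rmorphM /= conjcK mulrBr mulr1 mulrCA zw mulr1.
  have g2 b : z * (w - b)^*%C = 1 - b^*%C * z by rewrite rmorphB /= mulrBr zw (mulrC z).
  have QJ : z ^+ size s * (Q.[w])^*%C = c2^*%C * P.[z].
    by rewrite QofE (prod_refl _ g1) PE mulrA (mulrC _ c2) c2J mul1r.
  have PJ : z ^+ size s * (P.[w])^*%C = c2^*%C * Q.[z].
    by rewrite PE rmorphM /= mulrCA (prod_refl _ g2) QofE.
  have SJ : z ^+ size rs * (S.[w])^*%C = k^*%C * (Qof rs).[z].
    by rewrite Seval rmorphM /= mulrCA (prod_refl _ g2) QofE.
  have SU : z ^+ size s * (S.[w])^*%C = - c2^*%C * U.[z].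
    by rewrite SE UE rmorphB rmorphM /= mulrBr mulrCA QJ PJ; ring.
  transitivity (c2 * c2^*%C * (z ^+ size rs * U.[z])); first by rewrite c2J mul1r.
  transitivity (- c2 * z ^+ size rs * (- c2^*%C * U.[z])); first by ring.
  rewrite -SU; transitivity (- c2 * z ^+ size s * (z ^+ size rs * (S.[w])^*%C)); first by ring.
  by rewrite SJ /e; ring.
have e1 : normc e = normc k by rewrite /e normcN normcM c2_normc mul1r normc_conj.
have e0 : e != 0 by rewrite -normc_gt0 e1 normc_gt0.
have U0 z : normc z < 1 -> U.[z] != 0.
  move=> z1; have q0 := Qof_neq0 bs.2 (ltW z1).
  rewrite UE -[P.[z]](divfK q0) -bprodE mulrA -{1}[Q.[z]]mul1r -mulrBl mulf_neq0//.
  by rewrite bfac_den_neq0// disc_mul_lt1// normc_bprod_le1.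
have n0 : normc (0 : C) < 1 by rewrite normc0.
have heT : holo 1 (fun z => e * (Qof rs).[z]).
  by move=> z z1; have [l dl] := holo_poly (Qof rs) z1; exists (e * l); exact: cdiffZ.
(* Neither [U] nor the product over the roots of [S] vanishes at 0, so the two powers of [z] in
   [refl] have the same exponent. *)
have rsN : size rs = size s.
  apply/eqP; rewrite eqn_leq (order_at0_le heT (holo_poly U)) ?(order_at0_le (holo_poly U) heT)//.
  - by rewrite U0.
  - by rewrite mulf_neq0// Qof_neq0// normc0.
  - by move=> z /refl.
have UT z : normc z < 1 -> U.[z] = e * (Qof rs).[z].
  have off w : w != 0 -> U.[w] = e * (Qof rs).[w].
    by move=> w0; apply: (mulfI (expf_neq0 (size s) w0)); rewrite -refl// rsN.
  have [->|/off//] := eqVneq z 0 => _; apply/eqP; rewrite -subr_eq0; apply/eqP.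
  apply: (@eq0_limit (fun z => U.[z] - e * (Qof rs).[z])) => // [|w _ /off ->]; last exact: subrr.
  by apply: (@holo_ceps 1) => //; apply: holoB => //; exact: holo_poly.
exists (k / e * (-1) ^+ size rs), rs; split.
- split=> //; rewrite normcM normcX (_ : normc (-1) = 1) ?normcN ?normc1// expr1n mulr1.
  by rewrite normcM normcV e1 mulfV// normc_eq0.
- by rewrite -size_eq0 rsN size_eq0.
move=> z z1; have q0 := Qof_neq0 bs.2 (ltW z1); have u0 := U0 z z1.
rewrite /bfac bprodE.
have -> : (a - P.[z] / Q.[z]) / (1 - a^*%C * (P.[z] / Q.[z])) = S.[z] / U.[z].
  rewrite UE in u0; rewrite UE SE; field.
  by rewrite u0 q0.
rewrite UT// Seval QofE /bprod prodf_div prodB invfM.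
transitivity ((-1) ^+ size rs * (-1) ^+ size rs * (k / e * ((\prod_(r <- rs) (z - r)) /
  (\prod_(r <- rs) (1 - r^*%C * z))))); last by ring.
by rewrite -expr2 sqrr_sign mul1r; ring.
Qed.

End composition.

End blaschke.

(** * Boundedness of weighted composition operators *)

Section circle_pairing.
Context {R : realType}.
Local Notation C := R[i].
Implicit Types (F G : R -> C) (x y : nat -> C).

Lemma Re_avg_le F G : ccirc F -> ccirc G ->
  (forall t, complex.Re (F t) <= complex.Re (G t)) -> complex.Re (avg F) <= complex.Re (avg G).
Proof.
move=> cF cG FG; rewrite -subr_ge0.
have -> : complex.Re (avg G) - complex.Re (avg F) = complex.Re (avg (fun t => G t - F t)).
  by rewrite avgB//; case: (avg G) (avg F) => [? ?] [? ?].
by apply: Re_avg_ge0 => t; have := FG t; rewrite -subr_ge0; case: (G t) (F t) => [? ?] [? ?].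
Qed.

(* The partial sums increase to the mean. *)
Lemma parseval_pairing_le F G x (w : nat -> R) (M q : R) : 0 <= M -> 0 <= q < 1 ->
  (forall k, 0 <= w k) ->
  (forall n t, normc (F t - \sum_(k < n) (w k)%:C * x k * circ t ^+ k) <= M * q ^+ n) ->
  (forall n t, normc (G t - \sum_(k < n) x k * circ t ^+ k) <= M * q ^+ n) ->
  forall n, \sum_(k < n) w k * normc (x k) ^+ 2 <= complex.Re (avg (fun t => F t * (G t)^*%C)).
Proof.
move=> M0 q01 w0 hF hG n; apply/ler_addgt0Pr => e e0.
have [N NP] := @parseval_pairing R F G (fun k => (w k)%:C * x k) x M q M0 q01 hF hG e e0.
have {NP} := NP (maxn N n) (leq_maxl _ _).
have -> : \sum_(k < maxn N n) (w k)%:C * x k * (x k)^*%C =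
  (\sum_(k < maxn N n) w k * normc (x k) ^+ 2)%:C.
  rewrite rmorph_sum; apply: eq_bigr => k _; rewrite -mulrA normcJE [RHS]rmorphM /=.
  by [].
move=> H; have := le_trans (ler_Re_normc _) H.
set z := avg _; rewrite (_ : complex.Re _ = \sum_(k < maxn N n) w k * normc (x k) ^+ 2 - complex.Re z); last first.
  by case: z {H}.
rewrite ler_norml => /andP[_].
have : \sum_(k < n) w k * normc (x k) ^+ 2 <= \sum_(k < maxn N n) w k * normc (x k) ^+ 2.
  rewrite -!(big_mkord xpredT (fun k => w k * normc (x k) ^+ 2)).
  rewrite [leRHS](big_cat_nat (n := n)) ?leq_maxr//= lerDl sumr_ge0// => k _.
  by rewrite mulr_ge0// sqr_ge0.
lra.
Qed.

End circle_pairing.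

Section weighted_composition_bound.
Context {R : realType}.
Local Notation C := R[i].
Variables (c c' : C) (s s' : seq C).
Hypotheses (bs : blaschke c s) (bs' : blaschke c' s').
Local Notation phi := (bprod c s).
Local Notation psi := (bprod c' s').

Let theta (t : R) : C := (bangle s (circ t))%:C.

Lemma ccirc_bangle (s0 : seq C) : in_disc s0 -> ccirc (fun t => (bangle s0 (circ t))%:C : C).
Proof.
move=> sD t; rewrite (_ : (fun t => _) = (fun t => \sum_(a <- s0)
   ((1 - normc a ^+ 2) / normc (1 - a^*%C * circ t) ^+ 2)%:C)); last first.
  by apply/funext => u; rewrite /bangle rmorph_sum.
elim: s0 sD => [_|a r IH /in_disc_cons[a1 /IH rD]] e e0.
  by exists 1 => // u _; rewrite !big_nil subrr normc0.
have h (u : R) : 1 - a^*%C * circ u != 0 by rewrite bfac_den_neq0// normc_circ mulr1.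
have aE : (fun u => ((1 - normc a ^+ 2) / normc (1 - a^*%C * circ u) ^+ 2)%:C) =
   (fun u => (1 - normc a ^+ 2)%:C * ((1 - a^*%C * circ u)^-1 * ((1 - a^*%C * circ u)^-1)^*%C)).
  by apply/funext => u; rewrite normcJE normcV exprVn rmorphM.
have ci : ccont (fun u => (1 - a^*%C * circ u)^-1) t.
  apply: (ccont_comp (f := fun w => w^-1) (cdiff_inv (h t))).
  by apply: ccontB; [exact: ccont_cst|apply: ccontZ; exact: ccont_circ].
have ca : ccont (fun u => ((1 - normc a ^+ 2) / normc (1 - a^*%C * circ u) ^+ 2)%:C) t.
  by rewrite aE; apply: ccontZ; apply: ccontM => //; exact: ccontJ.
have := ccontD ca rD.
move=> /(_ e e0)[d d0 H]; exists d => // u /H; by rewrite !big_cons.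
Qed.

Let phi_holo1 (t : R) : exists l, cdiff phi (circ t) l.
Proof. by eexists; apply: bprod_cdiff_circ; [exact: bs.2|exact: normc_circ]. Qed.

Lemma ccirc_bprod : ccirc (fun t => phi (circ t)).
Proof. by move=> t; have [l dl] := phi_holo1 t; apply: (ccont_comp dl); exact: ccont_circ. Qed.

Let phi1 t : normc (phi (circ t)) = 1.
Proof. by rewrite normc_bprod_circ// normc_circ. Qed.

Let phiJ t : phi (circ t) * (phi (circ t))^*%C = 1.
Proof. by rewrite normcJE phi1 expr1n. Qed.

(* [theta phi^m] is a multiple of the derivative of [phi^m] along the circle. *)
Lemma avg_bangleX m : (0 < m)%N -> avg (fun t => theta t * phi (circ t) ^+ m) = 0.
Proof.
move=> m0.
have c0 : ccirc (fun t => theta t * phi (circ t) ^+ m).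
  move=> t; apply: ccontM; first exact: (ccirc_bangle bs.2).
  by apply: ccontX; exact: ccirc_bprod.
have m0' : m%:R != 0 :> C by rewrite pnatr_eq0 -lt0n.
apply: (mulfI m0'); rewrite mulr0 -avgZ//.
pose F t := m%:R * (theta t * phi (circ t) ^+ m) * (circ t)^-1.
rewrite (@eq_avg _ _ (fun t => F t * circ t)); last by move=> t; rewrite divfK ?circ_neq0.
apply: (avg_FTC (f := fun z => phi z ^+ m)) => t; last first.
  apply: ccontM; first exact: ccontZ.
  by apply: (ccont_comp (cdiff_inv (circ_neq0 t))); exact: ccont_circ.
have := cdiff_comp (bprod_cdiff_circ c bs.2 (normc_circ t)) (cdiffX m (phi (circ t))).
rewrite [X in cdiff _ _ X -> _](_ : _ = F t)//.
have E : phi (circ t) ^+ m = phi (circ t) * phi (circ t) ^+ m.-1 by rewrite -exprS prednK.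
by rewrite /F E /theta; ring.
Qed.

Let N : C := avg theta.

(** As [|phi| = 1] on the circle, [phi^k] times the conjugate of [phi^l] is a power of [phi] or the
    conjugate of one, and [avg_bangleX] applies. *)
Lemma avg_bangle_orthogonal k l :
  avg (fun t => theta t * (phi (circ t) ^+ k * (phi (circ t) ^+ l)^*%C)) = (k == l)%:R * N.
Proof.
have H i j t : phi (circ t) ^+ (i + j) * (phi (circ t) ^+ j)^*%C = phi (circ t) ^+ i.
  by rewrite exprD rmorphXn -mulrA -exprMn phiJ expr1n mulr1.
have [kl|lk|->] := ltngtP k l.
- rewrite mul0r -[RHS](conjc0 R) -(@avg_bangleX (l - k)) ?subn_gt0//.
  rewrite -avgJ; last first.
    move=> t; apply: ccontM; first exact: (ccirc_bangle bs.2).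
    by apply: ccontX; exact: ccirc_bprod.
  apply: eq_avg => t; rewrite rmorphM /= /theta; congr (_ * _).
    by rewrite /= oppr0.
  by rewrite -(H (l - k)%N k) subnK ?(ltnW kl)// [RHS]rmorphM /= conjcK mulrC.
- rewrite mul0r -(@avg_bangleX (k - l)) ?subn_gt0//.
  by apply: eq_avg => t; rewrite -(H (k - l)%N l) subnK ?(ltnW lk).
rewrite mul1r; apply: eq_avg => t.
by rewrite -{1}[l]add0n H expr0 mulr1.
Qed.

Let P (a : nat -> C) n z : C := \sum_(k < n) a k * phi z ^+ k.

Let ccirc_theta : ccirc theta.
Proof. exact: ccirc_bangle bs.2. Qed.

Let ccirc_P a n : ccirc (fun t => P a n (circ t)).
Proof.
by move=> t; apply: ccont_sum => k; apply: ccontZ; apply: ccontX; exact: ccirc_bprod.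
Qed.

Lemma avg_bangle_pairing a b n :
  avg (fun t => theta t * (P a n (circ t) * (P b n (circ t))^*%C)) =
  N * \sum_(k < n) a k * (b k)^*%C.
Proof.
apply: avg_orthogonal ccirc_theta ccirc_bprod _ => k l.
exact: avg_bangle_orthogonal.
Qed.

Let ReZ (r : R) (z : C) : complex.Re (r%:C * z) = r * complex.Re z.
Proof. by case: z => x y /=; rewrite mul0r subr0. Qed.

Let ReD (z w : C) : complex.Re (z + w) = complex.Re z + complex.Re w.
Proof. by case: z w => ? ? []. Qed.

Let N_ge0 : 0 <= complex.Re N.
Proof.
apply: Re_avg_ge0 => t; have [K _ H] := bangle_bounds bs.2.
by have /andP[] := H _ (normc_circ t).
Qed.

Let ccirc_P2 a b n : ccirc (fun t => P a n (circ t) * (P b n (circ t))^*%C).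
Proof. by move=> t; apply: ccontM; [exact: ccirc_P|apply: ccontJ; exact: ccirc_P]. Qed.

Let mean_lower (kl : R) a n : (forall z, normc z = 1 -> kl <= bangle s z) ->
  kl * complex.Re (avg (fun t => P a n (circ t) * (P a n (circ t))^*%C)) <=
  complex.Re N * \sum_(k < n) normc (a k) ^+ 2.
Proof.
move=> low; have cP := @ccirc_P2 a a n.
rewrite -ReZ -avgZ//; apply: (@le_trans _ _ (complex.Re (avg
    (fun t => theta t * (P a n (circ t) * (P a n (circ t))^*%C))))).
  apply: Re_avg_le => [t|t|t]; [exact: ccontZ|apply: ccontM; [exact: ccirc_theta|exact: cP]|].
  by rewrite normcJE /theta !ReZ ler_wpM2r ?sqr_ge0// low// normc_circ.
by rewrite avg_bangle_pairing normc2_sum_real mulrC ReZ mulrC.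
Qed.

Let mean_upper (K : R) a n : (forall z, normc z = 1 -> 0 <= bangle s' z <= K) ->
  complex.Re (avg (fun t => (bangle s' (circ t))%:C * (P a n (circ t) * (P a n (circ t))^*%C))) <=
  K * complex.Re (avg (fun t => P a n (circ t) * (P a n (circ t))^*%C)).
Proof.
move=> up; have cP := @ccirc_P2 a a n.
rewrite -ReZ -avgZ//; apply: Re_avg_le => [t|t|t]; [|exact: ccontZ|].
  by apply: ccontM; [exact: (ccirc_bangle bs'.2)|exact: cP].
rewrite normcJE !ReZ ler_wpM2r ?sqr_ge0//.
by have /andP[] := up _ (normc_circ t).
Qed.

Let g a n z := psi z * P a n z.

Let g_cdiff a n t : cdiff (g a n) (circ t) ((circ t)^-1 *
  (psi (circ t) * ((bangle s' (circ t))%:C * P a n (circ t) +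
                   theta t * P (fun k => k%:R * a k) n (circ t)))).
Proof.
have d1 := bprod_cdiff_circ c bs.2 (normc_circ t).
have d2 := bprod_cdiff_circ c' bs'.2 (normc_circ t).
have d3 : cdiff (P a n) (circ t) ((circ t)^-1 * (theta t * P (fun k => k%:R * a k) n (circ t))).
  rewrite (_ : (circ t)^-1 * (theta t * P _ n (circ t)) =
    \sum_(k < n) a k * (k%:R * phi (circ t) ^+ k.-1 *
    ((circ t)^-1 * (bangle s (circ t))%:C * phi (circ t)))).
    by apply: cdiff_sum => k; apply: cdiffZ; exact: (cdiff_comp d1 (cdiffX k _)).
  rewrite /P !mulr_sumr; apply: eq_bigr => k _.
  case: (k : nat) => [|m]; first by rewrite !mul0r !mulr0.
  by rewrite exprS /= /theta; ring.
have := cdiffM d2 d3; rewrite [X in cdiff _ _ X -> _](_ : _ = (circ t)^-1 *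
  (psi (circ t) * ((bangle s' (circ t))%:C * P a n (circ t) +
                   theta t * P (fun k => k%:R * a k) n (circ t))))//.
by ring.
Qed.

Let g_holo a n : exists2 r0 : R, 1 < r0 & holo r0 (g a n).
Proof.
have [r1 r11 h1] := bprod_radius bs.2; have [r2 r21 h2] := bprod_radius bs'.2.
exists (Num.min r1 r2); first by rewrite lt_min r11.
move=> z; rewrite lt_min => /andP[z1 z2].
have [l1 d1] := h1 c z z1; have [l2 d2] := h2 c' z z2.
have d3 : cdiff (P a n) z (\sum_(k < n) a k * (k%:R * phi z ^+ k.-1 * l1)).
  by apply: cdiff_sum => k; apply: cdiffZ; exact: (cdiff_comp d1 (cdiffX k _)).
by eexists; exact: (cdiffM d2 d3).
Qed.

Let psiJ t : psi (circ t) * (psi (circ t))^*%C = 1.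
Proof. by rewrite normcJE normc_bprod_circ ?normc_circ// expr1n. Qed.

(** Let [A] be the mean of [|p o phi|^2] on the circle, [p] having coefficients [a]. The lower bound
    [kl] of [theta] and orthogonality give [kl A <= N sum |a_k|^2]. The coefficients [b_k] of
    [psi (p o phi)] satisfy [sum |b_k|^2 <= A], as [|psi| = 1], and
    [sum k |b_k|^2 <= K A + N sum k |a_k|^2], where [K] bounds the angular derivative of [psi]. *)
Lemma wnorm_poly_bound : s != [::] -> exists2 K, 0 <= K & forall (a : nat -> C) n m,
  wnorm (fun z => psi z * \sum_(k < n) a k * phi z ^+ k) m <=
  K * \sum_(k < n) (1 + kappa * k%:R) * normc (a k) ^+ 2.
Proof.
move=> s0; have [kl kl0 low] := bangle_lower bs.2 s0.
have [K K0 up] := bangle_bounds bs'.2.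
have kp : 0 < kappa :> R := kappa_gt0.
exists ((1 + kappa * K) * (complex.Re N / kl) + complex.Re N).
  by rewrite addr_ge0// mulr_ge0// ?divr_ge0 ?(ltW kl0)// addr_ge0// mulr_ge0// ltW.
move=> a n m; rewrite -[X in wnorm X]/(g a n).
have [r0 r01 hg] := g_holo a n.
have r01' : 0 <= (1 : R) < r0 by rewrite ler01.
have [M [q [M0 q01 H]]] := taylor_uniform (ltW r01) hg r01'.
have c1 t : normc (circ t) <= 1 :> R by rewrite normc_circ.
have {}H k t := H k (circ t) (c1 t).
pose b k := coef (g a n) k.
(* On the circle [D] is [z g'(z)], whose Taylor coefficients are those of [g] multiplied by their
   index. *)
pose D t := psi (circ t) * ((bangle s' (circ t))%:C * P a n (circ t) +
                   theta t * P (fun k => k%:R * a k) n (circ t)).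
have hF k t : normc (g a n (circ t) - \sum_(j < k) b j * circ t ^+ j) <= M * q ^+ k.
  by have [] := H k t.
have hD k t : normc (D t - \sum_(j < k) (j%:R)%:C * b j * circ t ^+ j) <= M * q ^+ k.
  have -> : \sum_(j < k) (j%:R)%:C * b j * circ t ^+ j =
     circ t * \sum_(j < k) coef (g a n) j * (j%:R * circ t ^+ j.-1).
    rewrite mulr_sumr; apply: eq_bigr => j _; rewrite rmorph_nat.
    case: (j : nat) => [|i]; first by rewrite !mul0r !mulr0.
    by rewrite exprS /= /b; ring.
  have [_ /(_ _ (@g_cdiff a n t)) h] := H k t.
  apply: le_trans h; rewrite -[leRHS]mul1r -(normc_circ t) -normcM mulrBr mulrA.
  by rewrite mulfV ?circ_neq0// mul1r.
have hF1 k t : normc (g a n (circ t) - \sum_(j < k) 1%:C * b j * circ t ^+ j) <= M * q ^+ k.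
  by under eq_bigr do rewrite mul1r; exact: hF.
have S1 := parseval_pairing_le (w := fun=> 1) M0 q01 (fun=> ler01) hF1 hF m.
have S2 := parseval_pairing_le (w := fun k => k%:R) M0 q01 (fun k => ler0n _ k) hD hF m.
have E1 : avg (fun t => g a n (circ t) * (g a n (circ t))^*%C) =
    avg (fun t => P a n (circ t) * (P a n (circ t))^*%C).
  by apply: eq_avg => t; rewrite /g rmorphM /= mulrACA psiJ mul1r.
have E2 : avg (fun t => D t * (g a n (circ t))^*%C) =
    avg (fun t => (bangle s' (circ t))%:C * (P a n (circ t) * (P a n (circ t))^*%C)) +
    N * (\sum_(k < n) k%:R * normc (a k) ^+ 2)%:C.
  have -> : (\sum_(k < n) k%:R * normc (a k) ^+ 2)%:C = \sum_(k < n) (k%:R * a k) * (a k)^*%C.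
    rewrite rmorph_sum; apply: eq_bigr => k _; rewrite -mulrA normcJE [LHS]rmorphM /=.
    by rewrite rmorph_nat.
  rewrite -(@avg_bangle_pairing (fun k => k%:R * a k) a n) -avgD; first last.
  - by move=> t; apply: ccontM; [exact: ccirc_theta|exact: ccirc_P2].
  - by move=> t; apply: ccontM; [exact: (ccirc_bangle bs'.2)|exact: ccirc_P2].
  apply: eq_avg => t; rewrite /D /g rmorphM /=.
  transitivity ((psi (circ t) * (psi (circ t))^*%C) * (((bangle s' (circ t))%:C * P a n (circ t) +
                   theta t * P (fun k => k%:R * a k) n (circ t)) * (P a n (circ t))^*%C)).
    by ring.
  by rewrite psiJ mul1r mulrDl !mulrA.
rewrite E1 in S1; rewrite E2 (mulrC N) ReD (ReZ (\sum_(k < n) _)) in S2.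
have := mean_lower a n low; have := mean_upper a n up.
set A' := complex.Re (avg _); set A := complex.Re (avg _) => hA' hA.
have wE : wnorm (g a n) m = \sum_(k < m) 1 * normc (b k) ^+ 2 +
   kappa * \sum_(k < m) k%:R * normc (b k) ^+ 2.
  rewrite mulr_sumr -big_split; apply: eq_bigr => k _ /=; rewrite -/(b k); ring.
have aE : \sum_(k < n) (1 + kappa * k%:R) * normc (a k) ^+ 2 = \sum_(k < n) normc (a k) ^+ 2 +
   kappa * \sum_(k < n) k%:R * normc (a k) ^+ 2.
  rewrite mulr_sumr -big_split; apply: eq_bigr => k _ /=; ring.
rewrite wE aE; move: S1 S2 hA' hA; rewrite -/A -/A'.
set X := \sum_(k < m) _; set Y := \sum_(k < m) _; 
set U := \sum_(k < n) normc (a k) ^+ 2; set V := \sum_(k < n) k%:R * normc (a k) ^+ 2.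
have U0 : 0 <= U by apply: sumr_ge0 => k _; rewrite sqr_ge0.
have V0 : 0 <= V by apply: sumr_ge0 => k _; rewrite mulr_ge0// sqr_ge0.
clearbody X Y U V A A' => XA YA AA hA.
have AU : A <= complex.Re N / kl * U.
  rewrite mulrAC ler_pdivlMr// (mulrC A).
  by [].
have : kappa * Y <= kappa * (K * A + V * complex.Re N).
  rewrite ler_wpM2l ?(ltW kp)//.
  lra.
have : (1 + kappa * K) * A <= (1 + kappa * K) * (complex.Re N / kl * U).
  by rewrite ler_wpM2l// addr_ge0// mulr_ge0// ltW.
have : 0 <= (1 + kappa * K) * (complex.Re N / kl) * (kappa * V).
  have k1 := ltW kp; have KK0 : 0 <= kappa * K by exact: mulr_ge0.
  apply: mulr_ge0; last exact: mulr_ge0.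
  by apply: mulr_ge0; [exact: addr_ge0|exact: divr_ge0 (ltW kl0)].
have : 0 <= complex.Re N * U by rewrite mulr_ge0.
lra.
Qed.

End weighted_composition_bound.

(** * From polynomials to all functions *)

Section boundedness.
Context {R : realType}.
Local Notation C := R[i].
Implicit Types (f g : C -> C).

Lemma coef_eq f g n : (forall z, normc z = 2^-1 -> f z = g z) -> coef f n = coef g n.
Proof.
move=> fg; apply: eq_avg => t; rewrite fg// normc_circr// invr_ge0//.
Qed.

Lemma wnorm_eq f g n : (forall z, normc z < 1 -> f z = g z) -> wnorm f n = wnorm g n.
Proof.
move=> fg; apply: eq_bigr => k _; rewrite (@coef_eq f g)// => z zE.
by rewrite fg// zE invf_lt1// ltr1n.
Qed.

Lemma wnormS f n :
  wnorm f n.+1 = wnorm f n + (1 + kappa * n%:R) * (normc (coef f n) * normc (coef f n)).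
Proof. by rewrite -expr2; exact: big_ord_recr. Qed.

(** For fixed [n] only finitely many coefficients occur, so coefficientwise convergence preserves
    the bound, as in Fatou's lemma. *)
Lemma wnorm_le_limit (u : nat -> C -> C) g n L :
  (forall k e, 0 < e -> exists N : nat, forall m, (N <= m)%N ->
     normc (coef (u m) k - coef g k) <= e) ->
  (forall m, wnorm (u m) n <= L) -> wnorm g n <= L.
Proof.
move=> H uL.
have cv k : (fun m => normc (coef (u m) k)) @ \oo --> normc (coef g k).
  apply/cvgrPdist_le => e e0; have [N NP] := H k e e0; exists N => // m mN.
  apply: le_trans (NP m mN); rewrite ler_norml.
  have := lerB_normc (coef (u m) k) (coef g k); have := lerB_normc (coef g k) (coef (u m) k).
  by rewrite (normc_distC (coef g k)); lra.
have cw : (fun m => wnorm (u m) n) @ \oo --> wnorm g n.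
  elim: n {uL} => [|n IH].
    by rewrite /wnorm big_ord0; under eq_fun do rewrite big_ord0; exact: cvg_cst.
  rewrite wnormS (_ : (fun m => _) = (fun m => wnorm (u m) n +
    (1 + kappa * n%:R) * (normc (coef (u m) n) * normc (coef (u m) n)))); last first.
    by apply/funext => m; rewrite wnormS.
  apply: cvgD; first exact: IH.
  by apply: cvgM; [exact: cvg_cst|exact: cvgM].
by apply: (cvgr_to_le cw); exact: nearW.
Qed.

Lemma holo_comp_poly r0 f (a : nat -> C) n : holo r0 f ->
  holo r0 (fun z => \sum_(k < n) a k * f z ^+ k).
Proof.
move=> hf z zr; have [l dl] := hf z zr.
exists (\sum_(k < n) a k * (k%:R * f z ^+ k.-1 * l)).
by apply: cdiff_sum => k; apply: cdiffZ; exact: (cdiff_comp dl (cdiffX k _)).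
Qed.

(** [f] is replaced by its Taylor partial sums, whose norms stay below [L]. On the circle of radius
    1/2, where [coef] is defined, [bprod c s] stays in a smaller closed disc; the images converge
    uniformly on that circle, hence coefficientwise. *)
Lemma wcomp_bound (c c' : C) s s' : blaschke c s -> blaschke c' s' -> s != [::] ->
  exists2 K : R, 0 <= K & forall f W (L : R), holo 1 f ->
    (forall z, normc z < 1 -> W z = bprod c' s' z * f (bprod c s z)) ->
    (forall n, wnorm f n <= L) -> forall n, wnorm W n <= K * L.
Proof.
move=> bs bs' s0; have [K K0 HK] := wnorm_poly_bound bs bs' s0.
exists K => // f W L hf WE fL n.
pose g z := bprod c' s' z * f (bprod c s z).
rewrite (@wnorm_eq W g)//.
pose u m z := bprod c' s' z * \sum_(k < m) coef f k * bprod c s z ^+ k.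
have hu m : holo 1 (u m).
  apply: holoM; first exact: bprod_holo1 bs'.2.
  by apply: holo_comp_poly; exact: bprod_holo1 bs.2.
have hg : holo 1 g.
  move=> z z1; have [l dl] := bprod_holo1 c bs.2 z1; have [m dm] := bprod_holo1 c' bs'.2 z1.
  have [k dk] := hf _ (normc_bprod_lt1 bs s0 z1).
  by eexists; exact: (cdiffM dm (cdiff_comp dl dk)).
have h1 : 0 <= (2^-1 : R) < 1 by apply/andP; split; lra.
have [t0 rhoP] := holo_circ_max (bprod_holo1 c bs.2) h1.
have half1 t : normc ((2^-1)%:C * circ t : C) < 1 by rewrite normc_circr; case/andP: h1.
have rho01 : 0 <= normc (bprod c s ((2^-1)%:C * circ t0)) < 1.
  by rewrite normc_ge0 normc_bprod_lt1.
have [M [q [M0 q01 HT]]] := taylor_uniform (lexx 1) hf rho01.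
apply: (@wnorm_le_limit u) => [k|m].
  apply: (@coef_cvg _ g u 1 k (lexx 1) hg hu) => e e0.
  have [N NP] := geo_small M q01 e0; exists N => m /NP /ltW mN t tI; have z1 := half1 t; set z := _ * _ in z1.
  apply: le_trans mN; rewrite /u /g -mulrBr normcM normc_distC.
  apply: (@le_trans _ _ (normc (f (bprod c s z) - \sum_(k0 < m) coef f k0 * bprod c s z ^+ k0))).
    by rewrite ler_piMl// normc_bprod_le1.
  by have [] := HT m _ (rhoP t tI).
by apply: (le_trans (HK _ _ _)); rewrite ler_wpM2l//; exact: fL.
Qed.

Definition disc_ext f z : C := if normc z < 1 then f z else 0.

Lemma disc_ext_hol f : holo 1 f -> disc_ext f \in hol_pred.
Proof.
move=> hf; rewrite inE; split => z.
  rewrite unit_discE => z1; have [l dl] := hf z z1; apply: (@cdiff_derivable _ _ _ l).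
  apply: (@cdiff_near _ f _ _ _ (1 - normc z)) => //; first by rewrite subr_gt0.
  move=> w wz; rewrite /disc_ext ifT//.
  by have := le_normcD (w - z) z; rewrite subrK; lra.
by rewrite unit_discE => /negP /negbTE z1; rewrite /disc_ext z1.
Qed.

Lemma holP f : holo 1 f -> exists h : hol R, forall z, normc z < 1 -> h z = f z.
Proof. by move=> hf; exists (Hol (disc_ext_hol hf)) => z z1 /=; rewrite /disc_ext z1. Qed.

Lemma dirichletP f (K : R) : holo 1 f -> (forall n, wnorm f n <= K) ->
  exists d : dirichlet R, forall z, normc z < 1 -> d z = f z.
Proof.
move=> hf fK; have [h hE] := holP hf.
have hp : h \in dirichlet_pred.
  by apply/dirichlet_predP; exists K => n; rewrite (@wnorm_eq h f).
by exists (Dirichlet hp) => z /hE.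
Qed.

Lemma hol_eq (f g : hol R) : (forall z, normc z < 1 -> f z = g z) -> f = g.
Proof.
move=> fg; apply/val_inj/funext => z /=; have [z1|/negP z1] := boolP (normc z < 1); first exact: fg.
by rewrite !hol_out.
Qed.

End boundedness.

(** * Sufficiency: weighted compositions with Blaschke symbols *)

Section weighted_composition_operators.
Context {R : realType}.
Local Notation C := R[i].

Lemma bprod_comp (c d : C) s t : blaschke c s -> s != [::] -> blaschke d t ->
  exists d' t', blaschke d' t' /\
    forall z, normc z < 1 -> bprod d t (bprod c s z) = bprod d' t' z.
Proof.
move=> bs s0 [d1]; elim: t => [_|a t IH /in_disc_cons[a1 /IH[d' [t' [[d'1 tD'] E]]]]].
  by exists d, [::]; split=> // z _; rewrite !bprod_nil.
have [e [r [[e1 rD] _ E']]] := bfac_bprod_blaschke bs s0 a1.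
exists (e * d'), (r ++ t'); split.
  by split; [rewrite normcM e1 d'1 mulr1|exact: in_disc_cat].
by move=> z z1; rewrite bprod_cons E'// E// bprod_cat.
Qed.

Lemma bprod_neq_nil (phi : hol R) c s : (forall z, normc z < 1 -> phi z = bprod c s z) ->
  ~ constant_on_disc phi -> s != [::].
Proof.
move=> phiE ncst; apply/eqP => s0; apply: ncst; exists c => z; rewrite unit_discE => /phiE ->.
by rewrite s0 bprod_nil.
Qed.

Lemma weighted_composition_preserver (phi psi : hol R) (T : dirichlet R -> hol R) :
  finite_blaschke phi -> finite_blaschke psi -> ~ constant_on_disc phi ->
  weighted_composition phi psi T -> bounded_blaschke_preserver T.
Proof.
move=> /finite_blaschkeP[c [s [bs phiE]]] /finite_blaschkeP[c' [s' [bs' psiE]]] ncst TE.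
have s0 := bprod_neq_nil phiE ncst.
have {}TE (f : dirichlet R) z : normc z < 1 -> T f z = bprod c' s' z * f (bprod c s z).
  by move=> z1; rewrite TE ?unit_discE// psiE// phiE.
have phi1 z : normc z < 1 -> normc (bprod c s z) < 1 by exact: normc_bprod_lt1.
have [K K0 HK] := wcomp_bound bs bs' s0.
split.
- move=> f; have /dirichlet_predP[L HL] := dirichlet_holP f.
  apply/dirichlet_predP; exists (K * L).
  exact: (HK f _ L (hol_holo f) (TE f) HL).
- move=> a f g; apply: hol_eq => z z1.
  have -> : (a *: T f + T g) z = a * T f z + T g z by [].
  rewrite !TE//.
  have -> : (a *: f + g) (bprod c s z) = a * f (bprod c s z) + g (bprod c s z) by [].
  by rewrite mulrDr mulrCA.
(* [K] may be 0; dividing by [K + 1] is legitimate and makes the final inequality strict, since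
   [K < (K + 1) ^+ 2]. *)
- move=> f e e0; have K1 : 0 < K + 1 by lra.
  exists (e / (K + 1)); first by rewrite divr_gt0.
  move=> g gf; apply: (@dirichlet_norm_ltP _ _ _ (K * (e / (K + 1)) ^+ 2)) => //.
    rewrite expr_div_n mulrCA gtr_pMr ?exprn_gt0//.
    rewrite ltr_pdivrMr ?exprn_gt0// mul1r; nra.
  apply: (HK (g - f : dirichlet R)); first exact: hol_holo.
    move=> z z1; have -> : (T g - T f) z = T g z - T f z by [].
    have -> : (g - f) (bprod c s z) = g (bprod c s z) - f (bprod c s z) by [].
    by rewrite !TE// mulrBr.
  by move=> n; apply: wnorm_lt gf; rewrite divr_gt0.
move=> f /finite_blaschkeP[d [t [bt fE]]].
have [d' [t' [[d'1 tD'] E]]] := bprod_comp bs s0 bt.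
apply/finite_blaschkeP; exists (c' * d'), (s' ++ t'); split.
  by split; [rewrite normcM bs'.1 d'1 mulr1|apply: in_disc_cat => //; exact: bs'.2].
by move=> z z1; rewrite TE// fE ?phi1// E// bprod_cat.
Qed.

End weighted_composition_operators.

(** * Blaschke products as elements of the space, and evaluation at points *)

Section evaluation.
Context {R : realType}.
Local Notation C := R[i].

Lemma wnorm_cst1 n : wnorm (fun=> 1 : C) n <= 1.
Proof.
have cE k : coef (fun=> 1 : C) k = (0 == k)%N%:R.
  have <- : coef (fun z : C => z ^+ 0) k = (0 == k)%N%:R by rewrite coef_power.
  by apply: coef_eq => z _; rewrite expr0.
rewrite /wnorm; case: n => [|n]; first by rewrite big_ord0.
rewrite big_ord_recl cE normc1 expr1n mulr1 mulr0 addr0 big1 ?addr0// => k _.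
by rewrite cE normc0 expr0n mulr0.
Qed.

(** The product is the image of the constant 1 under the weighted composition with [phi] the
    identity, so [wcomp_bound] bounds its norm. *)
Lemma bprod_dirichlet (c : C) s : blaschke c s ->
  exists d : dirichlet R, forall z, normc z < 1 -> d z = bprod c s z.
Proof.
move=> bs; have [K K0 HK] := wcomp_bound (blaschke_power 1) bs isT.
apply: (dirichletP (K := K * 1)); first exact: bprod_holo1 bs.2.
apply: (HK (fun=> 1)) wnorm_cst1 => [z _|z _]; last by rewrite mulr1.
by exists 0; exact: cdiff_cst.
Qed.

Lemma bprod_nseq0 n z : bprod ((-1) ^+ n) (nseq n 0) z = z ^+ n :> C.
Proof.
have E : \prod_(a <- nseq n 0) bfac a z = (- z) ^+ n :> C.
  elim: n => [|n IH]; first by rewrite big_nil expr0.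
  by rewrite big_cons IH exprS /bfac conjc0 mul0r subr0 divr1 sub0r.
by rewrite /bprod E -exprMn mulN1r opprK.
Qed.

Lemma normc_coef_le (g : C -> C) (d : R) k : 0 <= d -> (forall n, wnorm g n <= d ^+ 2) ->
  normc (coef g k) <= d.
Proof.
move=> d0 H; rewrite -(@ler_pXn2r _ 2) ?nnegrE ?normc_ge0//.
apply: le_trans (H k.+1); rewrite wnormS -expr2.
have : 0 <= wnorm g k by apply: sumr_ge0 => i _; rewrite mulr_ge0 ?weight_ge0 ?sqr_ge0.
have : 0 <= kappa * k%:R * normc (coef g k) ^+ 2.
  rewrite -mulrA; apply: mulr_ge0; first exact: ltW kappa_gt0.
  by apply: mulr_ge0 => //; exact: sqr_ge0.
by rewrite mulrDl mul1r; lra.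
Qed.

(** Each coefficient is at most [d], and the geometric series does the rest; crude, but it makes
    evaluation continuous at each point of the disc. *)
Lemma normc_eval_le (g : C -> C) (d : R) z : 0 <= d -> holo 1 g -> (forall n, wnorm g n <= d ^+ 2) ->
  normc z < 1 -> normc (g z) <= d / (1 - normc z).
Proof.
move=> d0 hg H z1; apply/ler_addgt0Pr => e e0.
have zz : 0 <= normc z < 1 by rewrite normc_ge0.
have [M [q [M0 q01 HT]]] := taylor_uniform (lexx 1) hg zz.
have [n /(_ n (leqnn n)) Mq] := geo_small M q01 e0.
have [{}HT _] := HT n z (lexx _).
have : normc (\sum_(k < n) coef g k * z ^+ k) <= d / (1 - normc z).
  apply: (le_trans (normc_sum _ _ _)).
  apply: (@le_trans _ _ (\sum_(k < n) d * normc z ^+ k)).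
    by apply: ler_sum => k _; rewrite normcM normcX ler_wpM2r ?exprn_ge0 ?normc_ge0//;
      exact: (normc_coef_le _ d0 H).
  rewrite -mulr_sumr ler_wpM2l// -[leRHS]div1r ler_pdivlMr ?subr_gt0//.
  rewrite mulrC; have := subrX1 (normc z) n.
  have : 0 <= normc z ^+ n by rewrite exprn_ge0.
  by nra.
have := le_normcD (g z - \sum_(k < n) coef g k * z ^+ k) (\sum_(k < n) coef g k * z ^+ k).
rewrite subrK; lra.
Qed.

(* The Taylor partial sums of [f] converge to [f] in norm: the tails of the convergent
   series of [wnorm f] are small. *)
Lemma partial_sum_cvg (f : dirichlet R) (p : nat -> dirichlet R) :
  (forall n z, normc z < 1 -> p n z = \sum_(k < n) coef f k * z ^+ k) ->
  forall d : R, 0 < d -> exists N : nat, forall n, (N <= n)%N ->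
    (dirichlet_norm (p n - f)%R < d%:E)%E.
Proof.
move=> pE d d0; have /dirichlet_predP[K HK] := dirichlet_holP f.
pose A := [set wnorm f n | n in [set: nat]].
have supA : has_sup A by split; [exists (wnorm f 0); exists 0%N|exists K => _ [n _ <-]].
have d2 : 0 < d ^+ 2 / 2 by rewrite divr_gt0// exprn_gt0.
have [_ [N _ <-] HN] := sup_adherent d2 supA.
have mono i j : (i <= j)%N -> wnorm f i <= wnorm f j.
  move=> ij; rewrite -(subnK ij); elim: (j - i)%N => [|k IH]; first by rewrite add0n.
  rewrite addSn wnormS; apply: (le_trans IH); rewrite lerDl mulr_ge0 ?weight_ge0//.
  by apply: mulr_ge0; exact: normc_ge0.
exists N => n Nn; apply: (@dirichlet_norm_ltP _ _ _ (d ^+ 2 / 2)) => //; first lra.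
have cE k : coef (p n - f : dirichlet R) k = if (k < n)%N then 0 else - coef f k.
  transitivity (coef (fun z => (-1) * f z + \sum_(k < n) coef f k * z ^+ k) k).
    apply: coef_eq => z zE; have z1 : normc z < 1 by rewrite zE invf_lt1// ltr1n.
    by rewrite -pE// mulN1r addrC.
  rewrite (coef_lin _ _ (lexx 1) (hol_holo f)); last first.
    move=> z z1; exists (\sum_(k < n) coef f k * (k%:R * z ^+ k.-1)).
    by apply: cdiff_sum => i; apply: cdiffZ; exact: cdiffX.
  by rewrite coef_polynomial; case: ifP => _; rewrite mulN1r ?addNr ?addr0.
move=> m; have [mn|nm] := leqP m n.
  rewrite /wnorm big1 ?ltW// => k _.
  by rewrite cE (leq_trans (ltn_ord k) mn) normc0 expr0n mulr0.
have : wnorm (p n - f : dirichlet R) m <= wnorm f m - wnorm f n.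
  rewrite -(subnK (ltnW nm)); elim: (m - n)%N => [|k IH].
    rewrite add0n subrr /wnorm big1// => k _.
    by rewrite cE (ltn_ord k) normc0 expr0n mulr0.
  have E : coef (p n - f : dirichlet R) (k + n) = - coef f (k + n).
    by rewrite cE ltnNge leq_addl.
  by rewrite addSn !wnormS E normcN; lra.
have : wnorm f m <= sup A by apply: sup_upper_bound => //; exists m.
by have := mono N n Nn; lra.
Qed.

End evaluation.

(** * Blaschke-preserving operators *)

Section boundary_values.
Context {R : realType}.
Local Notation C := R[i].

Lemma normc_boundary_le (f : C -> C) e (K : R) : ceps f e -> normc e = 1 ->
  (forall z, normc z < 1 -> normc (f z) <= K) -> normc (f e) <= K.
Proof.
move=> cf e1 H; apply/ler_addgt0Pr => d d0; have [r r0 hr] := cf d d0.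
pose x := Num.min (r / 2) 2^-1.
have x0 : 0 < x by rewrite lt_min divr_gt0 ?invr_gt0 ?ltr0n.
have x1 : x <= 2^-1 by rewrite ge_min lexx orbT.
have xr : x <= r / 2 by rewrite ge_min lexx.
pose w := e - x%:C * e.
have wE : w = (1 - x)%:C * e by rewrite /w rmorphB rmorph1 mulrBl mul1r.
have w1 : normc w < 1.
  rewrite wE normcM e1 mulr1 normcC ger0_norm; last lra.
  lra.
have we : normc (w - e) < r.
  by rewrite /w addrC addKr normcN normcM e1 mulr1 normcC gtr0_norm//; lra.
have := hr w we; have := H w w1; have := lerB_normc (f e) (f w); rewrite normc_distC.
lra.
Qed.

(** Holomorphy past the closed disc makes radius 1 admissible in Cauchy's formula. *)
Lemma eq0_circle (f : C -> C) r0 : 1 < r0 -> holo r0 f ->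
  (forall z, normc z = 1 -> f z = 0) -> forall z, normc z < 1 -> f z = 0.
Proof.
move=> r01 hf f0 z z1; rewrite (cauchy_formula (r := 1) hf) ?z1//.
rewrite -[RHS]avg_cst; apply: eq_avg => t.
by rewrite f0 ?mul0r// normc_circr.
Qed.

(* First-order optimality of [v] among the [v - a u + a^* w], tested at [a = - (v^* u - v w^* )^* / 8]. *)
Lemma unimodular_mid (u v w : C) : normc u = 1 -> normc v = 1 -> normc w = 1 ->
  (forall a : C, normc a <= 2^-1 ->
     normc (a * u - v - a^*%C * w) <= 1 + 4 * normc a ^+ 2) -> u * w = v ^+ 2.
Proof.
move=> u1 v1 w1 H.
have vJ : v * v^*%C = 1 by rewrite normcJE v1 expr1n.
have wJ : w * w^*%C = 1 by rewrite normcJE w1 expr1n.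
pose D := v^*%C * u - v * w^*%C.
suff D0 : D = 0.
  transitivity ((v * v^*%C) * u * w); first by rewrite vJ mul1r.
  transitivity (v * w * D + v ^+ 2 * (w * w^*%C)); first by rewrite /D; ring.
  by rewrite D0 wJ mulr0 add0r mulr1.
pose a := - ((8^-1)%:C * D^*%C).
have aD : normc a = normc D / 8.
  by rewrite normcN normcM normc_conj normcC ger0_norm ?invr_ge0// mulrC.
have D2 : normc D <= 2.
  have := le_normcD (v^*%C * u) (- (v * w^*%C)).
  rewrite normcN !normcM !normc_conj u1 v1 w1; lra.
have /H h : normc a <= 2^-1 by rewrite aD; lra.
have E : normc (a * u - v - a^*%C * w) ^+ 2 =
   normc v ^+ 2 - 2 * complex.Re (a * D) + normc (a * u - a^*%C * w) ^+ 2.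
  rewrite !sqr_normc /D; case: (a) (u) (v) (w) => [a1 a2] [x1 x2] [y1 y2] [t1 t2] /=.
  ring.
have aDE : complex.Re (a * D) = - (normc D ^+ 2 / 8).
  by rewrite /a sqr_normc; case: (D) => x y /=; field.
have h2 : normc (a * u - v - a^*%C * w) ^+ 2 <= (1 + 4 * normc a ^+ 2) ^+ 2.
  by rewrite ler_pXn2r ?nnegrE ?normc_ge0// addr_ge0// mulr_ge0// sqr_ge0.
rewrite E aDE aD v1 expr1n in h2.
have s0 := sqr_ge0 (normc (a * u - a^*%C * w)).
have DD : normc D ^+ 2 <= 4.
  have -> : (4 : R) = 2 ^+ 2 by ring.
  by rewrite ler_pXn2r ?nnegrE ?normc_ge0.
apply/eqP; rewrite -normc_eq0 -[normc D == 0](@expf_eq0 _ _ 2) eq_le sqr_ge0 andbT.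
move: h2 s0 DD (sqr_ge0 (normc D)); rewrite expr_div_n.
set X := normc D ^+ 2; set Y := normc _ ^+ 2; clearbody X Y => h2 Y0 X4 X0.
have : X * X <= 4 * X by rewrite ler_wpM2r.
(* With [X = |D|^2 <= 4] the hypothesis gives [X / 4 <= X / 8 + X * X / 256], and the right-hand
   side is at most [X / 8 + X / 64]; so [X] is 0. *)
have : (1 + 4 * (X / 8 ^+ 2)) ^+ 2 = 1 + X / 8 + X * X / 256 by field.
lra.
Qed.

End boundary_values.

(** * Images of the powers of z under a preserver *)

Section preserver.
Context {R : realType}.
Local Notation C := R[i].
Variable T : dirichlet R -> hol R.
Hypothesis PT : bounded_blaschke_preserver T.

Let linT : linear T. Proof. by case: PT. Qed.
Let contT : dirichlet_continuous T. Proof. by case: PT. Qed.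
Let Tb (f : dirichlet R) : finite_blaschke f -> finite_blaschke (T f).
Proof. by case: PT => _ _ _; exact. Qed.

HB.instance Definition _ := GRing.isLinear.Build C (dirichlet R) (hol R) _ T linT.

Let TD (f g : dirichlet R) z : T (f + g) z = T f z + T g z.
Proof. by rewrite linearD. Qed.

Let TB (f g : dirichlet R) z : T (f - g) z = T f z - T g z.
Proof. by rewrite linearB. Qed.

Let TZ a (f : dirichlet R) z : T (a *: f) z = a * T f z.
Proof. by rewrite linearZ. Qed.

Lemma preserver_sum n (a : nat -> C) (X : nat -> dirichlet R) z :
  T (\sum_(k < n) a k *: X k) z = \sum_(k < n) a k * T (X k) z.
Proof.
elim: n => [|n IH]; first by rewrite !big_ord0 linear0.
by rewrite !big_ord_recr /= TD TZ IH.
Qed.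

Let T_le1 (f : dirichlet R) c s : blaschke c s -> (forall z, normc z < 1 -> f z = bprod c s z) ->
  forall z, normc z < 1 -> normc (T f z) <= 1.
Proof.
move=> bs fE z z1.
have /Tb/finite_blaschkeP[d [t [bt ->//]]] : finite_blaschke f.
  by apply/finite_blaschkeP; exists c, s.
exact: normc_bprod_le1.
Qed.

(** Continuity of [T] in norm is combined with continuity of evaluation at [z]; the tolerance
    [e * (1 - normc z)] absorbs the loss in [normc_eval_le]. *)
Lemma preserver_cvg (f : dirichlet R) (g : nat -> dirichlet R) z : normc z < 1 ->
  (forall d : R, 0 < d -> exists N : nat, forall n, (N <= n)%N ->
    (dirichlet_norm (g n - f)%R < d%:E)%E) ->
  forall e : R, 0 < e -> exists N : nat, forall n, (N <= n)%N -> normc (T (g n) z - T f z) <= e.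
Proof.
move=> z1 gf e e0; have z1' : 0 < 1 - normc z by rewrite subr_gt0.
have e1 : 0 < e * (1 - normc z) by rewrite mulr_gt0.
have [d d0 Hd] := contT f e1; have [N HN] := gf d d0; exists N => n /HN /Hd lt_e.
have -> : T (g n) z - T f z = (T (g n) - T f) z by [].
have := normc_eval_le (ltW e1) (hol_holo (T (g n) - T f)) (fun m => wnorm_lt m e1 lt_e) z1.
by rewrite mulfK ?gt_eqF.
Qed.

Lemma exists_power_bfac (a : C) : normc a < 1 -> exists b : nat -> dirichlet R,
  forall n z, normc z < 1 -> b n z = z ^+ n * bfac a z.
Proof.
move=> a1; suff /choice[b bE] : forall n, exists b : dirichlet R,
  forall z, normc z < 1 -> b z = z ^+ n * bfac a z by exists b.
move=> n.
have bn : blaschke ((-1) ^+ n) (a :: nseq n 0).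
  by split; [exact: (blaschke_power n).1|apply/in_disc_cons; split=> //; exact: (blaschke_power n).2].
have [b bE] := bprod_dirichlet bn; exists b => z z1.
by rewrite bE// bprod_cons bprod_nseq0 mulrC.
Qed.

Lemma exists_powers : exists X : nat -> dirichlet R,
  forall n z, normc z < 1 -> X n z = bprod ((-1) ^+ n) (nseq n 0) z.
Proof.
suff /choice[X XE] : forall n, exists b : dirichlet R, forall z, normc z < 1 ->
  b z = bprod ((-1) ^+ n) (nseq n 0) z by exists X.
move=> n.
exact/bprod_dirichlet/blaschke_power.
Qed.

Variables (X : nat -> dirichlet R).
Hypothesis XE : forall n z, normc z < 1 -> X n z = z ^+ n.

Let TX_le1 n z : normc z < 1 -> normc (T (X n) z) <= 1.
Proof.
move=> z1; apply: (T_le1 (blaschke_power n)) => // w w1.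
by rewrite XE// bprod_nseq0.
Qed.

Lemma preserver_first_order m (a : C) z : normc a <= 2^-1 -> normc z < 1 ->
  normc (a * T (X m) z - T (X m.+1) z - a^*%C * T (X m.+2) z) <= 1 + 4 * normc a ^+ 2.
Proof.
move=> ah z1; have a1 : normc a < 1 by lra.
have [b bE] := exists_power_bfac a1.
have Tb1 n : normc (T (b n) z) <= 1.
  apply: (@T_le1 _ ((-1) ^+ n) (a :: nseq n 0)) => //.
    by split; [exact: (blaschke_power n).1|apply/in_disc_cons; split=> //; exact: (blaschke_power n).2].
  by move=> w w1; rewrite bE// bprod_cons bprod_nseq0 mulrC.
have a2 : normc a ^+ 2 < 1 by rewrite expr_lt1.
have aa : 1 - a * a^*%C = (1 - normc a ^+ 2)%:C by rewrite normcJE rmorphB rmorph1.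
have aa0 : 1 - a * a^*%C != 0.
  by rewrite -normc_gt0 aa normcC gtr0_norm subr_gt0.
pose k := (1 - a * a^*%C)^-1.
have bm : b m = a *: X m - X m.+1 - a^*%C *: X m.+2 +
   k *: ((a * a^*%C) *: (X m.+1 - a^*%C *: b m.+1) - (a^*%C ^+ 2) *: (X m.+3 - a^*%C *: b m.+3)).
  apply/val_inj/hol_eq => w w1; rewrite [LHS](bE m w w1).
  transitivity (a * X m w - X m.+1 w - a^*%C * X m.+2 w +
   k * ((a * a^*%C) * (X m.+1 w - a^*%C * b m.+1 w) - (a^*%C ^+ 2) * (X m.+3 w - a^*%C * b m.+3 w))); last by [].
  rewrite !XE// !bE// /bfac /k !exprS.
  have d0 : 1 - a^*%C * w != 0 by rewrite bfac_den_neq0// disc_mul_lt1// ltW.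
  by field; rewrite d0 aa0.
have TbE : T (b m) z = a * T (X m) z - T (X m.+1) z - a^*%C * T (X m.+2) z +
   k * ((a * a^*%C) * (T (X m.+1) z - a^*%C * T (b m.+1) z) -
        (a^*%C ^+ 2) * (T (X m.+3) z - a^*%C * T (b m.+3) z)).
  by rewrite bm !(TB, TD, TZ).
set V := a * _ - _ - _ in TbE *; set W := _ - _ in TbE.
have -> : V = T (b m) z - k * W by rewrite TbE addrK.
apply: (le_trans (le_normcD _ _)); rewrite normcN normcM; apply: lerD => //.
have kE : normc k = (1 - normc a ^+ 2)^-1.
  by rewrite /k normcV aa normcC gtr0_norm// subr_gt0.
have half n j : normc (T (X n) z - a^*%C * T (b j) z) <= 1 + normc a.
  apply: (le_trans (le_normcD _ _)); rewrite normcN normcM normc_conj; apply: lerD; first exact: TX_le1.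
  by rewrite ler_piMr// normc_ge0.
have WE : normc W <= 2 * (normc a ^+ 2 * (1 + normc a)).
  rewrite /W mulr2n mulrDl mul1r; apply: (le_trans (le_normcD _ _)); rewrite normcN.
  apply: lerD; rewrite normcM ?normcX ?normcM normc_conj -?expr2 ler_wpM2l ?sqr_ge0//.
(* What remains is [2 |a|^2 / (1 - |a|) <= 4 |a|^2], which uses [normc a <= 2^-1]. *)
rewrite kE mulrC ler_pdivrMr ?subr_gt0//; apply: (le_trans WE).
have -> : 1 - normc a ^+ 2 = (1 - normc a) * (1 + normc a) by ring.
have : 0 <= normc a ^+ 2 * (1 + normc a) * (1 - 2 * normc a).
  apply: mulr_ge0; last by lra.
  by apply: mulr_ge0; [exact: sqr_ge0|rewrite addr_ge0// normc_ge0].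
lra.
Qed.

Variables (c : nat -> C) (s : nat -> seq C).
Hypothesis bs : forall n, blaschke (c n) (s n).
Hypothesis TXE : forall n z, normc z < 1 -> T (X n) z = bprod (c n) (s n) z.
Local Notation h n z := (bprod (c n) (s n) z).

Lemma preserver_mid m z : normc z < 1 -> h m z * h m.+2 z = h m.+1 z ^+ 2.
Proof.
move=> z1; apply/eqP; rewrite -subr_eq0; apply/eqP.
have [r0 r01 hr0] := bprod_radius (bs m).2.
have [r1 r11 hr1] := bprod_radius (bs m.+1).2.
have [r2 r21 hr2] := bprod_radius (bs m.+2).2.
pose r := Num.min (Num.min r0 r1) r2.
have r_gt1 : 1 < r by rewrite !lt_min r01 r11 r21.
have rr0 : r <= r0 by rewrite !ge_min lexx.
have rr1 : r <= r1 by rewrite !ge_min lexx orbT.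
have rr2 : r <= r2 by rewrite !ge_min lexx !orbT.
apply: (@eq0_circle _ (fun z => h m z * h m.+2 z - h m.+1 z ^+ 2) r) => //.
  apply: holoB; last by apply: holoX; exact: holo_le (hr1 _).
  by apply: holoM; [exact: holo_le (hr0 _)|exact: holo_le (hr2 _)].
move=> e e1; apply/eqP; rewrite subr_eq0; apply/eqP.
apply: unimodular_mid; rewrite ?normc_bprod_circ// => a ah.
apply: (@normc_boundary_le _ (fun z => a * h m z - h m.+1 z - a^*%C * h m.+2 z)) => // [|w w1].
  have [l0 d0] : exists l, cdiff (bprod (c m) (s m)) e l by apply: hr0; rewrite e1.
  have [l1 d1] : exists l, cdiff (bprod (c m.+1) (s m.+1)) e l by apply: hr1; rewrite e1.
  have [l2 d2] : exists l, cdiff (bprod (c m.+2) (s m.+2)) e l by apply: hr2; rewrite e1.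
  move=> d dp; exact: (cdiff_cont (cdiffB (cdiffB (cdiffZ a d0) d1) (cdiffZ a^*%C d2)) dp).
by rewrite -!TXE//; exact: preserver_first_order.
Qed.

(** In the inductive step, [h_n] times the difference of the two sides is
    [h_0 h_(n+1)^2 - h_1 h_n h_(n+1)], which is 0 by the induction hypothesis; then [h_n], a
    Blaschke product, is cancelled. *)
Lemma preserver_ratio n z : normc z < 1 -> h 0 z * h n.+1 z = h 1 z * h n z.
Proof.
elim: n z => [|n IH] z z1; first by rewrite mulrC.
apply/eqP; rewrite -subr_eq0; apply/eqP.
apply: (bprod_mul_eq0 (bs n) (u := fun z => h 0 z * h n.+2 z - h 1 z * h n.+1 z)) => // [|w w1].
  by apply: holoB; apply: holoM; exact: bprod_holo1 (bs _).2.
transitivity (h 0 w * (h n w * h n.+2 w) - (h 1 w * h n w) * h n.+1 w); first by ring.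
by rewrite preserver_mid// -IH// expr2; ring.
Qed.

(** Iterating the ratio gives [h_0^n h_n = h_1^n h_0]. If [0 < |h_0| < |h_1|] at [z], then
    [|h_n| <= 1] yields [|h_0| <= (|h_0| / |h_1|)^n] for all [n], which is absurd. If [h_0] vanishes
    at [z], then [h_1^2 = h_0 h_2] does too. *)
Lemma preserver_h1_le z : normc z < 1 -> normc (h 1 z) <= normc (h 0 z).
Proof.
move=> z1; have [h0|h0] := eqVneq (h 0 z) 0.
  have := preserver_ratio 1 z1; rewrite h0 mul0r => /esym/eqP.
  by rewrite mulf_eq0 orbb => /eqP ->.
rewrite leNgt; apply/negP => lt01.
have h00 : 0 < normc (h 0 z) by rewrite normc_gt0.
have h10 : 0 < normc (h 1 z) by exact: lt_trans lt01.
pose q := normc (h 0 z) / normc (h 1 z).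
have q01 : 0 <= q < 1 by rewrite divr_ge0 ?normc_ge0// ltr_pdivrMr// mul1r.
have [n /(_ n (leqnn n))] := geo_small 1 q01 h00.
rewrite mul1r; apply/negP; rewrite -leNgt.
have E : h 0 z ^+ n * h n z = h 1 z ^+ n * h 0 z.
  elim: n => [|n IH]; first by rewrite !expr0 mul1r.
  rewrite exprSr -mulrA preserver_ratio// exprS -mulrA -IH; ring.
rewrite /q expr_div_n ler_pdivlMr ?exprn_gt0//.
have E' : normc (h 0 z) ^+ n * normc (h n z) = normc (h 1 z) ^+ n * normc (h 0 z).
  by rewrite -!normcX -!normcM E.
rewrite mulrC -E' ler_piMr ?exprn_ge0 ?normc_ge0//.
exact: normc_bprod_le1.
Qed.

Lemma preserver_powers : exists d t, blaschke d t /\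
  forall n z, normc z < 1 -> T (X n) z = h 0 z * bprod d t z ^+ n.
Proof.
have [d [t [bt E]]] := bprod_divides (bs 0) (bs 1) preserver_h1_le.
exists d, t; split => // n z z1; rewrite TXE//.
elim: n z z1 => [|n IH] z z1; first by rewrite expr0 mulr1.
rewrite exprS mulrCA -IH//; apply/eqP; rewrite -subr_eq0; apply/eqP.
apply: (bprod_mul_eq0 (bs 0) (u := fun z => h n.+1 z - bprod d t z * h n z)) => // [|w w1].
  apply: holoB; first exact: bprod_holo1 (bs _).2.
  by apply: holoM; [exact: bprod_holo1 bt.2|exact: bprod_holo1 (bs _).2].
by rewrite mulrBr preserver_ratio// E; ring.
Qed.

End preserver.

(** * Exclusion of a constant phi, and density of the polynomials *)

Section necessity.
Context {R : realType}.
Local Notation C := R[i].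

Lemma harmonic_unbounded (B : R) :
  exists N, forall n, (N <= n)%N -> B < \sum_(k < n) (k%:R : R)^-1.
Proof.
(* The term of index 0 is [0^-1 = 0], so [S n.+1] is the [n]-th harmonic number. *)
pose S n : R := \sum_(k < n) (k%:R : R)^-1.
have mono i j : (i <= j)%N -> S i <= S j.
  move=> ij; rewrite -(subnK ij); elim: (j - i)%N => [|k IH]; first by rewrite add0n.
  by rewrite addSn /S big_ord_recr /=; apply: (le_trans IH); rewrite lerDl invr_ge0.
suff [N BN] : exists N, B < S N by exists N => n /mono; exact: lt_le_trans.
apply: contrapT => /forallNP H; apply: (@dvg_harmonic R).
have SE n : series (@harmonic R) n = S n.+1.
  rewrite /S big_ord_recl invr0 add0r /series /= big_mkord.
  by apply: eq_bigr.
apply: nondecreasing_is_cvgn.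
  by move=> i j ij; rewrite !SE; exact: mono.
by exists B => _ [n _ <-]; rewrite SE leNgt; apply/negP; exact: H.
Qed.

Lemma bprod1_id z : bprod (-1) [:: 0] z = z :> C.
Proof. by have := bprod_nseq0 1 z; rewrite !expr1. Qed.

(** The case of [wnorm_poly_bound] where [phi] is the identity and [psi] is 1. A constant [K] in
    front does not affect convergence to 0. *)
Lemma wnorm_poly : exists2 K : R, 0 <= K & forall (f : C -> C) (a : nat -> C) n m,
  (forall z, normc z < 1 -> f z = \sum_(k < n) a k * z ^+ k) ->
  wnorm f m <= K * \sum_(k < n) (1 + kappa * k%:R) * normc (a k) ^+ 2.
Proof.
have [K K0 H] := wnorm_poly_bound (@blaschke_power R 1) (@blaschke_power R 0) isT.
exists K => // f a n m fE; apply: le_trans (H a n m).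
rewrite (wnorm_eq (g := fun z => bprod 1 [::] z * \sum_(k < n) a k * bprod (-1) [:: 0] z ^+ k))//.
by move=> z z1; rewrite fE// bprod_nil mul1r bprod1_id.
Qed.

Lemma blaschke_neq0 (c : C) s : blaschke c s -> ~ (forall z, normc z < 1 -> bprod c s z = 0).
Proof.
move=> bs H; have n0 : normc (0 : C) < 1 by rewrite normc0.
have : (fun=> 1 : C) (0 : C) = 0.
  apply: (bprod_mul_eq0 bs (u := fun=> 1)) n0 => [z _|z z1]; last by rewrite H// mul0r.
  by exists 0; exact: cdiff_cst.
by move/eqP; rewrite oner_eq0.
Qed.

Lemma bprod_nonconstant (phi : hol R) (d : C) t : blaschke d t -> t != [::] ->
  (forall z, normc z < 1 -> phi z = bprod d t z) -> ~ constant_on_disc phi.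
Proof.
case: t => [//|a t] bt _ phiE [e eE]; apply: (blaschke_neq0 bt) => z z1.
have a1 : normc a < 1 by apply: bt.2; exact: mem_head.
rewrite -phiE// eE ?unit_discE// -(eE a) ?unit_discE// phiE//.
by apply/eqP; rewrite (bprod_eq0 bt)// mem_head.
Qed.

Variable T : dirichlet R -> hol R.
Hypothesis PT : bounded_blaschke_preserver T.
Variable X : nat -> dirichlet R.
Hypothesis XE : forall n z, normc z < 1 -> X n z = z ^+ n.

Let sumXE n (a : nat -> C) z : normc z < 1 ->
  (\sum_(k < n) a k *: X k) z = \sum_(k < n) a k * z ^+ k.
Proof.
move=> z1; elim: n => [|n IH]; first by rewrite !big_ord0.
rewrite !big_ord_recr -XE// -IH; by [].
Qed.

(* With [S] the partial sums of the harmonic series, the polynomials [S^-1 sum d^*^k z^k / k] tend to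
   0 in the Dirichlet space, but [T] would map all of them to [psi]. *)
Lemma preserver_constant_ratio (d : C) (psi : C -> C) : normc d = 1 ->
  (forall n z, normc z < 1 -> T (X n) z = psi z * d ^+ n) ->
  forall z, normc z < 1 -> psi z = 0.
Proof.
move=> d1 TX z z1.
have dJ : d^*%C * d = 1 by rewrite mulrC normcJE d1 expr1n.
pose S n : R := \sum_(k < n) (k%:R : R)^-1.
pose a n k : C := ((S n)^-1 * k%:R^-1)%:C * d^*%C ^+ k.
pose p n : dirichlet R := \sum_(k < n) a n k *: X k.
have [K K0 HK] := wnorm_poly.
have p0 e : 0 < e -> exists N : nat, forall n, (N <= n)%N -> (dirichlet_norm (p n - 0)%R < e%:E)%E.
  move=> e0; have kp : 0 < kappa :> R := kappa_gt0.
  have [N HN] := harmonic_unbounded (K * (1 + kappa) / e ^+ 2).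
  exists N => n /HN; rewrite -/(S n) => Sn.
  have L0 : 0 <= K * (1 + kappa) by rewrite mulr_ge0// addr_ge0// ltW.
  have S0 : 0 < S n by apply: le_lt_trans Sn; rewrite divr_ge0// sqr_ge0.
  apply: (@dirichlet_norm_ltP _ _ _ (K * (1 + kappa) / S n)) => //.
    by rewrite ltr_pdivrMr// (mulrC (e ^+ 2)) -ltr_pdivrMr ?exprn_gt0.
  move=> m; rewrite subr0; apply: (le_trans (HK _ (a n) n m (sumXE n (a n)))).
  rewrite -mulrA ler_wpM2l//.
  (* Since [(1 + kappa k) / k^2 <= (1 + kappa) / k] for [k >= 1], the squared norm is at most
     [K (1 + kappa) / S n]. The term of index 0 is 0 on both sides. *)
  apply: (@le_trans _ _ (\sum_(k < n) (1 + kappa) / S n ^+ 2 * k%:R^-1)); last first.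
    by rewrite -mulr_sumr -/(S n) expr2 invfM mulrA mulfVK// gt_eqF.
  apply: ler_sum => k _.
  rewrite /a normcM normcX normc_conj d1 expr1n mulr1 normcC ger0_norm; last first.
    by rewrite mulr_ge0 ?invr_ge0// ltW.
  rewrite exprMn exprVn mulrCA -mulrA [leRHS]mulrCA ler_wpM2l ?invr_ge0 ?sqr_ge0//.
  case: (k : nat) => [|j]; first by rewrite invr0 expr0n !mulr0.
  rewrite exprVn expr2 invfM mulrA ler_wpM2r ?invr_ge0// ler_pdivrMr ?ltr0n//.
  have : (1 : R) <= j.+1%:R by rewrite ler1n.
  by move=> j1; rewrite mulrDl mul1r lerD2r.
apply: normc_small0 => e e0.
have [N HN] := preserver_cvg PT z1 p0 e0; have [M HM] := harmonic_unbounded 0.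
have S0 : 0 < S (maxn N M) by apply: HM; exact: leq_maxr.
have := HN _ (leq_maxl N M); rewrite /p (preserver_sum PT _ (a (maxn N M)) X z).
have -> : T 0 z = 0 by have := preserver_sum PT 0 (a 0%N) X z; rewrite !big_ord0.
rewrite subr0.
have -> : \sum_(k < maxn N M) a (maxn N M) k * T (X k) z = psi z; last by [].
transitivity (psi z * ((S (maxn N M))^-1 * S (maxn N M))%:C); last first.
  by rewrite mulVf ?gt_eqF// mulr1.
rewrite {2}/S mulr_sumr rmorph_sum mulr_sumr; apply: eq_bigr => k _.
rewrite TX// /a mulrCA; congr (_ * _).
by rewrite -mulrA -exprMn dJ expr1n mulr1.
Qed.

(** Both sides are limits of their values on the Taylor partial sums of [f]: the left one by
    continuity of [T] and of evaluation at [z], the right one because [bprod d t z] lies in the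
    disc. *)
Lemma preserver_weighted (d : C) (t : seq C) (psi : C -> C) : blaschke d t -> t != [::] ->
  (forall n z, normc z < 1 -> T (X n) z = psi z * bprod d t z ^+ n) ->
  forall (f : dirichlet R) z, normc z < 1 -> T f z = psi z * f (bprod d t z).
Proof.
move=> bt t0 TX f z z1.
pose p n : dirichlet R := \sum_(k < n) coef f k *: X k.
have pf := partial_sum_cvg (p := p) (fun n w w1 => sumXE n _ w1).
have phi1 := normc_bprod_lt1 bt t0 z1.
have pr : 0 <= normc (bprod d t z) < 1 by rewrite normc_ge0.
have [M [q [M0 q01 HT]]] := taylor_uniform (lexx 1) (hol_holo f) pr.
apply/eqP; rewrite -subr_eq0; apply/eqP; apply: (@normc_limit0 _ _ (1 + normc (psi z))) => e e0.
have [N HN] := preserver_cvg PT z1 pf e0; have [N' HN'] := geo_small M q01 e0.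
have := HN _ (leq_maxl N N'); have := HN' _ (leq_maxr N N').
have [+ _] := HT (maxn N N') _ (lexx _).
set n := maxn N N'; rewrite /p (preserver_sum PT n (coef f) X z).
have -> : \sum_(k < n) coef f k * T (X k) z = psi z * \sum_(k < n) coef f k * bprod d t z ^+ k.
  by rewrite mulr_sumr; apply: eq_bigr => k _; rewrite TX// mulrCA.
set A := \sum_(_ < _) _; set F := f _; set G := T f z; move: (M * q ^+ n) => E.
clearbody A F G n => h1 h2 h3.
have -> : G - psi z * F = - (psi z * A - G) - psi z * (F - A) by ring.
apply: (le_trans (le_normcD _ _)); rewrite !normcN normcM mulrDl mul1r lerD//.
by rewrite ler_wpM2l ?normc_ge0//; lra.
Qed.

End necessity.

(** * Every preserver is a weighted composition *)

Section characterization.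
Context {R : realType}.
Local Notation C := R[i].

Lemma preserver_weighted_composition (T : dirichlet R -> hol R) : bounded_blaschke_preserver T ->
  exists phi psi : hol R, [/\ finite_blaschke phi, finite_blaschke psi,
    ~ constant_on_disc phi & weighted_composition phi psi T].
Proof.
move=> PT; have [X XB] := @exists_powers R.
have XE n z : normc z < 1 -> X n z = z ^+ n by move=> z1; rewrite XB// bprod_nseq0.
have /choice[cs csP] : forall n, exists cs : C * seq C, blaschke cs.1 cs.2 /\
    forall z, normc z < 1 -> T (X n) z = bprod cs.1 cs.2 z.
  move=> n; case: (PT) => _ _ _ TB; have /TB/finite_blaschkeP[c [s [bs E]]] : finite_blaschke (X n).
    apply/finite_blaschkeP; exists ((-1) ^+ n), (nseq n 0); split; last exact: XB.
    exact: blaschke_power.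
  by exists (c, s).
have bs n : blaschke (cs n).1 (cs n).2 by have [] := csP n.
have [d [t [bt TX]]] := preserver_powers PT XE bs (fun n => (csP n).2).
(* Without zeros, [bprod d t] is the unimodular constant [d], and the image of 1 would vanish
   identically although it is a Blaschke product. *)
have t0 : t != [::].
  apply/eqP => t0; apply: (blaschke_neq0 (bs 0)).
  apply: (preserver_constant_ratio PT XE bt.1) => n z z1.
  by rewrite TX// t0 bprod_nil.
have [phi phiE] := holP (bprod_holo1 d bt.2).
have [psi psiE] := holP (bprod_holo1 (cs 0).1 (bs 0).2).
exists phi, psi; split.
- by apply/finite_blaschkeP; exists d, t.
- by apply/finite_blaschkeP; exists (cs 0).1, (cs 0).2.
- exact: (bprod_nonconstant bt t0 phiE).
move=> f z; rewrite unit_discE => z1; rewrite psiE// phiE//.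
exact: (preserver_weighted PT XE bt t0 TX).
Qed.

End characterization.

(** * The surjective case *)

Section surjective.
Context {R : realType}.
Local Notation C := R[i].

Lemma bfacK (a w : C) : normc a < 1 -> normc w < 1 -> bfac a (bfac a w) = w.
Proof.
move=> a1 w1.
have d0 : 1 - a^*%C * w != 0 by rewrite bfac_den_neq0// disc_mul_lt1// ltW.
have d1 : 1 - a^*%C * a != 0 by rewrite bfac_den_neq0// disc_mul_lt1// ltW.
rewrite /bfac; field; rewrite d0 /=.
by rewrite (_ : 1 - a^*%C * w - a^*%C * (a - w) = 1 - a^*%C * a)//; ring.
Qed.

Lemma circX (t : R) n : circ t ^+ n = circ (n%:R * t).
Proof.
elim: n => [|n IH]; first by rewrite expr0 mul0r circ0.
by rewrite exprS IH -circD -natr1 mulrDl mul1r addrC.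
Qed.

Lemma root_of_unity_neq1 n : (1 < n)%N -> exists2 w : C, normc w = 1 & w ^+ n = 1 /\ w != 1.
Proof.
move=> n1; have n0 : (0 : R) < n%:R by rewrite ltr0n ltnW.
exists (circ (2 * pi / n%:R)); first exact: normc_circ.
split; first by rewrite circX mulrC divfK ?circ2pi// gt_eqF.
have tp : 0 < 2 * pi / n%:R :> R by rewrite divr_gt0// twopi_gt0.
(* [n >= 2] puts the angle in the range from 0 to [pi], where cos is injective. *)
have tpi : 2 * pi / n%:R <= pi :> R.
  by rewrite ler_pdivrMr// mulrC ler_pM2l ?pi_gt0// (ler_nat _ 2).
apply/eqP => /(congr1 (@complex.Re R)) /= c1.
have : 2 * pi / n%:R = 0 :> R.
  by apply: (@cos_inj R); rewrite ?cos0// in_itv /= ?lexx ?pi_ge0// (ltW tp) tpi.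
by move/eqP; rewrite gt_eqF.
Qed.

(** Injectivity makes all zeros equal, so the product is [c b_a^n]. As [b_a] is an involution of the
    disc, for [n >= 2] and an [n]-th root of unity [w] other than 1 the images of [w / 2] and
    [1 / 2] under [b_a] are distinct points with the same value. *)
Lemma bprod_injective (c : C) s : blaschke c s -> s != [::] ->
  (forall z w, normc z < 1 -> normc w < 1 -> bprod c s z = bprod c s w -> z = w) ->
  exists a, s = [:: a].
Proof.
case: s => [//|a s] bs _ inj; exists a.
have a1 : normc a < 1 by apply: bs.2; exact: mem_head.
have all_a : all (pred1 a) (a :: s).
  apply/allP => b bin; apply/eqP; apply: inj => //; first exact: bs.2.
  transitivity (0 : C); last apply: esym; apply/eqP; rewrite (bprod_eq0 bs) ?mem_head//.
  exact: bs.2.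
have E z : bprod c (a :: s) z = c * bfac a z ^+ (size s).+1.
  rewrite /bprod; congr (_ * _); move/all_pred1P : all_a => /= [->].
  elim: (size s) => [|n IH]; first by rewrite big_seq1 expr1.
  by rewrite exprS -IH [LHS]big_cons.
case: s => [//|b s] in bs inj all_a E *.
have [w w1 [wn wne]] := @root_of_unity_neq1 (size (b :: s)).+1 isT.
have h0 : normc (2^-1 : C) < 1.
  by rewrite normcV (normcnat 2) invf_lt1// ltr1n.
have hw : normc (w * 2^-1) < 1 by rewrite normcM w1 mul1r.
have : bfac a (w * 2^-1) = bfac a 2^-1.
  by apply: inj; rewrite ?normc_bfac_lt1// !E !bfacK// exprMn wn mul1r.
move=> /(congr1 (bfac a)); rewrite !bfacK// => /eqP.
rewrite -subr_eq0 -[X in _ - X]mul1r -mulrBl mulf_eq0 subr_eq0 (negbTE wne) invr_eq0.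
by rewrite pnatr_eq0.
Qed.

(** The inverse operator is itself a weighted composition, with the inverse of [phi] and the
    constant [1 / psi]; its linearity and continuity are instances of the sufficiency part. *)
Lemma onto_invertible (phi psi : hol R) (T : dirichlet R -> hol R) :
  finite_blaschke phi -> finite_blaschke psi -> ~ constant_on_disc phi ->
  weighted_composition phi psi T -> range T = [set h : hol R | h \in dirichlet_pred] ->
  [/\ unimodular_constant psi, disc_automorphism phi & dirichlet_invertible T].
Proof.
move=> fphi fpsi ncst TE rT.
have [Tpred _ _ _] := weighted_composition_preserver fphi fpsi ncst TE.
have /finite_blaschkeP[c [s [bs phiE]]] := fphi.
have /finite_blaschkeP[c' [s' [bs' psiE]]] := fpsi.
have s0 := bprod_neq_nil phiE ncst.
have {}TE (f : dirichlet R) z : normc z < 1 -> T f z = bprod c' s' z * f (bprod c s z).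
  by move=> z1; rewrite TE ?unit_discE// psiE// phiE.
have onto (h : dirichlet R) : exists f, T f = h.
  have : range T h by rewrite rT; exact: dirichlet_holP.
  by case=> f _ fE; exists f.
have s'0 : s' = [::].
  have [u uE] := bprod_dirichlet (@blaschke_power R 0); have [f fE] := onto u.
  case: s' bs' {psiE} TE => [//|a s'] bs' TE.
  have a1 : normc a < 1 by apply: bs'.2; exact: mem_head.
  have : T f a = 0.
    rewrite TE// (_ : bprod c' (a :: s') a = 0) ?mul0r//.
    by apply/eqP; rewrite (bprod_eq0 bs')// mem_head.
  by rewrite fE uE// bprod_nil => /eqP; rewrite oner_eq0.
rewrite s'0 in bs' psiE TE; have c'0 : c' != 0 by rewrite -normc_gt0 bs'.1.
have [a sE] : exists a, s = [:: a].
  apply: (bprod_injective bs s0) => z w z1 w1 zw.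
  have [u uE] := bprod_dirichlet (@blaschke_power R 1); have [f fE] := onto u.
  by have := TE f z z1; rewrite zw (bprod_nil c' z) -(bprod_nil c' w) -TE// fE !uE// !bprod1_id => ->.
have a1 : normc a < 1 by apply: bs.2; rewrite sE mem_head.
have cn0 : c != 0 by rewrite -normc_gt0 bs.1.
have phiE' z : bprod c s z = c * bfac a z by rewrite sE /bprod big_seq1.
(* This is [z / c] as a Blaschke product, the sign cancelling that of the factor [- z]. Followed by
   [bfac a] it inverts [c * bfac a]. *)
have bi : blaschke (- c^-1) [:: 0].
  split; first by rewrite normcN normcV bs.1 invr1.
  by move=> x; rewrite inE => /eqP ->; rewrite normc0.
have biE z : bprod (- c^-1) [:: 0] z = z / c.
  by have := bprod1_id z; rewrite /bprod big_seq1 mulN1r mulNr -mulrN => ->; rewrite mulrC.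
have [d [t [bt t0 tE]]] := bfac_bprod_blaschke bi isT a1.
have phi1 z : normc z < 1 -> normc (bprod c s z) < 1 by exact: normc_bprod_lt1.
have g1 z : normc z < 1 -> normc (bprod d t z) < 1 by exact: normc_bprod_lt1.
have gphi z : normc z < 1 -> bprod d t (bprod c s z) = z.
  by move=> z1; rewrite -tE ?phi1// biE phiE' mulrAC mulfV// mul1r bfacK.
have phig z : normc z < 1 -> bprod c s (bprod d t z) = z.
  move=> z1; rewrite -tE// phiE' biE bfacK//; first by rewrite mulrC divfK.
  by rewrite normcM normcV bs.1 invr1 mulr1.
have [g gE] := holP (bprod_holo1 d bt.2).
split.
- exists c'; first by apply/norm_normc; rewrite bs'.1.
  by move=> z; rewrite unit_discE => z1; rewrite psiE// bprod_nil.
- exists g; split=> z; rewrite unit_discE => z1; rewrite ?unit_discE ?gE ?phiE ?gE ?gphi ?phig ?phi1 ?g1//.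
have b'V : blaschke c'^-1 [::] by split=> //; rewrite normcV bs'.1 invr1.
have [K K0 HK] := wcomp_bound bt b'V t0.
have /choice[S SE] : forall f : dirichlet R, exists h : dirichlet R,
    forall z, normc z < 1 -> h z = c'^-1 * f (bprod d t z).
  move=> f; have /dirichlet_predP[L HL] := dirichlet_holP f.
  apply: (dirichletP (K := K * L)).
    move=> z z1; have [l dl] := bprod_holo1 d bt.2 z1.
    have [m dm] := hol_holo f (g1 z z1).
    by eexists; exact: (cdiffZ _ (cdiff_comp dl dm)).
  apply: (HK f _ L (hol_holo f)) HL => z z1.
  by rewrite bprod_nil.
have [q qE] := holP (bprod_holo1 c'^-1 b'V.2).
have wS : weighted_composition g q (fun f => S f : hol R).
  by move=> f z; rewrite unit_discE => z1; rewrite SE// gE// qE// bprod_nil.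
have fg : finite_blaschke g by apply/finite_blaschkeP; exists d, t.
have fq : finite_blaschke q by apply/finite_blaschkeP; exists c'^-1, [::].
have [_ linS contS _] := weighted_composition_preserver fg fq (bprod_nonconstant bt t0 gE) wS.
exists (fun f => Dirichlet (Tpred f)), S; split=> //.
- move=> f; apply/val_inj/hol_eq => z z1.
  by rewrite [LHS]SE//= TE ?g1// bprod_nil mulKf// phig.
- move=> f; apply/val_inj/hol_eq => z z1.
  by rewrite [LHS]TE// bprod_nil SE ?phi1// mulVKf// gphi.
- by move=> b f h; apply: val_inj; exact: linS.
Qed.

End surjective.

Theorem theorem1p5 (R : realType) (T : dirichlet R -> hol R) :
  (bounded_blaschke_preserver T <->
   exists phi psi : hol R,
     [/\ finite_blaschke phi, finite_blaschke psi,
         ~ constant_on_disc phi & weighted_composition phi psi T]) /\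
  (forall phi psi : hol R,
     finite_blaschke phi -> finite_blaschke psi ->
     ~ constant_on_disc phi -> weighted_composition phi psi T ->
     range T = [set h : hol R | h \in dirichlet_pred] ->
     [/\ unimodular_constant psi, disc_automorphism phi &
         dirichlet_invertible T]).
Proof.
split; last by move=> phi psi; exact: onto_invertible.
split; first exact: preserver_weighted_composition.
by move=> [phi [psi [fphi fpsi ncst wT]]]; exact: weighted_composition_preserver wT.
Qed.
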